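(* Let $\mathcal{D}$ be the maximum degree of a vertex in the matching graph $M$, and let $c$ be any constant fixed in advance. There is a Monte Carlo algorithm that solves the reporting variant of Generalised Pattern Matching in $\mathcal{O}(\mathcal{D}\, n\log m\log n)$ time. The error is one-sided (only false positives are allowed: every reported position may fail to be an occurrence, but every true occurrence is reported), and the error probability is at most $1/n^c$.
   Context: Generalised Pattern Matching (GPM): the input is a text $T\in\Sigma_T^n$, a pattern $P\in\Sigma_P^m$, and a matching relationship $M\subseteq\Sigma_T\times\Sigma_P$, viewed as a bipartite graph (the matching graph) on vertex set $\Sigma_T\cup\Sigma_P$ whose edges are the matching pairs. Reporting variant: output all $i\in[n-m+1]$ such that $T[i+j-1]$ matches $P[j]$ for all $j\in[m]$. Counting variant: for each $i\in[n-m+1]$ output the number of $j\in[m]$ such that $T[i+j-1]$ does not match $P[j]$. The alphabet sizes are polynomial in $n$, and the matching graph is accessed through oracles answering in $\mathcal{O}(1)$ time: (1) whether $a\in\Sigma_T$ and $b\in\Sigma_P$ match; (2) the degree of a given character in $M$; (3) the $k$-th neighbour of a given $a\in\Sigma_T$ (for an arbitrary fixed order of neighbours). Word RAM model. *)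

(* Defs.v *)
From mathcomp Require Import all_boot all_order all_algebra.

Set Implicit Arguments.
Unset Strict Implicit.
Unset Printing Implicit Defensive.

Import Order.TTheory GRing.Theory Num.Theory.

(* max(1, floor(log2 x)): the usual logarithm of asymptotic bounds, kept
   positive so that a bound containing [lg m] is not 0 at m = 1. *)
Definition lg (x : nat) : nat := maxn 1 (trunc_log 2 x).

Definition uniform_prob (Omega : finType) (E : {set Omega}) : rat :=
  (#|E|%:R / #|Omega|%:R)%R.

(** * Generalised pattern matching *)

Section Problem.

Variables (n m sT sP : nat).
Variables (T : n.-tuple 'I_sT) (P : m.-tuple 'I_sP) (M : 'I_sT -> 'I_sP -> bool).

(* Positions are counted from 0: they are the i < n - m + 1. *)
Definition occurrence (i : nat) : bool :=
  (i < n - m + 1) &&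
  [forall j : 'I_m, forall k : 'I_n,
     (k == i + j :> nat) ==> M (tnth T k) (tnth P j)].

Definition degT (a : 'I_sT) : nat := #|[set b | M a b]|.
Definition degP (b : 'I_sP) : nat := #|[set a | M a b]|.

Definition max_degree : nat :=
  maxn (\max_(a < sT) degT a) (\max_(b < sP) degP b).

(* [nbr a] lists the neighbours of [a], without repetition, in some order. *)
Definition neighbour_order (nbr : 'I_sT -> seq 'I_sP) : Prop :=
  forall a : 'I_sT, uniq (nbr a) /\ (forall b : 'I_sP, (b \in nbr a) = M a b).

Definition valid_report (r : seq nat) : bool := all (fun i => i < n - m + 1) r.

Definition no_false_negative (r : seq nat) : bool :=
  [forall i : 'I_(n - m + 1), occurrence i ==> (val i \in r)].

Definition correct_report (r : seq nat) : bool :=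
  [forall i : 'I_(n - m + 1), (val i \in r) == occurrence i].

End Problem.

(** * A randomised word RAM with oracles *)

(* Program text is finite and never depends on the input.  Every instruction
   and every test costs one unit of time and handles O(1) words of w bits. *)

Inductive binop : Type :=
  | BAdd | BSub | BMul | BDiv | BMod | BAnd | BOr | BXor | BShl | BShr | BEq | BLt.

(* Registers are named by numbers; register arguments come destination first,
   except in [IStore x y], which writes the content of y at the address held by x. *)
Inductive instr : Type :=
  | IConst (x k : nat)
  | IBin (o : binop) (x y z : nat)
  | ILoad (x y : nat)
  | IStore (x y : nat)
  | IRand (x : nat)
  | IMatch (x a b : nat)
  | IDegT (x a : nat)
  | IDegP (x b : nat)
  | INbr (x a k : nat)
  | IReport (x : nat).

Inductive cmd : Type :=
  | CSkip
  | CDo (i : instr)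
  | CSeq (c1 c2 : cmd)
  | CIf (x : nat) (c1 c2 : cmd)
  | CWhile (x : nat) (c : cmd).

Record oracle : Type := Oracle {
  o_match : nat -> nat -> bool;
  o_degT : nat -> nat;
  o_degP : nat -> nat;
  o_nbr : nat -> nat -> nat
}.

(* [tape] is the unread part of the random tape. *)
Record state : Type := State {
  regs : nat -> nat;
  cells : nat -> nat;
  tape : seq nat;
  out : seq nat
}.

Section Semantics.

Variables (w : nat) (O : oracle).

Definition eval_binop (o : binop) (x y : nat) : nat :=
  match o with
  | BAdd => x + y
  | BSub => x + (2 ^ w - y)
  | BMul => x * y
  | BDiv => x %/ y
  | BMod => x %% y
  | BAnd => Nat.land x y
  | BOr => Nat.lor x y
  | BXor => Nat.lxor x y
  | BShl => x * 2 ^ y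
  | BShr => x %/ 2 ^ y
  | BEq => x == y
  | BLt => x < y
  end.

(* The truncation to w bits happens here, for all instructions at once. *)
Definition set_reg (s : state) (x v : nat) : state :=
  State [eta regs s with x |-> v %% 2 ^ w] (cells s) (tape s) (out s).

Definition exec (i : instr) (s : state) : state :=
  let r := regs s in
  match i with
  | IConst x k => set_reg s x k
  | IBin o x y z => set_reg s x (eval_binop o (r y) (r z))
  | ILoad x y => set_reg s x (cells s (r y))
  | IStore x y => State r [eta cells s with r x |-> r y] (tape s) (out s)
  | IRand x =>
      set_reg (State r (cells s) (behead (tape s)) (out s)) x (head 0 (tape s))
  | IMatch x a b => set_reg s x (o_match O (r a) (r b))
  | IDegT x a => set_reg s x (o_degT O (r a))
  | IDegP x b => set_reg s x (o_degP O (r b))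
  | INbr x a k => set_reg s x (o_nbr O (r a) (r k))
  | IReport x => State r (cells s) (tape s) (r x :: out s)
  end.

(* The first component is the stack of commands still to be executed; the
   machine has halted when it is empty. *)
Definition step (cf : seq cmd * state) : seq cmd * state :=
  let: (k, s) := cf in
  match k with
  | [::] => ([::], s)
  | CSkip :: k' => (k', s)
  | CDo i :: k' => (k', exec i s)
  | CSeq c1 c2 :: k' => ([:: c1, c2 & k'], s)
  | CIf x c1 c2 :: k' => ((if regs s x != 0 then c1 else c2) :: k', s)
  | CWhile x c :: k' =>
      if regs s x != 0 then ([:: c, CWhile x c & k'], s) else (k', s)
  end.

Definition run (p : cmd) (s : state) (t : nat) : seq cmd * state :=
  iter t step ([:: p], s).

End Semantics.

(** * Running a program on a pattern matching instance *)

Section Instance.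

Variables (n m sT sP : nat).
Variables (T : n.-tuple 'I_sT) (P : m.-tuple 'I_sP) (M : 'I_sT -> 'I_sP -> bool).
Variable nbr : 'I_sT -> seq 'I_sP.

(* The answer is 0 when an argument is not a character, or in [o_nbr] when
   [k], counted from 0, is not smaller than the degree. *)
Definition gpm_oracle : oracle := {|
  o_match a b :=
    if (insub a, insub b) is (Some a', Some b') then M a' b' else false;
  o_degT a := if insub a is Some a' then degT M a' else 0;
  o_degP b := if insub b is Some b' then degP M b' else 0;
  o_nbr a k := if insub a is Some a' then nth 0 (map val (nbr a')) k else 0
|}.

(* Registers 0 to 3 hold the sizes; T is stored at addresses 0, ..., n - 1 and
   P at n, ..., n + m - 1; all other registers and cells are 0. *)
Definition init (rnd : seq nat) : state := {|
  regs := nth 0 [:: n; m; sT; sP];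
  cells := nth 0 (map val T ++ map val P);
  tape := rnd;
  out := [::]
|}.

(* In t steps at most t random words are read, so a uniform element of
   [t.-tuple 'I_(2 ^ w)] provides all the randomness of a t-step run. *)
Definition gpm_run (w : nat) (p : cmd) (t : nat) (rnd : t.-tuple 'I_(2 ^ w)) :
    seq cmd * state :=
  run w gpm_oracle p (init (map val rnd)) t.

Definition halts (w : nat) (p : cmd) (t : nat) (rnd : t.-tuple 'I_(2 ^ w)) :
    bool :=
  nilp (gpm_run p rnd).1.

Definition report (w : nat) (p : cmd) (t : nat) (rnd : t.-tuple 'I_(2 ^ w)) :
    seq nat :=
  out (gpm_run p rnd).2.

End Instance.

(* Main.v *)
Require Import Defs.
From mathcomp Require Import all_boot all_order all_algebra all_field zify ring.

(* If some text character has at least m neighbours, the naive algorithm is fast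
   enough.  Otherwise let D < m be the largest degree of a text character, and
   hash the characters to 2 ^ l >= 4 D + 1 values by a multiply-shift function
   drawn from one random word.  Call T_i and P_j compatible when the hash value of
   P_j is that of some neighbour of T_i: matching pairs are always compatible, and
   a mismatching pair is compatible with probability at most 2 D / 2 ^ l <= 1 / 2.
   Expand each text character to 2 ^ l bits that mark the hash values of no
   neighbour, and each pattern character to the indicator of its hash value: the
   number of incompatible pairs at each shift is then a correlation of a word of
   length O(D n) with one of length O(D m).  Blocks of length O(D m) = O(m ^ 2)
   and a fast Fourier transform compute it in O(D n log m) steps, in fixed-point
   complex arithmetic with O(log n) bits, precise enough to tell 0 from 1.
   A shift is reported when it survives (c + 1) lgn n independent rounds; a
   non-occurrence survives with probability at most 1 / n ^ (c + 1), and the union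
   bound over the shifts gives 1 / n ^ c. *)

Set Implicit Arguments.
Unset Strict Implicit.
Unset Printing Implicit Defensive.

Import Order.TTheory GRing.Theory Num.Theory.

(** * Compiling integer programs to machine code *)

(** The naive branch is affordable because n m is at most n D there. Precision is what shapes the
    numerical part. Roots of unity come from half-angle formulas and integer square roots. For
    cosines the root is taken away from 0, and the error grows by one unit per level; for sines it
    may be taken near 0, which costs half of the digits. Hence the scale is a square, S = sg ^ 2,
    every later error is a constant times a power of N times sg, and [sg_big] leaves room for N ^ 7.
    Decimation lists the roots in bit-reversed order. The inverse passes undo the forward ones in
    the opposite order, so no permutation is ever carried out. They also skip the division by N: a
    count c is read as roughly c N S, and the test is made against N S / 2. The text and the pattern
    are blocks of one vector, so a single forward transform serves both. The random multiplier of
    the hash function may be even: the hashed words have at least as many spare bits as a character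
    has bits, which compensates for the powers of 2 dividing a difference of characters. *)

Inductive expr : Type :=
  | EReg (x : nat)
  | ECst (k : nat)
  | EBin (o : binop) (e1 e2 : expr)
  | EArr (a : nat) (e : expr)
  | EInp (e : expr)
  | EMatch (e1 e2 : expr)
  | EDegT (e : expr)
  | ENbr (e1 e2 : expr).

(** Counted loops are the only iteration and their bound is evaluated once, so that meaning, safety
    and running time can all be defined by structural recursion. *)
Inductive prog : Type :=
  | PAsg (x : nat) (e : expr)
  | PSt (a : nat) (e1 e2 : expr)
  | PRand (x : nat)
  | PRep (e : expr)
  | PSeq (p q : prog)
  | PIf (e : expr) (p q : prog)
  | PSkip
  | PFor (x : nat) (e : expr) (p : prog).

(** An idealised state: values are unbounded signed integers, of which the machine stores residues
    modulo 2 ^ w. *)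
Record ist : Type := IS {
  env : nat -> int;
  arr : nat -> int -> int;
  itape : seq nat;
  iout : seq nat
}.

Definition upd (A : eqType) (B : Type) (f : A -> B) (x : A) (v : B) : A -> B :=
  fun y => if y == x then v else f y.

Definition setr (s : ist) x v := IS (upd (env s) x v) (arr s) (itape s) (iout s).
Definition seta (s : ist) a i v :=
  IS (env s) (upd (arr s) a (upd (arr s a) i v)) (itape s) (iout s).

(* Register use of the compiled code: variables are registers below 50, the
   bound of the loop on [x] is kept in register [50 + x], registers from 100 on
   are temporaries.  Register 99 holds the length of the input; entry i of array
   a is the cell 16 (base + i) + a, where base is that length. *)
Section Compile.

(** Registers serve as a stack: the value goes to register [t], and only registers from [t] on are
    overwritten. *)
Fixpoint cexp (e : expr) (t : nat) : cmd :=
  match e with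
  | EReg x => CSeq (CDo (IConst t 0)) (CDo (IBin BAdd t t x))
  | ECst k => CDo (IConst t k)
  | EBin o e1 e2 =>
      CSeq (cexp e1 t) (CSeq (cexp e2 t.+1) (CDo (IBin o t t t.+1)))
  | EArr a e =>
      CSeq (cexp e t) (CSeq (CDo (IBin BAdd t t 99))
        (CSeq (CDo (IConst t.+1 16)) (CSeq (CDo (IBin BMul t t t.+1))
          (CSeq (CDo (IConst t.+1 a)) (CSeq (CDo (IBin BAdd t t t.+1))
            (CDo (ILoad t t)))))))
  | EInp e => CSeq (cexp e t) (CDo (ILoad t t))
  | EMatch e1 e2 =>
      CSeq (cexp e1 t) (CSeq (cexp e2 t.+1) (CDo (IMatch t t t.+1)))
  | EDegT e => CSeq (cexp e t) (CDo (IDegT t t))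
  | ENbr e1 e2 =>
      CSeq (cexp e1 t) (CSeq (cexp e2 t.+1) (CDo (INbr t t t.+1)))
  end.

Fixpoint ecost (e : expr) : nat :=
  match e with
  | EReg _ => 3
  | ECst _ => 1
  | EBin _ e1 e2 | EMatch e1 e2 | ENbr e1 e2 => ecost e1 + ecost e2 + 3
  | EArr _ e => ecost e + 12
  | EInp e | EDegT e => ecost e + 2
  end.

Definition cmov (x y : nat) : cmd :=
  CSeq (CDo (IConst x 0)) (CDo (IBin BAdd x x y)).

Fixpoint comp (p : prog) : cmd :=
  match p with
  | PAsg x e => CSeq (cexp e 100) (cmov x 100)
  | PSt a e1 e2 =>
      CSeq (cexp e2 100) (CSeq (cexp e1 101) (CSeq (CDo (IBin BAdd 101 101 99))
        (CSeq (CDo (IConst 102 16)) (CSeq (CDo (IBin BMul 101 101 102))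
          (CSeq (CDo (IConst 102 a)) (CSeq (CDo (IBin BAdd 101 101 102))
            (CDo (IStore 101 100))))))))
  | PRand x => CDo (IRand x)
  | PRep e => CSeq (cexp e 100) (CDo (IReport 100))
  | PSeq p q => CSeq (comp p) (comp q)
  | PIf e p q => CSeq (cexp e 100) (CIf 100 (comp p) (comp q))
  | PSkip => CSkip
  | PFor x e p =>
      let test := CDo (IBin BLt 100 x (50 + x)) in
      CSeq (cexp e 100) (CSeq (cmov (50 + x) 100) (CSeq (CDo (IConst x 0))
        (CSeq test
          (CWhile 100 (CSeq (comp p) (CSeq (CDo (IConst 100 1))
             (CSeq (CDo (IBin BAdd x x 100)) test)))))))
  end.

Fixpoint writes (p : prog) : seq nat :=
  match p with
  | PAsg x _ | PRand x => [:: x]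
  | PSeq p q | PIf _ p q => writes p ++ writes q
  | PFor x _ p => x :: writes p
  | _ => [::]
  end.

Fixpoint awrites (p : prog) : seq nat :=
  match p with
  | PSt a _ _ => [:: a]
  | PSeq p q | PIf _ p q => awrites p ++ awrites q
  | PFor _ _ p => awrites p
  | _ => [::]
  end.

Fixpoint loops (p : prog) : seq nat :=
  match p with
  | PSeq p q | PIf _ p q => loops p ++ loops q
  | PFor x _ p => x :: loops p
  | _ => [::]
  end.

Fixpoint wfe (e : expr) : bool :=
  match e with
  | EReg x => x < 50
  | ECst _ => true
  | EBin _ e1 e2 | EMatch e1 e2 | ENbr e1 e2 => wfe e1 && wfe e2
  | EArr a e => (a < 16) && wfe e
  | EInp e | EDegT e => wfe e
  end.

(** The loop condition protects the loop registers: a counter below 49 keeps [50 + x] below 99,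
    where the input length is stored, and the body neither assigns the counter nor reuses it in an
    inner loop. *)
Fixpoint wf (p : prog) : bool :=
  match p with
  | PAsg x e => (x < 50) && wfe e
  | PRand x => x < 50
  | PRep e => wfe e
  | PSt a e1 e2 => [&& a < 16, wfe e1 & wfe e2]
  | PSeq p q => wf p && wf q
  | PIf e p q => [&& wfe e, wf p & wf q]
  | PSkip => true
  | PFor x e p => [&& x < 49, wfe e, wf p, x \notin writes p & x \notin loops p]
  end.

End Compile.

Section Semantics.

Variables (w : nat) (O : oracle) (inp : nat -> nat) (base lim : nat).

Definition inw (z : int) : bool := (0 <= z)%R && (z < (Posz (2 ^ w)))%R.

Definition ibin (o : binop) (x y : int) : int :=
  match o with
  | BAdd => (x + y)%R
  | BSub => (x - y)%R
  | BMul => (x * y)%R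
  | BDiv => (x %/ y)%Z
  | BMod => (x %% y)%Z
  | BShl => (x * Posz (2 ^ `|y|))%R
  | BEq => Posz (x == y)
  | BLt => Posz (x < y)%R
  | _ => 0%R
  end.

(** Sums, differences and products commute with reduction modulo 2 ^ w and need no range. Quotients,
    remainders and comparisons do not, so their operands must be genuine words; for a shift this is
    asked of the amount only. *)
Definition ibin_ok (o : binop) (x y : int) : bool :=
  match o with
  | BAdd | BSub | BMul => true
  | BDiv | BMod | BEq | BLt => inw x && inw y
  | BShl => inw y
  | _ => false
  end.

Fixpoint eval (e : expr) (s : ist) : int :=
  match e with
  | EReg x => env s x
  | ECst k => (Posz k)
  | EBin o e1 e2 => ibin o (eval e1 s) (eval e2 s)
  | EArr a e => arr s a (eval e s)
  | EInp e => Posz (inp `|eval e s|)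
  | EMatch e1 e2 => Posz (o_match O `|eval e1 s| `|eval e2 s|)
  | EDegT e => Posz (o_degT O `|eval e s|)
  | ENbr e1 e2 => Posz (o_nbr O `|eval e1 s| `|eval e2 s|)
  end.

Definition inidx (z : int) : bool := (0 <= z)%R && (z < (Posz lim))%R.

Fixpoint eok (e : expr) (s : ist) : bool :=
  match e with
  | EReg x => true
  | ECst k => true
  | EBin o e1 e2 => [&& eok e1 s, eok e2 s & ibin_ok o (eval e1 s) (eval e2 s)]
  | EArr a e => eok e s && inidx (eval e s)
  | EInp e => [&& eok e s, (0 <= eval e s)%R & (eval e s < (Posz base))%R]
  | EMatch e1 e2 | ENbr e1 e2 =>
      [&& eok e1 s, eok e2 s, inw (eval e1 s) & inw (eval e2 s)]
  | EDegT e => eok e s && inw (eval e s)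
  end.

(** After a loop the counter equals the bound, as in the compiled code, where the last increment
    makes the test fail. *)
Fixpoint sem (p : prog) (s : ist) : ist :=
  match p with
  | PAsg x e => setr s x (eval e s)
  | PSt a e1 e2 => seta s a (eval e1 s) (eval e2 s)
  | PRand x => IS (upd (env s) x (Posz (head 0 (itape s)))) (arr s)
                  (behead (itape s)) (iout s)
  | PRep e => IS (env s) (arr s) (itape s) (`|eval e s|%N :: iout s)
  | PSeq p q => sem q (sem p s)
  | PIf e p q => if eval e s != 0%R then sem p s else sem q s
  | PSkip => s
  | PFor x e p =>
      let n := `|eval e s|%N in
      setr (iteri n (fun i s' => sem p (setr s' x (Posz i))) s) x (Posz n)
  end.

Definition loop x p s i := iteri i (fun i s' => sem p (setr s' x (Posz i))) s.

Fixpoint ok (p : prog) (s : ist) : Prop :=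
  match p with
  | PAsg x e => eok e s
  | PSt a e1 e2 => [&& eok e1 s, eok e2 s & inidx (eval e1 s)]
  | PRand x => True
  | PRep e => eok e s && inw (eval e s)
  | PSeq p q => ok p s /\ ok q (sem p s)
  | PIf e p q => eok e s && inw (eval e s) /\
      if eval e s != 0%R then ok p s else ok q s
  | PSkip => True
  | PFor x e p => eok e s && inw (eval e s) /\
      forall i, i < `|eval e s| -> ok p (setr (loop x p s i) x (Posz i))
  end.

Fixpoint cost (p : prog) (s : ist) : nat :=
  match p with
  | PAsg x e => ecost e + 4
  | PSt a e1 e2 => ecost e1 + ecost e2 + 13
  | PRand x => 1
  | PRep e => ecost e + 2
  | PSeq p q => cost p s + cost q (sem p s) + 1
  | PIf e p q => ecost e + 2 + (if eval e s != 0%R then cost p s else cost q s)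
  | PSkip => 1
  | PFor x e p =>
      ecost e + 10 +
      \sum_(i < `|eval e s|) (cost p (setr (loop x p s i) x (Posz i)) + 7)
  end.

Definition rep (z : int) : nat := `|(z %% (Posz (2 ^ w)))%Z|%N.

Lemma rep_nat (n : nat) : rep (Posz n) = n %% 2 ^ w.
Proof. by rewrite /rep modz_nat. Qed.

Lemma repE (z : int) : Posz (rep z) = (z %% (Posz (2 ^ w)))%Z.
Proof. by rewrite /rep gez0_abs // modz_ge0 // eqz_nat -lt0n expn_gt0. Qed.

Lemma rep_inw (z : int) : inw z -> rep z = `|z|%N.
Proof. by case/andP=> h0 h1; rewrite /rep modz_small // h0. Qed.

Lemma rep_inwE (z : int) : inw z -> z = Posz (rep z).
Proof. by move=> h; rewrite rep_inw //; case/andP: h => h _; rewrite gez0_abs. Qed.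

Lemma rep_lt (z : int) : rep z < 2 ^ w.
Proof. by rewrite -ltz_nat repE ltz_pmod // ltz_nat expn_gt0. Qed.

Lemma repP (z : int) (n : nat) :
  ((Posz n) = z %[mod (Posz (2 ^ w))])%Z -> n %% 2 ^ w = rep z.
Proof. by move=> h; rewrite -rep_nat /rep h. Qed.

Lemma rep_mod (z : int) : (Posz (rep z) = z %[mod (Posz (2 ^ w))])%Z.
Proof. by rewrite repE modz_mod. Qed.

Lemma eqzmodD (a b c e d : int) : (a = b %[mod d] -> c = e %[mod d] ->
  a + c = b + e %[mod d])%Z.
Proof. by move=> h1 h2; rewrite -modzDm h1 h2 modzDm. Qed.

Lemma eqzmodM (a b c e d : int) : (a = b %[mod d] -> c = e %[mod d] ->
  a * c = b * e %[mod d])%Z.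
Proof. by move=> h1 h2; rewrite -modzMm h1 h2 modzMm. Qed.

Lemma eqzmodN (a b d : int) : (a = b %[mod d] -> - a = - b %[mod d])%Z.
Proof. by move=> h; rewrite -modzNm h modzNm. Qed.

Lemma eval_binop_rep o x y :
  ibin_ok o x y -> eval_binop w o (rep x) (rep y) %% 2 ^ w = rep (ibin o x y).
Proof.
case: o => //=.
- by move=> _; apply: repP; rewrite PoszD; apply: eqzmodD; apply: rep_mod.
(* The machine adds 2 ^ w - y, a true difference because y is a word, and this is - y modulo 2 ^
   w. *)
- move=> _; apply: repP; rewrite PoszD -subzn; last exact/ltnW/rep_lt.
  rewrite addrCA modzDl; apply: eqzmodD; first exact: rep_mod.
  by apply: eqzmodN; apply: rep_mod.
- by move=> _; apply: repP; rewrite PoszM; apply: eqzmodM; apply: rep_mod.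
- case/andP=> hx hy; apply: repP.
  by congr (_ %% _)%Z; rewrite [in RHS](rep_inwE hx) [in RHS](rep_inwE hy) divz_nat.
- case/andP=> hx hy; apply: repP.
  by congr (_ %% _)%Z; rewrite [in RHS](rep_inwE hx) [in RHS](rep_inwE hy) modz_nat.
- move=> hy; apply: repP.
  by rewrite PoszM (rep_inw hy); apply: eqzmodM => //; apply: rep_mod.
- case/andP=> hx hy; apply: repP.
  by congr (_ %% _)%Z; rewrite [in RHS](rep_inwE hx) [in RHS](rep_inwE hy).
- case/andP=> hx hy; apply: repP.
  by congr (_ %% _)%Z; rewrite [in RHS](rep_inwE hx) [in RHS](rep_inwE hy).
Qed.

(** Quantifying over the rest [k] of the stack makes executions compose. *)
Definition steps (c : cmd) (s : state) (t : nat) (s' : state) : Prop :=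
  forall k, iter t (step w O) (c :: k, s) = (k, s').

Lemma steps_do i s : steps (CDo i) s 1 (exec w O i s).
Proof. by []. Qed.

Lemma steps_skip s : steps CSkip s 1 s.
Proof. by []. Qed.

Lemma steps_seq c1 c2 s1 s2 s3 t1 t2 :
  steps c1 s1 t1 s2 -> steps c2 s2 t2 s3 -> steps (CSeq c1 c2) s1 (t1 + t2 + 1) s3.
Proof.
move=> h1 h2 k; rewrite iterD /= addnC iterD.
by rewrite h1 h2.
Qed.

Lemma steps_if x c1 c2 s t s' :
  steps (if regs s x != 0 then c1 else c2) s t s' -> steps (CIf x c1 c2) s t.+1 s'.
Proof. by move=> h k; rewrite -addn1 iterD /= h. Qed.

Lemma steps_while0 x c s : regs s x = 0 -> steps (CWhile x c) s 1 s.
Proof. by move=> h k /=; rewrite h. Qed.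

Lemma steps_while1 x c s s1 s' t t' : regs s x != 0 ->
  steps c s t s1 -> steps (CWhile x c) s1 t' s' ->
  steps (CWhile x c) s (t + t' + 1) s'.
Proof.
by move=> h h1 h2 k; rewrite iterD /= h addnC iterD h1 h2.
Qed.

Lemma steps_eq c s t s' u : steps c s t s' -> t = u -> steps c s u s'.
Proof. by move=> h <-. Qed.

Hypothesis base0 : 0 < base.
Hypothesis mem_ok : 16 * (base + lim) <= 2 ^ w.
Hypothesis base_w : 16 < 2 ^ w.
Hypothesis inp_w : forall i, i < base -> inp i < 2 ^ w.

(** Array cells start at address 16 base, above the input, and the residue modulo 16 of an address
    identifies its array: stores never disturb the input or another array. *)
Definition rel (s : ist) (m : state) : Prop :=
  [/\ forall x, x < 50 -> regs m x = rep (env s x),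
      regs m 99 = base,
      forall a i, a < 16 -> i < lim ->
        cells m (16 * (base + i) + a) = rep (arr s a (Posz i)),
      forall i, i < base -> cells m i = inp i
    & tape m = itape s /\ out m = iout s].

Definition ceval_post (m : state) (t v : nat) (m' : state) : Prop :=
  [/\ regs m' t = v, forall z, z < t -> regs m' z = regs m z,
      cells m' = cells m & tape m' = tape m /\ out m' = out m].

Lemma rel_post s m t v m' : 100 <= t -> rel s m -> ceval_post m t v m' -> rel s m'.
Proof.
move=> ht hr [h1 h2 h3 [h4 h5]].
case: hr => r1 r2 r3 r4 [r5 r6]; split.
- by move=> x hx; rewrite h2 ?r1 //; lia.
- by rewrite h2 ?r2.
- by move=> *; rewrite h3 r3.
- by move=> *; rewrite h3 r4.
- by rewrite h4 h5.
Qed.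

Lemma addr_small a i : a < 16 -> i < lim -> 16 * (base + i) + a < 2 ^ w.
Proof. by move=> ha hi; nia. Qed.

(** The clause of [ceval_post] on registers below [t] carries the induction: it keeps the first
    operand intact while the second one is computed in [t.+1]. *)
Lemma cexp_correct e s m t : wfe e -> eok e s -> rel s m -> 100 <= t ->
  exists m', steps (cexp e t) m (ecost e) m' /\
             ceval_post m t (rep (eval e s)) m'.
Proof.
elim: e t m => [x|k|o e1 IH1 e2 IH2|a e IH|e IH|e1 IH1 e2 IH2|e IH|e1 IH1 e2 IH2]
  t m /=.
- move=> hx _ hr ht; eexists; split; first exact: steps_seq (steps_do _ _) (steps_do _ _).
  split=> //=.
    case: hr => h _ _ _ _; rewrite eqxx [x == t]ltn_eqF; last by lia.
    by rewrite h // mod0n add0n modn_small ?rep_lt.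
  by move=> z hz; rewrite ltn_eqF.
- move=> _ _ hr ht; eexists; split; first exact: steps_do.
  split=> //=; first by rewrite eqxx rep_nat.
  by move=> z hz; rewrite ltn_eqF.
- case/andP=> w1 w2 /and3P [k1 k2 k3] hr ht.
  have [m1 [c1 p1]] := IH1 t m w1 k1 hr ht.
  have hr1 := rel_post ht hr p1.
  have [m2 [c2 p2]] := IH2 t.+1 m1 w2 k2 hr1 (ltnW ht).
  case: p1 p2 => a1 a2 a3 [a4 a5] [b1 b2 b3 [b4 b5]].
  eexists; split.
    apply: (steps_eq (steps_seq c1 (steps_seq c2 (steps_do _ _)))); lia.
  split=> /=.
  + by rewrite eqxx b1 b2 // a1 eval_binop_rep.
  + by move=> z hz; rewrite ltn_eqF // b2 ?a2 // ltnW.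
  + by rewrite b3.
  + by rewrite b4 b5.
- case/andP=> w1 w2 /andP [k1 /andP [k2 k3]] hr ht.
  have [m1 [c1 p1]] := IH t m w2 k1 hr ht.
  have hr1 := rel_post ht hr p1.
  case: p1 => a1 a2 a3 [a4 a5].
  eexists; split.
    apply: (steps_eq (steps_seq c1 (steps_seq (steps_do _ _) (steps_seq (steps_do _ _)
     (steps_seq (steps_do _ _) (steps_seq (steps_do _ _) (steps_seq (steps_do _ _)
     (steps_do _ _)))))))); lia.
  split=> //=.
  + case: hr1 => _ h99 hc _ _.
    have e1: (99 == t) = false by lia.
    have e2: (t == t.+1) = false by lia.
    have e3: (t.+1 == t) = false by lia.
    set i := `|eval e s|%N.
    have ei : eval e s = Posz i by rewrite gez0_abs.
    have il : i < lim by move: k3; rewrite ei; lia.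
    have hi : i + base < 2 ^ w by nia.
    have ri : rep (eval e s) = i by rewrite ei rep_nat modn_small //; lia.
    rewrite ?(e1, e2, e3, eqxx) a1 h99 ri (modn_small hi) (modn_small base_w).
    have hi2 : (i + base) * 16 < 2 ^ w by nia.
    have ha : a < 2 ^ w by lia.
    rewrite (modn_small hi2) (modn_small ha).
    have hi3 := addr_small w1 il.
    have -> : (i + base) * 16 + a = 16 * (base + i) + a by lia.
    by rewrite (modn_small hi3) hc // ei modn_small // rep_lt.
  + move=> z hz.
    have -> : (z == t) = false by lia.
    have -> : (z == t.+1) = false by lia.
    exact: a2.
- move=> w1 /and3P [k1 k2 k3] hr ht.
  have [m1 [c1 p1]] := IH t m w1 k1 hr ht.
  have hr1 := rel_post ht hr p1.
  case: p1 => a1 a2 a3 [a4 a5].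
  eexists; split.
    apply: (steps_eq (steps_seq c1 (steps_do _ _))); lia.
  split=> //=.
  + case: hr1 => _ _ _ hi _.
    set i := `|eval e s|%N.
    have ei : eval e s = Posz i by rewrite gez0_abs.
    have il : i < base by move: k3; rewrite ei; lia.
    have ri : rep (eval e s) = i by rewrite ei rep_nat modn_small //; lia.
    by rewrite eqxx a1 ri hi // rep_nat.
  + move=> z hz.
    have -> : (z == t) = false by lia.
    exact: a2.
- case/andP=> w1 w2 /and4P [k1 k2 k3 k4] hr ht.
  have [m1 [c1 p1]] := IH1 t m w1 k1 hr ht.
  have hr1 := rel_post ht hr p1.
  have [m2 [c2 p2]] := IH2 t.+1 m1 w2 k2 hr1 (ltnW ht).
  case: p1 p2 => a1 a2 a3 [a4 a5] [b1 b2 b3 [b4 b5]].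
  eexists; split.
    apply: (steps_eq (steps_seq c1 (steps_seq c2 (steps_do _ _)))); lia.
  split=> /=.
  + by rewrite eqxx b1 b2 // a1 (rep_inw k3) (rep_inw k4) rep_nat.
  + by move=> z hz; rewrite ltn_eqF // b2 ?a2 // ltnW.
  + by rewrite b3.
  + by rewrite b4 b5.
- move=> w1 /andP [k1 k2] hr ht.
  have [m1 [c1 p1]] := IH t m w1 k1 hr ht.
  have hr1 := rel_post ht hr p1.
  case: p1 => a1 a2 a3 [a4 a5].
  eexists; split.
    apply: (steps_eq (steps_seq c1 (steps_do _ _))); lia.
  split=> //=.
  + by rewrite eqxx a1 (rep_inw k2) rep_nat.
  + by move=> z hz; rewrite ltn_eqF // a2.
- case/andP=> w1 w2 /and4P [k1 k2 k3 k4] hr ht.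
  have [m1 [c1 p1]] := IH1 t m w1 k1 hr ht.
  have hr1 := rel_post ht hr p1.
  have [m2 [c2 p2]] := IH2 t.+1 m1 w2 k2 hr1 (ltnW ht).
  case: p1 p2 => a1 a2 a3 [a4 a5] [b1 b2 b3 [b4 b5]].
  eexists; split.
    apply: (steps_eq (steps_seq c1 (steps_seq c2 (steps_do _ _)))); lia.
  split=> /=.
  + by rewrite eqxx b1 b2 // a1 (rep_inw k3) (rep_inw k4) rep_nat.
  + by move=> z hz; rewrite ltn_eqF // b2 ?a2 // ltnW.
  + by rewrite b3.
  + by rewrite b4 b5.
Qed.

Lemma rel_setr s m x (v : int) r : rel s m -> x < 50 -> r x = rep v ->
  (forall z, z < 50 -> z != x -> r z = regs m z) -> r 99 = regs m 99 ->
  rel (setr s x v) (State r (cells m) (tape m) (out m)).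
Proof.
case=> h1 h2 h3 h4 h5 hx hv hz h99; split=> //=; last by rewrite h99.
move=> z lz; rewrite /upd; case: eqP => [->//|/eqP ne].
by rewrite hz // h1.
Qed.

Definition bound_regs (p : prog) := [seq 50 + x | x <- loops p].

(** [rel] is silent on registers 50 to 98, which hold the bounds of the enclosing loops; this clause
    lets them survive the execution of a body. *)
Definition keeps (p : prog) (m m' : state) : Prop :=
  forall z, 50 <= z < 99 -> z \notin bound_regs p -> regs m' z = regs m z.

Lemma comp_correct p s m : wf p -> ok p s -> rel s m ->
  exists m', [/\ steps (comp p) m (cost p s) m', rel (sem p s) m' & keeps p m m'].
Proof.
elim: p s m => [x e|a e1 e2|x|e|p IHp q IHq|e p IHp q IHq||x e p IHp] s m /=.
- case/andP=> hx w1 k1 hr.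
  have [m1 [c1 p1]] := cexp_correct w1 k1 hr (leqnn _).
  have hr1 := rel_post (leqnn _) hr p1.
  case: p1 => a1 a2 a3 [a4 a5].
  eexists; split.
  + apply: (steps_eq (steps_seq c1 (steps_seq (steps_do _ _) (steps_do _ _)))); lia.
  + apply: (rel_setr hr1) => //=.
    * rewrite !eqxx (_ : (100 == x) = false); last by lia.
      by rewrite a1 mod0n add0n modn_small // rep_lt.
    * by move=> z hz /negbTE ->.
    * by rewrite (_ : (99 == x) = false) //; lia.
  + move=> z hz _ /=.
    rewrite (_ : (z == x) = false); last by lia.
    by rewrite a2 //; lia.
- case/and3P=> wa w1 w2 /and3P [k1 k2 /andP[k3 k4]] hr.
  have [m1 [c1 p1]] := cexp_correct w2 k2 hr (leqnn _).
  have hr1 := rel_post (leqnn _) hr p1.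
  have [m2 [c2 p2]] := cexp_correct w1 k1 hr1 (leqnSn _).
  have hr2 := rel_post (leqnSn _) hr1 p2.
  case: p1 p2 => a1 a2 a3 [a4 a5] [b1 b2 b3 [b4 b5]].
  eexists; split.
  + apply: (steps_eq (steps_seq c1 (steps_seq c2 (steps_seq (steps_do _ _) (steps_seq (steps_do _ _)
     (steps_seq (steps_do _ _) (steps_seq (steps_do _ _) (steps_seq (steps_do _ _)
     (steps_do _ _))))))))); lia.
  + case: hr2 => q1 q2 q3 q4 [q5 q6].
    set i := `|eval e1 s|%N.
    have ei : eval e1 s = Posz i by rewrite gez0_abs.
    have il : i < lim by move: k4; rewrite ei; lia.
    have hi : i + base < 2 ^ w by nia.
    have ri : rep (eval e1 s) = i by rewrite ei rep_nat modn_small //; lia.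
    have hi2 : (i + base) * 16 < 2 ^ w by nia.
    have ha : a < 2 ^ w by lia.
    have hi3 := addr_small wa il.
    have ea : (i + base) * 16 + a = 16 * (base + i) + a by lia.
    split=> //=.
    * by move=> z hz; rewrite !ifF ?q1 //; lia.
    * move=> a' i' ha' hi'.
      rewrite b1 q2 b2 // a1 ri (modn_small hi) (modn_small base_w)
        (modn_small hi2) (modn_small ha) ea (modn_small hi3).
      rewrite /upd; case: (altP (a' =P a)) => [->|ne].
        rewrite ei; case: (altP (Posz i' =P Posz i)) => [[->]|ne].
          by rewrite eqxx.
        by rewrite ifF ?q3 //; lia.
      by rewrite ifF ?q3 //; lia.
    * move=> i' hi'; rewrite b1 q2 ri (modn_small hi) (modn_small base_w)
        (modn_small hi2) (modn_small ha) ea (modn_small hi3).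
      by rewrite ifF ?q4 //; lia.
  + move=> z hz _ /=.
    rewrite !ifF; try lia.
    rewrite b2 ?a2 //; lia.
- move=> hx _ hr; eexists; split; first exact: steps_do.
  + case: hr => h1 h2 h3 h4 [h5 h6]; split=> //=.
    * move=> z hz; rewrite /upd; case: eqP => _; last exact: h1.
      by rewrite h5 rep_nat.
    * by rewrite ifF ?h2 //; lia.
    * by rewrite h5.
  + by move=> z hz _ /=; rewrite ifF //; lia.
- move=> w1 /andP [k1 k2] hr.
  have [m1 [c1 p1]] := cexp_correct w1 k1 hr (leqnn _).
  have hr1 := rel_post (leqnn _) hr p1.
  case: p1 => a1 a2 a3 [a4 a5].
  eexists; split.
  + apply: (steps_eq (steps_seq c1 (steps_do _ _))); lia.
  + case: hr1 => q1 q2 q3 q4 [q5 q6].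
    by split=> //=; rewrite a1 rep_inw // q6.
  + by move=> z hz _ /=; rewrite a2 //; lia.
- case/andP=> w1 w2 [k1 k2] hr.
  have [m1 [c1 r1 f1]] := IHp s m w1 k1 hr.
  have [m2 [c2 r2 f2]] := IHq _ m1 w2 k2 r1.
  exists m2; split=> //; first exact: steps_seq c1 c2.
  move=> z hz; rewrite /bound_regs /= map_cat mem_cat negb_or => /andP [h1 h2].
  by rewrite f2 // f1.
- case/and3P=> we w1 w2 [/andP [k1 k2] k3] hr.
  have [m1 [c1 p1]] := cexp_correct we k1 hr (leqnn _).
  have hr1 := rel_post (leqnn _) hr p1.
  case: p1 => a1 a2 a3 [a4 a5].
  have cond : (regs m1 100 != 0) = (eval e s != 0%R).
    by rewrite a1 rep_inw // absz_eq0.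
  case: (boolP (eval e s != 0%R)) k3 => he k3.
  + have [m2 [c2 r2 f2]] := IHp s m1 w1 k3 hr1.
    exists m2; split=> //.
    * apply: (steps_eq (steps_seq c1 (steps_if _))); first by rewrite cond he; exact: c2.
      by lia.
    * move=> z hz; rewrite /bound_regs /= map_cat mem_cat negb_or => /andP [h1 h2].
      by rewrite f2 // a2 //; lia.
  + have [m2 [c2 r2 f2]] := IHq s m1 w2 k3 hr1.
    exists m2; split=> //.
    * apply: (steps_eq (steps_seq c1 (steps_if _))); first by rewrite cond (negbTE he); exact: c2.
      by lia.
    * move=> z hz; rewrite /bound_regs /= map_cat mem_cat negb_or => /andP [h1 h2].
      by rewrite f2 // a2 //; lia.
- move=> _ _ hr; exists m; split=> //; exact: steps_skip.
- case/and5P=> hx we w1 xw xl [/andP [k1 k2] k3] hr.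
  have hx5 : x < 50 by lia.
  have [m1 [c1 p1]] := cexp_correct we k1 hr (leqnn _).
  have hr1 := rel_post (leqnn _) hr p1.
  case: p1 => a1 a2 a3 [a4 a5].
  have hn : eval e s = Posz `|eval e s| by case/andP: k2 => k2 _; rewrite gez0_abs.
  have hnw : `|eval e s|%N < 2 ^ w by case/andP: k2 => _; rewrite hn; lia.
  rewrite rep_inw // in a1.
  move: hnw a1 k3; set n := `|eval e s|%N => hnw a1 k3.
  set tst := CDo (IBin BLt 100 x (50 + x)).
  set body := CSeq (comp p) _.
  pose st0 := exec w O (IBin BLt 100 x (50 + x)) (exec w O (IConst x 0)
    (exec w O (IBin BAdd (50 + x) (50 + x) 100) (exec w O (IConst (50 + x) 0) m1))).
  (* Induction on the number [j] of remaining iterations; register 100 holds the pending test. *)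
  have main : forall j i mi, i + j = n ->
     rel (setr (loop x p s i) x (Posz i)) mi -> regs mi (50 + x) = n ->
     regs mi 100 = (i < n) ->
     exists m', [/\ steps (CWhile 100 body) mi
       (\sum_(i <= l < n) (cost p (setr (loop x p s l) x (Posz l)) + 7) + 1) m',
       rel (setr (loop x p s n) x (Posz n)) m' &
       forall z, 50 <= z < 99 -> z \notin bound_regs p -> regs m' z = regs mi z].
    elim=> [|j IHj] i mi hij ri bi ti.
      rewrite addn0 in hij; exists mi; split=> //.
        rewrite hij big_geq // add0n; apply: steps_while0.
        by rewrite ti hij ltnn.
      by rewrite -hij.
    have lin : i < n by lia.
    have [m2 [c2 r2 f2]] := IHp _ mi w1 (k3 i lin) ri.
    have [r21 r22 r23 r24 [r25 r26]] := r2.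
    pose m3 := exec w O (IBin BAdd x x 100) (exec w O (IConst 100 1) m2).
    pose m4 := exec w O (IBin BLt 100 x (50 + x)) m3.
    (* Needed to know that the counter still equals [i] when the body has finished. *)
    have ws : forall q s', wf q -> x \notin writes q -> env (sem q s') x = env s' x.
      elim=> [x' e'|? ? ?|x'|?|q1 I1 q2 I2|e' q1 I1 q2 I2||x' e' q1 I1] s' //=.
      + by move=> _; rewrite inE /upd => /negbTE ->.
      + by move=> _; rewrite inE /upd => /negbTE ->.
      + by case/andP=> ? ?; rewrite mem_cat negb_or => /andP [? ?]; rewrite I2 // I1.
      + case/and3P=> ? ? ?; rewrite mem_cat negb_or => /andP [? ?].
        by case: ifP => _; [rewrite I1|rewrite I2].
      + case/and5P=> ? ? ? ? ?; rewrite inE negb_or => /andP [ne ?].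
        rewrite /upd (negbTE ne); elim: `|_|%N => //= l IHl.
        by rewrite I1 // /= /upd (negbTE ne).
    have ex : regs m2 x = i.
      rewrite r21 // ws //= /upd eqxx rep_nat modn_small //; lia.
    have eb : regs m2 (50 + x) = n.
      have hz : 50 <= 50 + x < 99 by lia.
      rewrite (f2 _ hz) //; rewrite /bound_regs.
      by apply: contra xl => /mapP [y hy] /addnI ->.
    have i1 : i.+1 < 2 ^ w by lia.
    have rg3 : forall z, z < 100 -> z != x -> regs m4 z = regs m2 z.
      move=> z hz hz2; rewrite /m4 /m3 /= !ifF //; lia.
    have w1' : 1 < 2 ^ w by lia.
    have rgx : regs m4 x = i.+1.
      rewrite /m4 /m3 /= ifF; last by lia.
      rewrite eqxx ifF; last by lia.
      rewrite ex (modn_small w1') modn_small; lia.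
    have rg100 : regs m4 100 = (i.+1 < n).
      rewrite /m4 /m3 /= eqxx ifF; last by lia.
      rewrite (modn_small w1') ifF; last by lia.
      rewrite ifF; last by lia.
      rewrite ex eb addn1 (modn_small i1) modn_small //; lia.
    have rel4 : rel (setr (loop x p s i.+1) x (Posz i.+1)) m4.
      split; [| |exact: r23|exact: r24|by []].
      + move=> z hz; rewrite [env _]/(upd _ _ _) /upd; case: (altP (z =P x)) => [->|ne].
          by rewrite rgx rep_nat modn_small.
        have hz9 : z < 100 by lia.
        by rewrite rg3 // r21.
      + have h9 : 99 != x by lia.
        by rewrite rg3.
    have b4 : regs m4 (50 + x) = n by rewrite rg3 ?eb //; lia.
    have [m' [c' r' f']] := IHj i.+1 m4 ltac:(lia) rel4 b4 rg100.
    exists m'; split=> //.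
      rewrite big_ltn //.
      apply: (steps_eq (steps_while1 _ (steps_seq c2 (steps_seq (steps_do _ _)
         (steps_seq (steps_do _ _) (steps_do _ _)))) c')); first by rewrite ti lin.
      lia.
    by move=> z hz hz2; rewrite f' // rg3 ?f2 //; lia.
  have c0 : rel (setr (loop x p s 0) x 0%R) st0.
    case: hr1 => q1 q2 q3 q4 [q5 q6]; split; [| |exact: q3|exact: q4|by []].
    + move=> z hz; rewrite [env _]/(upd _ _ _) /upd; case: (altP (z =P x)) => [->|ne].
        rewrite /st0 /= ifF; last by lia.
        by rewrite eqxx rep_nat.
      have ne2 : (z == 50 + x) = false by lia.
      have ne3 : (z == 100) = false by lia.
      by rewrite /st0 /= ne2 ne3 (negbTE ne) q1.
    + have ne1 : (99 == x) = false by lia.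
      have ne2 : (99 == 50 + x) = false by lia.
      by rewrite /st0 /= ne1 ne2 q2.
  have b0 : regs st0 (50 + x) = n.
    rewrite /st0 /= ifF; last by lia.
    rewrite ifF; last by lia.
    rewrite !eqxx ifF; last by lia.
    by rewrite mod0n add0n a1 modn_small.
  have t0 : regs st0 100 = (0 < n).
    rewrite /st0 /= !eqxx mod0n.
    rewrite ifF; last by lia.
    rewrite ifF; last by lia.
    rewrite add0n a1 (modn_small hnw) modn_small //; lia.
  have [m' [c' r' f']] := main n 0 st0 erefl c0 b0 t0.
  exists m'; split=> //.
    rewrite -(big_mkord xpredT (fun l => cost p (setr (loop x p s l) x (Posz l)) + 7)).
    apply: (steps_eq (steps_seq c1 (steps_seq (steps_seq (steps_do _ _) (steps_do _ _))
       (steps_seq (steps_do _ _) (steps_seq (steps_do _ _) c'))))).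
    lia.
  move=> z hz; rewrite /bound_regs /= inE negb_or => /andP [ne hz2].
  rewrite f' // /st0 /= !ifF ?a2 //; lia.
Qed.

End Semantics.

(** * Specifications of integer programs *)

(** Used with the syntactic lists [writes] and [awrites], so that most claims about unchanged
    variables are settled by computation. *)
Definition frame (ws aws : seq nat) (s s' : ist) : Prop :=
  (forall x, x \notin ws -> env s' x = env s x) /\
  (forall a, a \notin aws -> arr s' a = arr s a).

Lemma frame_trans ws aws s1 s2 s3 :
  frame ws aws s1 s2 -> frame ws aws s2 s3 -> frame ws aws s1 s3.
Proof.
by move=> [h1 h2] [h3 h4]; split=> z hz; [rewrite h3 // h1|rewrite h4 // h2].
Qed.

Lemma frame_sub ws aws ws' aws' s s' : {subset ws <= ws'} -> {subset aws <= aws'} ->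
  frame ws aws s s' -> frame ws' aws' s s'.
Proof.
move=> sub1 sub2 [h1 h2]; split=> z hz; [apply: h1|apply: h2];
  by apply: contra hz; auto.
Qed.

Fixpoint norand (p : prog) : bool :=
  match p with
  | PRand _ => false
  | PSeq p q | PIf _ p q => norand p && norand q
  | PFor _ _ p => norand p
  | _ => true
  end.

Fixpoint noreport (p : prog) : bool :=
  match p with
  | PRep _ => false
  | PSeq p q | PIf _ p q => noreport p && noreport q
  | PFor _ _ p => noreport p
  | _ => true
  end.

Section Spec.

Variables (w : nat) (O : oracle) (inp : nat -> nat) (base lim : nat).

Notation sem := (sem O inp).
Notation eval := (eval O inp).
Notation eok := (eok w O inp base lim).
Notation ok := (ok w O inp base lim).
Notation cost := (cost O inp).
Notation inw := (inw w).

Lemma sem_frame p s : frame (writes p) (awrites p) s (sem p s).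
Proof.
elim: p s => [x e|a e1 e2|x|e|p IHp q IHq|e p IHp q IHq||x e p IHp] s //=.
- by split=> //= z; rewrite inE /upd => /negbTE ->.
- by split=> //= z; rewrite inE /upd => /negbTE ->.
- by split=> //= z; rewrite inE /upd => /negbTE ->.
- apply: (@frame_trans _ _ _ (sem p s)).
    by apply: frame_sub (IHp s) => z; rewrite mem_cat => ->.
  by apply: frame_sub (IHq _) => z; rewrite mem_cat => ->; rewrite orbT.
- case: ifP => _.
    by apply: frame_sub (IHp s) => z; rewrite mem_cat => ->.
  by apply: frame_sub (IHq _) => z; rewrite mem_cat => ->; rewrite orbT.
- have fr s' v : frame (x :: writes p) (awrites p) s' (setr s' x v).
    by split=> //= z; rewrite inE negb_or /upd => /andP [/negbTE ->].
  apply: frame_trans (fr _ _).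
  elim: `|_|%N => //= n IHn; apply: frame_trans IHn _.
  apply: frame_trans (fr _ _) _.
  by apply: frame_sub (IHp _) => // z; rewrite inE => ->; rewrite orbT.
Qed.

Lemma sem_tape p s : norand p -> itape (sem p s) = itape s.
Proof.
elim: p s => [x e|a e1 e2|x|e|p IHp q IHq|e p IHp q IHq||x e p IHp] s //=.
- by case/andP=> h1 h2; rewrite IHq // IHp.
- by case/andP=> h1 h2; case: ifP => _; [rewrite IHp|rewrite IHq].
- by move=> h; elim: `|_|%N => //= n IHn; rewrite IHp.
Qed.

Lemma sem_out p s : noreport p -> iout (sem p s) = iout s.
Proof.
elim: p s => [x e|a e1 e2|x|e|p IHp q IHq|e p IHp q IHq||x e p IHp] s //=.
- by case/andP=> h1 h2; rewrite IHq // IHp.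
- by case/andP=> h1 h2; case: ifP => _; [rewrite IHp|rewrite IHq].
- by move=> h; elim: `|_|%N => //= n IHn; rewrite IHp.
Qed.

Definition spec (p : prog) (s : ist) (T : nat) (Q : ist -> Prop) : Prop :=
  [/\ ok p s, cost p s <= T & Q (sem p s)].

Lemma spec_weaken p s T T' Q Q' :
  spec p s T Q -> T <= T' ->
  (forall s', frame (writes p) (awrites p) s s' -> Q s' -> Q' s') -> spec p s T' Q'.
Proof.
case=> h1 h2 h3 hT hQ; split=> //; first exact: leq_trans h2 hT.
by apply: hQ => //; apply: sem_frame.
Qed.

Lemma spec_seq p q s T1 T2 T Q R :
  spec p s T1 R ->
  (forall s', frame (writes p) (awrites p) s s' -> R s' -> spec q s' T2 Q) ->
  T1 + T2 + 1 <= T -> spec (PSeq p q) s T Q.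
Proof.
case=> h1 h2 h3 h4 hT.
have [k1 k2 k3] := h4 _ (sem_frame p s) h3.
by split=> //=; apply: leq_trans hT; rewrite !leq_add2r leq_add.
Qed.

Lemma spec_if e p q s T T' Q : eok e s -> inw (eval e s) ->
  (eval e s != 0%R -> spec p s T Q) -> (eval e s = 0%R -> spec q s T Q) ->
  T + ecost e + 2 <= T' -> spec (PIf e p q) s T' Q.
Proof.
move=> h1 h2 h3 h4 hT; rewrite /spec /= h1 h2.
case: (altP (eval e s =P 0%R)) => he.
  have [k1 k2 k3] := h4 he; split=> //; move: k2 hT => /=; lia.
have [k1 k2 k3] := h3 he; split=> //; move: k2 hT => /=; lia.
Qed.

(* The loop body may use that everything outside its write set still has the
   value it had before the loop. *)
Lemma spec_for x e p s (n : nat) T T' (I : nat -> ist -> Prop) Q :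
  eok e s -> inw (Posz n) -> eval e s = Posz n -> I 0 s ->
  (forall i s', i < n -> frame (x :: writes p) (awrites p) s s' -> I i s' ->
     spec p (setr s' x (Posz i)) T (I i.+1)) ->
  (forall s', frame (x :: writes p) (awrites p) s s' -> I n s' ->
     Q (setr s' x (Posz n))) ->
  n * (T + 7) + ecost e + 10 <= T' ->
  spec (PFor x e p) s T' Q.
Proof.
move=> he hn en I0 step fin hT.
have fr s' v : frame (x :: writes p) (awrites p) s' (setr s' x v).
  by split=> //= z; rewrite inE negb_or /upd => /andP [/negbTE ->].
have inv i : i <= n ->
   frame (x :: writes p) (awrites p) s (loop O inp x p s i) /\ I i (loop O inp x p s i).
  elim: i => [|i IH] hi //=.
  have [f1 i1] := IH (ltnW hi); have [_ _ h] := step _ _ hi f1 i1.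
  split=> //; apply: frame_trans f1 _; apply: frame_trans (fr _ _) _.
  by apply: frame_sub (sem_frame _ _) => // z; rewrite inE => ->; rewrite orbT.
split.
- split; first by rewrite he en.
  rewrite en /= => i hi; have [f1 i1] := inv i (ltnW hi).
  by have [] := step _ _ hi f1 i1.
- rewrite /= en; apply: leq_trans hT.
  apply: (@leq_trans (ecost e + 10 + n * (T + 7))); last by lia.
  rewrite leq_add2l.
  rewrite -[n in n * _]card_ord -sum_nat_const.
  apply: leq_sum => i _; rewrite leq_add2r.
  have [f1 i1] := inv i (ltnW (ltn_ord i)).
  by have [] := step _ _ (ltn_ord i) f1 i1.
- rewrite /= en /=; have [f1 i1] := inv n (leqnn n); exact: fin.
Qed.

(** For loop-free code only: loops go through [spec_for], and the value [False] here makes the dummy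
    cost 0 of a loop in [scost] harmless. *)
Fixpoint wp (p : prog) (s : ist) (Q : ist -> Prop) : Prop :=
  match p with
  | PAsg x e => eok e s /\ Q (setr s x (eval e s))
  | PSt a e1 e2 => [/\ eok e1 s, eok e2 s & inidx lim (eval e1 s)] /\
                   Q (seta s a (eval e1 s) (eval e2 s))
  | PRand x => Q (sem (PRand x) s)
  | PRep e => (eok e s /\ inw (eval e s)) /\ Q (sem (PRep e) s)
  | PSeq p q => wp p s (fun s' => wp q s' Q)
  | PIf e p q => (eok e s /\ inw (eval e s)) /\
      (eval e s != 0%R -> wp p s Q) /\ (eval e s = 0%R -> wp q s Q)
  | PSkip => Q s
  | PFor _ _ _ => False
  end.

Fixpoint scost (p : prog) : nat :=
  match p with
  | PAsg x e => ecost e + 4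
  | PSt a e1 e2 => ecost e1 + ecost e2 + 13
  | PRand x => 1
  | PRep e => ecost e + 2
  | PSeq p q => scost p + scost q + 1
  | PIf e p q => ecost e + 2 + maxn (scost p) (scost q)
  | PSkip => 1
  | PFor _ _ _ => 0
  end.

Lemma wp_spec p s T Q : scost p <= T -> wp p s Q -> spec p s T Q.
Proof.
move=> hT hwp; suff [h1 h2 h3] : spec p s (scost p) Q.
  by split=> //; apply: leq_trans hT.
move: hwp {T hT}.
elim: p s Q => [x e|a e1 e2|x|e|p IHp q IHq|e p IHp q IHq||x e p IHp] s Q //=.
- by case=> h1 h2; split.
- by case=> [[h1 h2 h3] h4]; split=> //=; rewrite h1 h2.
- by case=> [[h1 h2] h3]; split=> //=; rewrite h1 h2.
- move=> /IHp [h1 h2 /IHq [h3 h4 h5]]; split=> //=; move: h2 h4 => /=; lia.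
- case=> [[h1 h2] [h3 h4]]; rewrite /spec /= h1 h2.
  case: (altP (eval e s =P 0%R)) => he.
    have [k1 k2 k3] := IHq _ _ (h4 he); split=> //=; move: k2 => /=; lia.
  have [k1 k2 k3] := IHp _ _ (h3 he); split=> //=; move: k2 => /=; lia.
Qed.

End Spec.

(** * The Fourier transform by decimation *)

Section Transform.

Local Open Scope ring_scope.

Variables (C : comNzRingType) (z : nat -> C) (k : nat).

Notation N := (2 ^ k)%N.

(** The laws of a list of the N-th roots of unity in bit-reversed order: the two square roots of
    [z r] are neighbours, at 2 r and 2 r + 1. *)
Hypothesis z0 : z 0 = 1.
Hypothesis z_even : forall r, (2 * r < N)%N -> z (2 * r)%N ^+ 2 = z r.
Hypothesis z_odd : forall r, ((2 * r).+1 < N)%N -> z (2 * r).+1 = - z (2 * r)%N.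

(* The coefficients of A, cut into polynomials of degree < N, reduced modulo
   the polynomials X ^ H - z r for r < 2 ^ l, where H = N / 2 ^ l. *)
Definition dft (l : nat) (A : nat -> C) (p : nat) : C :=
  \sum_(q < 2 ^ l) A (p %/ N * N + q * 2 ^ (k - l) + p %% 2 ^ (k - l))%N *
                   z ((p %% N) %/ 2 ^ (k - l))%N ^+ q.

Lemma dft_at l A P r o : (l <= k)%N -> (r < 2 ^ l)%N -> (o < 2 ^ (k - l))%N ->
  dft l A (P * N + r * 2 ^ (k - l) + o)%N =
  \sum_(q < 2 ^ l) A (P * N + q * 2 ^ (k - l) + o)%N * z r ^+ q.
Proof.
move=> hl hr ho; rewrite /dft.
have eN : N = (2 ^ l * 2 ^ (k - l))%N by rewrite -expnD subnKC.
have hro : (r * 2 ^ (k - l) + o < N)%N by rewrite eN; nia.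
rewrite -addnA divnMDl ?expn_gt0 // (divn_small hro) addn0 modnMDl (modn_small hro).
rewrite divnMDl ?expn_gt0 // (divn_small ho) addn0.
have -> : ((P * N + (r * 2 ^ (k - l) + o)) %% 2 ^ (k - l) = o)%N.
  by rewrite eN mulnA addnA -mulnDl modnMDl modn_small.
by [].
Qed.

(** Squaring halves the index, so k squarings bring every index below 2 ^ k to 0. *)
Lemma z_pow r : (r < N)%N -> z r ^+ N = 1.
Proof.
suff H : forall j r, (j <= k)%N -> (r < 2 ^ j)%N -> z r ^+ (2 ^ j) = 1 by exact: H.
elim=> [|j IH] s hj hs.
  by rewrite expn0 expr1; move: hs; case: s.
have hs2 : (s = 2 * (s %/ 2) + s %% 2)%N by rewrite mulnC -divn_eq.
have lt : (s %/ 2 < 2 ^ j)%N by move: hs; rewrite expnS; lia.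
have lN' : ((2 * (s %/ 2)).+1 < N)%N.
  apply: leq_trans (_ : 2 ^ j.+1 <= _)%N; last by rewrite leq_exp2l.
  by rewrite expnS; lia.
have lN := ltnW lN'.
have zs : z s ^+ 2 = z (s %/ 2).
  rewrite [in LHS]hs2; case: (s %% 2)%N (ltn_pmod s (isT : 0 < 2)%N) => [|[|//]] _.
    by rewrite addn0 z_even.
  by rewrite addn1 z_odd // sqrrN z_even.
by rewrite expnS exprM zs IH // ltnW.
Qed.

Lemma sum_even_odd (F : nat -> C) l :
  \sum_(q < 2 ^ l.+1) F q = \sum_(q < 2 ^ l) F (2 * q)%N + \sum_(q < 2 ^ l) F (2 * q).+1.
Proof.
rewrite -big_split /= expnS.
elim: (2 ^ l)%N => [|j IH]; first by rewrite muln0 !big_ord0.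
by rewrite mulnS !big_ord_recr /= IH addrA.
Qed.

(* One decimation step: X ^ (2 h) - z r = (X ^ h - z (2 r)) (X ^ h - z (2 r + 1)). *)
Lemma dft_step l A P r b o (h := (2 ^ (k - l.+1))%N) :
  (l < k)%N -> (r < 2 ^ l)%N -> (b < 2)%N -> (o < h)%N ->
  dft l.+1 A (P * N + r * (2 * h) + b * h + o)%N =
  dft l A (P * N + r * (2 * h) + o)%N +
  (-1) ^+ b * z (2 * r)%N * dft l A (P * N + r * (2 * h) + o + h)%N.
Proof.
move=> hl hr hb ho.
have eh : (2 ^ (k - l) = 2 * h)%N by rewrite /h -expnS; congr (2 ^ _)%N; lia.
have eN : N = (2 ^ l * (2 * h))%N by rewrite -eh -expnD subnKC // ltnW.
have r2' : ((2 * r).+1 < N)%N by rewrite eN /h; have := expn_gt0 2 (k - l.+1); nia.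
have r2 := ltnW r2'.
have zb : z (2 * r + b) = (-1) ^+ b * z (2 * r)%N.
  case: b hb => [|[|//]] _; first by rewrite addn0 expr0 mul1r.
  by rewrite addn1 z_odd // expr1 mulN1r.
have zb2 : z (2 * r + b) ^+ 2 = z r.
  by rewrite zb exprMn -exprM mulnC exprM sqrrN expr1n expr1n mul1r z_even.
rewrite -[X in dft l.+1 A X](_ : (P * N + (2 * r + b) * h + o = _)%N); last by lia.
rewrite dft_at //; last by rewrite expnS; lia.
have hl' := ltnW hl.
have ho1 : (o < 2 ^ (k - l))%N by rewrite eh; lia.
have ho2 : (o + h < 2 ^ (k - l))%N by rewrite eh; lia.
rewrite -eh dft_at // -[(_ + o + h)%N]addnA dft_at //.
rewrite (sum_even_odd (fun q => A (P * N + q * h + o)%N * z (2 * r + b)%N ^+ q)).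
congr (_ + _).
  by apply: eq_bigr => q _; rewrite exprM zb2 eh; congr (A _ * _); rewrite -/h; lia.
rewrite mulr_sumr; apply: eq_bigr => q _.
rewrite exprS exprM zb2 zb mulrCA; congr (_ * _); congr (A _ * _).
by rewrite -/h eh; lia.
Qed.

(** The block containing [p] is convolved with block 0, to which [u] belongs, and not with
    itself. *)
Definition cconv (A : nat -> C) (p : nat) : C :=
  \sum_(u < N) A (p %/ N * N + (p %% N + N - u) %% N)%N * A u.

Lemma dft_full A P r : (r < N)%N ->
  dft k A (P * N + r)%N = \sum_(q < N) A (P * N + q)%N * z r ^+ q.
Proof.
move=> hr.
have := @dft_at k A P r 0 (leqnn k); rewrite subnn expn0 muln1 addn0 => -> //.
by apply: eq_bigr => q _; rewrite muln1 addn0.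
Qed.

(** The convolution theorem, block by block: exchange the sums and translate q by u modulo N; by
    [z_pow] a power of [z r] depends on its exponent modulo N only. *)
Lemma dft_cconv A Y P r : (r < N)%N ->
  (forall q, (q < N)%N -> Y (P * N + q)%N = cconv A (P * N + q)%N) ->
  dft k Y (P * N + r)%N = dft k A (P * N + r)%N * dft k A r.
Proof.
move=> hr hY; rewrite dft_full //.
have e0 : dft k A r = \sum_(q < N) A q * z r ^+ q.
  have := dft_full A 0 hr; rewrite mul0n add0n => ->.
  by apply: eq_bigr => q _; rewrite add0n.
rewrite dft_full // e0.
rewrite mulr_sumr.
transitivity (\sum_(q < N) \sum_(u < N)
   A (P * N + (q + N - u) %% N)%N * A u * z r ^+ q).
  apply: eq_bigr => q _; rewrite hY // /cconv mulr_suml.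
  by apply: eq_bigr => u _; rewrite divnMDl ?expn_gt0 // (divn_small (ltn_ord q)) addn0
     modnMDl (modn_small (ltn_ord q)).
rewrite exchange_big /=; apply: eq_bigr => u _.
rewrite mulr_suml.
have N0 : (0 < N)%N by rewrite expn_gt0.
pose f (q : 'I_N) : 'I_N := Ordinal (ltn_pmod (q + u) N0).
have inj : injective f.
  move=> a b /(congr1 val) /= /eqP; rewrite eqn_modDr !modn_small // => /eqP h.
  exact: val_inj.
rewrite (reindex_inj inj) /=; apply: eq_bigr => q _.
have -> : (((q + u) %% N + N - u) %% N = q)%N.
  have hu := ltn_ord u; have hq := ltn_ord q.
  case: (ltnP (q + u) N) => h.
    rewrite (modn_small h) (_ : (q + u + N - u = q + N)%N); last by lia.
    by rewrite modnDr modn_small.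
  have -> : ((q + u) %% N = q + u - N)%N.
    by rewrite -[in LHS](subnK h) modnDr modn_small //; lia.
  rewrite (_ : (q + u - N + N - u = q)%N); last by lia.
  by rewrite modn_small.
have -> : z r ^+ ((q + u) %% N) = z r ^+ q * z r ^+ u.
  rewrite -exprD [in RHS](divn_eq (q + u) N) exprD mulnC exprM z_pow // expr1n mul1r //.
by ring.
Qed.

End Transform.

(** * Roots of unity by half-angle formulas *)

Section Roots.

Local Open Scope ring_scope.

(* om j = cs j + i sn j = exp (2 i pi / 2 ^ (j + 1)), by the half-angle formulas. *)
Fixpoint cs (j : nat) : algC := if j is j'.+1 then sqrtC ((1 + cs j') / 2) else -1.
Definition sn (j : nat) : algC := if j is j'.+1 then sqrtC ((1 - cs j') / 2) else 0.
Definition om (j : nat) : algC := cs j + 'i * sn j.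

Lemma cs_bound j : -1 <= cs j <= 1.
Proof.
elim: j => [|j /andP [h1 h2]] /=; first by rewrite lexx (le_trans (lerN10 _) ler01).
have h0 : 0 <= (1 + cs j) / 2 by rewrite divr_ge0 ?ler0n // -lerBlDl sub0r.
apply/andP; split.
  by apply: le_trans (_ : 0 <= _); rewrite ?lerN10 // sqrtC_ge0.
rewrite -[X in _ <= X]sqrtC1 ler_sqrtC ?nnegrE ?ler01 //.
by rewrite ler_pdivrMr ?ltr0n // mul1r -[2]/(1 + 1) lerD2l.
Qed.

(** From level 1 on the angle is at most pi / 2, so the nonnegative root chosen by [sqrtC] is indeed
    the cosine. *)
Lemma cs_ge0 j : 0 <= cs j.+1.
Proof.
have /andP [h1 h2] := cs_bound j.
by rewrite /= sqrtC_ge0 divr_ge0 ?ler0n // -lerBlDl sub0r.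
Qed.

Lemma sn_ge0 j : 0 <= sn j.
Proof.
case: j => [|j] //=; have /andP [h1 h2] := cs_bound j.
by rewrite sqrtC_ge0 divr_ge0 ?ler0n // subr_ge0.
Qed.

Lemma cs_sn j : cs j ^+ 2 + sn j ^+ 2 = 1.
Proof.
case: j => [|j] /=; first by rewrite sqrrN expr1n expr0n addr0.
by rewrite !sqrtCK; field.
Qed.

Lemma cs_real j : cs j \is Num.real.
Proof. by have /andP [h1 h2] := cs_bound j; rewrite (ler_real h2) real1. Qed.

Lemma sn_real j : sn j \is Num.real.
Proof. exact: ger0_real (sn_ge0 j). Qed.

Lemma norm_om j : `|om j| = 1.
Proof.
apply/eqP; rewrite -(@eqrXn2 _ 2) ?normr_ge0 ?ler01 //.
rewrite /om normC2_rect ?cs_real ?sn_real // cs_sn expr1n //.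
Qed.

(** The double-angle formulas. For the sine the half-angle formulas only give squares; both sides
    being nonnegative fixes the sign. *)
Lemma om_sq j : om j.+1 ^+ 2 = om j.
Proof.
have e1 : cs j.+1 ^+ 2 = (1 + cs j) / 2 by rewrite /= sqrtCK.
have e2 : sn j.+1 ^+ 2 = (1 - cs j) / 2 by rewrite /= sqrtCK.
have e3 : 2 * cs j.+1 * sn j.+1 = sn j.
  apply/eqP; rewrite -(@eqrXn2 _ 2) ?sn_ge0 ?mulr_ge0 ?cs_ge0 ?sn_ge0 //.
  rewrite !exprMn e1 e2; apply/eqP.
  have -> : sn j ^+ 2 = 1 - cs j ^+ 2 by rewrite -(cs_sn j) addrC addKr.
  by field.
rewrite /om sqrrD e1 exprMn sqrCi e2 -e3.
rewrite -[in RHS](_ : (1 + cs j) / 2 - (1 - cs j) / 2 = cs j); last by field.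
ring.
Qed.

Variable k : nat.

(** Digit i of r contributes the angle 2 pi / 2 ^ (i + 1): this is exp (2 i pi x), where the binary
    digits of x after the point are those of r, lowest first. Hence the bit-reversed order. *)
Definition zt (r : nat) : algC := \prod_(i < k) om i ^+ odd (r %/ 2 ^ i).

Lemma zt0 : zt 0 = 1.
Proof. by rewrite /zt big1 // => i _; rewrite div0n. Qed.

Lemma norm_zt r : `|zt r| = 1.
Proof.
rewrite /zt normr_prod big1 // => i _; rewrite normrX norm_om expr1n //.
Qed.

Lemma zt_even r : (2 * r < 2 ^ k)%N -> zt (2 * r)%N ^+ 2 = zt r.
Proof.
rewrite /zt -prodrXl; case: k => [|k'] hr.
  by rewrite !big_ord0.
rewrite [in LHS]big_ord_recl [in RHS]big_ord_recr /= expn0 divn1.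
rewrite oddM /= expr0 expr1n mul1r.
rewrite [X in _ = _ * X](_ : _ = 1) ?mulr1; last first.
  by rewrite divn_small //; move: hr; rewrite expnS; lia.
apply: eq_bigr => i _; rewrite -exprM mulnC exprM om_sq /bump /= add1n expnS.
by rewrite divnMl.
Qed.

Lemma zt_odd r : ((2 * r).+1 < 2 ^ k)%N -> zt (2 * r).+1 = - zt (2 * r)%N.
Proof.
rewrite /zt; case: k => [|k'] hr.
  by move: hr; rewrite expn0.
rewrite !big_ord_recl /= !expn0 !divn1 /= oddM /= expr0 mul1r.
rewrite expr1 /om /cs /sn mulr0 addr0 mulN1r; congr (- _).
apply: eq_bigr => i _; rewrite /bump /= add1n expnS.
by rewrite !divnMA; congr (_ ^+ odd (_ %/ _)); lia.
Qed.

(** A new top digit multiplies by one root, which lets [p_table] double its table at each level. *)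
Lemma zt_add i r : (i < k)%N -> (r < 2 ^ i)%N -> zt (2 ^ i + r)%N = zt r * om i.
Proof.
move=> hi hr.
rewrite /zt (bigD1 (Ordinal hi)) //= [in RHS](bigD1 (Ordinal hi)) //=.
rewrite divnDl ?dvdnn // divnn expn_gt0 /= (divn_small hr) addn0 /= expr1 expr0 mul1r.
rewrite mulrC; congr (_ * _); apply: eq_bigr => j hj.
have ne : (j != i :> nat) by apply: contra hj => /eqP e; apply/eqP/val_inj.
congr (_ ^+ nat_of_bool _).
case: (ltngtP j i) ne => // h _.
  have -> : (2 ^ i = 2 ^ (i - j.+1) * 2 * 2 ^ j)%N.
    by rewrite -mulnA -expnS -expnD subnK.
  by rewrite divnMDl ?expn_gt0 // oddD oddM andbF.
rewrite !divn_small //.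
  by apply: leq_trans hr _; rewrite leq_exp2l // ltnW.
apply: (@leq_trans (2 ^ i.+1)); first by rewrite expnS; lia.
by rewrite leq_exp2l.
Qed.

End Roots.

(** * Fixed-point errors *)

Section Errors.

Local Open Scope ring_scope.

Definition gz (x y : int) : algC := x%:~R + 'i * y%:~R.

Lemma intr_real (x : int) : (x%:~R : algC) \is Num.real.
Proof. exact: realz. Qed.

Lemma norm_gz2 x y : `|gz x y| ^+ 2 = x%:~R ^+ 2 + y%:~R ^+ 2.
Proof. by rewrite /gz normC2_rect ?intr_real. Qed.

Lemma gz_re x y : `|x%:~R| <= `|gz x y|.
Proof.
rewrite -(@ler_pXn2r _ 2) ?nnegrE ?normr_ge0 // norm_gz2 real_normK ?intr_real //.
by rewrite lerDl -realEsqr intr_real.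
Qed.

Lemma gz_le x y : `|gz x y| <= `|x%:~R| + `|y%:~R|.
Proof. by apply: le_trans (ler_normD _ _) _; rewrite normrM normCi mul1r. Qed.

Lemma gzM a b c d : gz a b * gz c d = gz (a * c - b * d) (a * d + b * c).
Proof.
rewrite /gz !(intrD, rmorphN, intrM) /=.
have -> (u v s t : algC) : (u + 'i * v) * (s + 'i * t) =
  u * s + ('i ^+ 2) * (v * t) + 'i * (u * t + v * s) by ring.
by rewrite sqrCi; ring.
Qed.

Lemma gzD a b c d : gz a b + gz c d = gz (a + c) (b + d).
Proof. by rewrite /gz !intrD; ring. Qed.

Lemma gzB a b c d : gz a b - gz c d = gz (a - c) (b - d).
Proof. by rewrite /gz !intrB; ring. Qed.

Lemma conj_gz x y : (gz x y)^* = gz x (- y).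
Proof.
rewrite /gz rmorphD rmorphM /= conjCi !conj_Creal ?intr_real // rmorphN /=; ring.
Qed.

(** Turns estimates in the complex plane into ranges of integers, as needed to exclude overflow. *)
Lemma absz_le_gz x y (B : nat) : `|gz x y| <= B%:R -> (`|x| <= B)%N.
Proof.
move=> h; rewrite -(ler_nat algC) -[`|x|%N%:R](_ : `|x%:~R| = _).
  exact: le_trans (gz_re _ _) h.
by rewrite -intr_norm -abszE.
Qed.

Lemma gz_swap x y : `|gz y x| = `|gz x y|.
Proof.
by apply/eqP; rewrite -(@eqrXn2 _ 2) ?normr_ge0 // !norm_gz2 addrC.
Qed.

Lemma norm_bound (S e G : nat) (x v : algC) :
  `|x - S%:R * v| <= e%:R -> `|v| <= G%:R -> `|x| <= (S * G + e)%:R.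
Proof.
move=> h1 h2; rewrite -(subrK (S%:R * v) x) addrC natrD.
apply: le_trans (ler_normD _ _) _; apply: lerD => //.
by rewrite normrM normr_nat natrM ler_wpM2l ?ler0n.
Qed.

Section Product.

Variables (S H G d e : nat) (cr ci vr vi : int) (c v : algC).
Hypotheses (hc : `|gz cr ci - S%:R * c| <= d%:R) (hv : `|gz vr vi - S%:R * v| <= e%:R).
Hypotheses (nc : `|c| <= H%:R) (nv : `|v| <= G%:R).

Lemma cmul_bound : `|gz cr ci * gz vr vi| <= ((S * H + d) * (S * G + e))%:R.
Proof. by rewrite normrM natrM ler_pM ?normr_ge0 ?norm_bound // (norm_bound hc, norm_bound hv). Qed.

Lemma cmul_re_bound : (`|(cr * vr - ci * vi)%R| <= (S * H + d) * (S * G + e))%N.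
Proof. by apply: (@absz_le_gz _ (cr * vi + ci * vr)); rewrite -gzM cmul_bound. Qed.

Lemma cmul_im_bound : (`|(cr * vi + ci * vr)%R| <= (S * H + d) * (S * G + e))%N.
Proof. by apply: (@absz_le_gz _ (cr * vr - ci * vi)); rewrite gz_swap -gzM cmul_bound. Qed.

(** Three sources of error: that of the second factor, scaled by H; that of the first, scaled by a
    computed value of size at most S (G + 1), where e <= S is used; and two floor divisions, each at
    most 1. *)
Lemma cmul_err : (0 < S)%N -> (e <= S)%N ->
  `|gz ((cr * vr - ci * vi) %/ Posz S)%Z ((cr * vi + ci * vr) %/ Posz S)%Z
    - S%:R * (c * v)| <= (H * e + d * (G + 1) + 2)%:R.
Proof.
move=> S0 eS.
set a := cr * vr - ci * vi; set b := cr * vi + ci * vr.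
have S0' : (0 : algC) < S%:R by rewrite ltr0n.
rewrite -(ler_pM2l S0') -{1}[S%:R]ger0_norm ?ler0n // -normrM.
(* Multiplied by S, the quotients become the exact product minus the remainders. *)
have -> : S%:R * (gz (a %/ S)%Z (b %/ S)%Z - S%:R * (c * v)) =
  (gz cr ci - S%:R * c) * gz vr vi + S%:R * c * (gz vr vi - S%:R * v)
  - gz (a %% S)%Z (b %% S)%Z.
  have E : S%:R * gz (a %/ S)%Z (b %/ S)%Z = gz cr ci * gz vr vi - gz (a %% S)%Z (b %% S)%Z.
    have dm (t : int) : t - (t %% S)%Z = (t %/ S)%Z * S by rewrite {1}(divz_eq t S) addrK.
    rewrite gzM -/a -/b gzB !dm.
    by rewrite /gz !intrM; ring.
  by rewrite mulrBr E; ring.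
apply: le_trans (ler_normB _ _) _; rewrite natrD [in X in _ <= X]mulrDr.
have hm x : `|((x %% S)%Z%:~R : algC)| <= S%:R.
  have h1 : 0 <= (x %% S)%Z by rewrite modz_ge0 //; lia.
  have h2 : (x %% S)%Z < S by rewrite ltz_pmod.
  by rewrite -intr_norm -[S%:R]/((Posz S)%:~R) ler_int ger0_norm // ltW.
apply: lerD; last first.
  apply: le_trans (gz_le _ _) _; rewrite -[2]/(1 + 1) mulrDr mulr1.
  by apply: lerD; exact: hm.
apply: le_trans (ler_normD _ _) _; rewrite [in X in _ <= X]addnC natrD [in X in _ <= X]mulrDr.
apply: lerD; rewrite normrM.
  rewrite natrM mulrCA ler_pM ?normr_ge0 //.
  apply: le_trans (norm_bound hv nv) _.
  by rewrite -natrM ler_nat mulnDr muln1 leq_add2l.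
rewrite normrM normr_nat natrM -mulrA ler_wpM2l ?ler0n // ler_pM ?normr_ge0 //.
Qed.

End Product.

(** Away from 0 the square root is Lipschitz: divide x ^ 2 - y ^ 2 by x + y, which is at least K. *)
Lemma near_sqr (x y b K : algC) : 0 <= x -> 0 <= y -> 0 <= b -> 0 < K ->
  K <= y -> x ^+ 2 - y ^+ 2 <= K * b -> x - y <= b.
Proof.
move=> x0 y0 b0 K0 Ky h.
have [le|lt] := real_leP (ger0_real x0) (ger0_real y0).
  by apply: le_trans b0; rewrite subr_le0.
rewrite -(ler_pM2l K0); apply: le_trans h.
rewrite subr_sqr mulrC ler_wpM2l ?subr_ge0 ?(ltW lt) //.
by apply: le_trans Ky _; rewrite lerDr.
Qed.

(** Near 0 only a modulus of continuity of square-root type is left: (x - y) ^ 2 <= x ^ 2 - y ^ 2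
    when x >= y >= 0. *)
Lemma near_sqr2 (x y b : algC) : 0 <= x -> 0 <= y -> 0 <= b ->
  x ^+ 2 - y ^+ 2 <= b ^+ 2 -> x - y <= b.
Proof.
move=> x0 y0 b0 h.
have [le|lt] := real_leP (ger0_real x0) (ger0_real y0).
  by apply: le_trans b0; rewrite subr_le0.
have xy : 0 <= x - y by rewrite subr_ge0 ltW.
rewrite -(@ler_pXn2r _ 2) ?nnegrE //; apply: le_trans h.
rewrite subr_sqr expr2 ler_wpM2l //.
by rewrite lerD2l; apply: le_trans (_ : 0 <= y); rewrite ?oppr_le0.
Qed.

Lemma real_dist_le (x y b : algC) : x \is Num.real -> y \is Num.real ->
  x - y <= b -> y - x <= b -> `|x - y| <= b.
Proof.
move=> rx ry h1 h2; rewrite real_ler_norml ?rpredB // h1 andbT.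
by rewrite lerNl opprB.
Qed.

Variables (sg j x v : nat) (a : int) (c : algC).
Notation S := (sg ^ 2)%N.
Hypotheses (sg0 : (0 < sg)%N) (ha : `|a%:~R - S%:R * c| <= j%:R)
  (xv : (x ^ 2 <= v < x.+1 ^ 2)%N) (c1 : -1 <= c <= 1).

Let lo : x%:R ^+ 2 <= v%:R :> algC.
Proof. by case/andP: xv => h1 h2; rewrite -!natrX !ler_nat h1. Qed.
Let hi : v%:R <= x.+1%:R ^+ 2 :> algC.
Proof. by case/andP: xv => h1 h2; rewrite -!natrX !ler_nat ltnW. Qed.

Let cr : c \is Num.real.
Proof. by case/andP: c1 => h1 h2; rewrite (ler_real h2) real1. Qed.

Let ha1 : a%:~R - S%:R * c <= j%:R.
Proof. by apply: le_trans ha; apply: real_ler_norm; rewrite rpredB ?intr_real ?rpredM ?realn. Qed.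
Let ha2 : S%:R * c - a%:~R <= j%:R.
Proof.
apply: le_trans ha; rewrite distrC.
by apply: real_ler_norm; rewrite rpredB ?intr_real ?rpredM ?realn.
Qed.

(** As c >= 0, the exact root is at least S / 2. The radicand is off by at most S j / 2, so the root
    is off by at most j; the extra 1 pays for rounding down. *)
Lemma isqrt_cos : 0 <= c -> Posz (2 * v)%N = (Posz S + a) * Posz S ->
  `|x%:R - S%:R * sqrtC ((1 + c) / 2)| <= (j + 1)%:R.
Proof.
move=> c0 ev.
have ev' : 2 * v%:R = (S%:R + a%:~R) * S%:R :> algC.
  by move: (congr1 (fun t : int => t%:~R : algC) ev); rewrite PoszM !intrM intrD.
have h0 : 0 <= (1 + c) / 2 by rewrite divr_ge0 ?addr_ge0 ?ler0n ?ler01.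
set y := S%:R * _.
have y0 : 0 <= y by rewrite mulr_ge0 ?ler0n ?sqrtC_ge0.
have y2 : y ^+ 2 = S%:R ^+ 2 * (1 + c) / 2 by rewrite exprMn sqrtCK mulrA.
have S0 : 0 < S%:R / 2 :> algC by rewrite divr_gt0 ?ltr0n ?expn_gt0 ?sg0.
have yS : S%:R / 2 <= y.
  rewrite ler_wpM2l ?ler0n // -(@ler_pXn2r _ 2) ?nnegrE ?sqrtC_ge0 ?invr_ge0 ?ler0n // sqrtCK.
  rewrite ler_pdivlMr ?ltr0n // expr2 mulrVK ?unitfE ?pnatr_eq0 //.
  apply: le_trans (_ : 1 <= _); first by rewrite invf_le1 ?ltr0n // ler1n.
  by rewrite lerDl.
have rx : x%:R \is @Num.real algC by rewrite realn.
apply: real_dist_le; rewrite ?rx ?(ger0_real y0) //.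
  apply: (near_sqr _ y0 _ S0 yS); rewrite ?ler0n //.
  apply: le_trans (_ : v%:R - y ^+ 2 <= _); first by rewrite lerD2r lo.
  rewrite y2; have -> : v%:R = (S%:R + a%:~R) * S%:R / 2 :> algC by rewrite -ev'; field.
  have -> : (S%:R + a%:~R) * S%:R / 2 - S%:R ^+ 2 * (1 + c) / 2 =
     S%:R / 2 * (a%:~R - S%:R * c) :> algC by field.
  rewrite ler_pM2l //; apply: le_trans ha1 _; by rewrite ler_nat leq_addr.
(* [x] is a floor, so from above the exact root is compared with x + 1. *)
suff : y - x.+1%:R <= j%:R by rewrite natrD lerBlDr -addn1 natrD addrA lerBlDr addrAC.
have key : y ^+ 2 - x.+1%:R ^+ 2 <= S%:R / 2 * j%:R.
  apply: le_trans (_ : y ^+ 2 - v%:R <= _); first by rewrite lerD2l lerN2 hi.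
  rewrite y2; have -> : v%:R = (S%:R + a%:~R) * S%:R / 2 :> algC by rewrite -ev'; field.
  have -> : S%:R ^+ 2 * (1 + c) / 2 - (S%:R + a%:~R) * S%:R / 2 =
     S%:R / 2 * (S%:R * c - a%:~R) :> algC by field.
  by rewrite ler_pM2l // ha2.
have [le|lt] := real_leP (ger0_real y0) (realn algC x.+1).
  by apply: le_trans (ler0n _ _); rewrite subr_le0.
rewrite -(ler_pM2l S0); apply: le_trans key.
rewrite subr_sqr mulrC ler_wpM2l ?subr_ge0 ?(ltW lt) //.
by apply: le_trans yS _; rewrite lerDl ler0n.
Qed.

(** The exact root may vanish, so [near_sqr2] is the only tool: an error S j / 2 on the radicand
    becomes at most sg j, because S = sg ^ 2. *)
Lemma isqrt_sin : Posz (2 * v)%N = (Posz S - a) * Posz S ->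
  `|x%:R - S%:R * sqrtC ((1 - c) / 2)| <= (sg * j + 1)%:R.
Proof.
move=> ev.
have ev' : 2 * v%:R = (S%:R - a%:~R) * S%:R :> algC.
  by move: (congr1 (fun t : int => t%:~R : algC) ev); rewrite PoszM !intrM intrB.
have h0 : 0 <= (1 - c) / 2 by case/andP: c1 => _ h; rewrite divr_ge0 ?subr_ge0 ?ler0n.
set y := S%:R * _.
have y0 : 0 <= y by rewrite mulr_ge0 ?ler0n ?sqrtC_ge0.
have y2 : y ^+ 2 = S%:R ^+ 2 * (1 - c) / 2 by rewrite exprMn sqrtCK mulrA.
have bnd : S%:R / 2 * j%:R <= (sg * j)%:R ^+ 2 :> algC.
  rewrite mulrAC ler_pdivrMr ?ltr0n // -natrM -natrX -natrM ler_nat expnMn.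
  rewrite -mulnA leq_mul2l; apply/orP; right; nia.
have S0 : 0 <= S%:R / 2 :> algC by rewrite divr_ge0 ?ler0n.
have rx : x%:R \is @Num.real algC by rewrite realn.
apply: real_dist_le; rewrite ?rx ?(ger0_real y0) //.
  apply: le_trans (_ : (sg * j)%:R <= _); last by rewrite ler_nat leq_addr.
  apply: near_sqr2; rewrite ?ler0n //; apply: le_trans bnd.
  apply: le_trans (_ : v%:R - y ^+ 2 <= _); first by rewrite lerD2r lo.
  rewrite y2; have -> : v%:R = (S%:R - a%:~R) * S%:R / 2 :> algC by rewrite -ev'; field.
  have -> : (S%:R - a%:~R) * S%:R / 2 - S%:R ^+ 2 * (1 - c) / 2 =
     S%:R / 2 * (S%:R * c - a%:~R) :> algC by field.
  by rewrite ler_wpM2l // ha2.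
suff : y - x.+1%:R <= (sg * j)%:R by rewrite [in X in _ -> X]natrD lerBlDr -addn1 natrD addrA lerBlDr addrAC.
apply: near_sqr2; rewrite ?ler0n //; apply: le_trans bnd.
apply: le_trans (_ : y ^+ 2 - v%:R <= _); first by rewrite lerD2l lerN2 hi.
rewrite y2; have -> : v%:R = (S%:R - a%:~R) * S%:R / 2 :> algC by rewrite -ev'; field.
have -> : S%:R ^+ 2 * (1 - c) / 2 - (S%:R - a%:~R) * S%:R / 2 =
   S%:R / 2 * (a%:~R - S%:R * c) :> algC by field.
by rewrite ler_wpM2l // ha1.
Qed.

End Errors.

(** * Multiply-shift hashing *)

(** The top [l] of the low [W] bits of the product. Multiply-shift usually takes an odd multiplier;
    here [rho] is any word, and l + u <= W for characters of u bits replaces oddness. *)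
Definition mshash (W l rho x : nat) : nat :=
  ((rho %% 2 ^ W) * x) %% 2 ^ W %/ 2 ^ (W - l).

Lemma mshash_lt W l rho x : l <= W -> mshash W l rho x < 2 ^ l.
Proof.
move=> h; rewrite /mshash ltn_divLR ?expn_gt0 // -expnD subnKC //.
by rewrite ltn_pmod // expn_gt0.
Qed.

Section Collision.

Variables (w W l u d : nat).
Hypotheses (hW : W <= w) (hl : l + u <= W) (d0 : 0 < d) (du : d < 2 ^ u).

Let T := 2 ^ (W - l).
Let B := 2 ^ l.

Let TB : T * B = 2 ^ W.
Proof. by rewrite /T /B -expnD subnK //; lia. Qed.

(** Write d = o 2 ^ s with o odd. Then s < u <= W - l, and c is an inverse of o modulo 2 ^ W times 2
    ^ (W - l - s). *)
Lemma shift_exists : exists c, (c * d) %% 2 ^ W = T %% 2 ^ W.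
Proof.
have [o [ho ed]] : exists o, coprime o 2 /\ d = o * 2 ^ logn 2 d.
  have [o cop e] := pfactor_coprime (isT : prime 2) d0.
  by exists o; rewrite coprime_sym.
set s := logn 2 d in ed.
have su : s < u.
  rewrite -(ltn_exp2l _ _ (isT : 1 < 2)); apply: leq_ltn_trans du.
  by rewrite ed leq_pmull //; move: d0; rewrite ed; case: (o).
have cop : coprime o (2 ^ W) by rewrite coprimeXr.
have o0 : 0 < o by move: d0; rewrite ed; case: (o).
have [a b e _] := @egcdnP o (2 ^ W) o0.
rewrite (eqP cop) in e.
exists (a * 2 ^ (W - l - s)).
have -> : a * 2 ^ (W - l - s) * d = (a * o) * T.
  rewrite ed /T mulnACA -expnD subnK //; lia.
by rewrite e mulnDl mul1n mulnAC modnMDl.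
Qed.

Definition blk (rho : 'I_(2 ^ w)) : nat := (rho * d) %% 2 ^ W %/ T.

Lemma blk_lt rho : blk rho < B.
Proof. by rewrite /blk ltn_divLR ?expn_gt0 // (mulnC B) TB ltn_pmod ?expn_gt0. Qed.

(* Adding to rho the c with c d = 2 ^ (W - l) mod 2 ^ W moves rho d by exactly
   one block, so all blocks have the same number of preimages. *)
Lemma card_blk_shift j : j < B ->
  #|[set rho | blk rho == j]| <= #|[set rho | blk rho == j.+1 %% B]|.
Proof.
move=> hj; have [c hc] := shift_exists.
have w0 : 0 < 2 ^ w by rewrite expn_gt0.
pose f (rho : 'I_(2 ^ w)) : 'I_(2 ^ w) := Ordinal (ltn_pmod (rho + c) w0).
have inj : injective f.
  move=> a b /(congr1 val) /= /eqP; rewrite eqn_modDr !modn_small // => /eqP h.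
  exact: val_inj.
rewrite -(card_imset _ inj); apply: subset_leq_card.
apply/subsetP => _ /imsetP [rho hr ->]; move: hr; rewrite !inE => /eqP hb; rewrite /blk /=.
have -> : ((rho + c) %% 2 ^ w * d) %% 2 ^ W = ((rho * d) %% 2 ^ W + T) %% 2 ^ W.
  rewrite -modnMml modn_dvdm ?dvdn_exp2l // modnMml mulnDl -modnDmr hc.
  by rewrite modnDmr modnDml.
set v := (rho * d) %% 2 ^ W in hb *.
have vlt : v < T * B by rewrite TB ltn_pmod ?expn_gt0.
have T0 : 0 < T by rewrite expn_gt0.
have e : v = j * T + v %% T by rewrite -hb /blk -/v -divn_eq.
have rT : v %% T < T by rewrite ltn_pmod.
rewrite -TB; case: (ltnP j.+1 B) => h.
  rewrite (modn_small h) modn_small; last first.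
    rewrite e addnAC -mulSnr; apply: (@leq_trans (T * j.+2)); last by rewrite leq_mul2l h orbT.
    by rewrite mulnS (mulnC T) addnC ltn_add2r.
  by rewrite e addnAC -mulSnr divnMDl // divn_small ?addn0.
have ej : j.+1 = B by lia.
have -> : v + T = T * B + v %% T by rewrite {1}e addnAC -mulSnr ej (mulnC B).
have vW : v %% T < T * B by apply: leq_trans rT _; rewrite leq_pmulr // -ej.
by rewrite modnDl (modn_small vW) divn_small // ej modnn.
Qed.

Lemma sum_card_blk : \sum_(j < B) #|[set rho | blk rho == j]| = 2 ^ w.
Proof.
transitivity #|'I_(2 ^ w)|; last exact: card_ord.
rewrite -sum1_card (partition_big (fun rho => Ordinal (blk_lt rho)) xpredT) //=.
apply: eq_bigr => j _; rewrite -sum1_card; apply: eq_bigl => rho.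
by rewrite inE.
Qed.

(** Counts never decrease along the cycle of blocks, hence are constant. What is used is that block
    0 is at most the average and that the last block is at most block 0. *)
Lemma card_blk0_le j : j < B -> #|[set rho | blk rho == 0]| <= #|[set rho | blk rho == j]|.
Proof.
elim: j => // j IH hj; apply: leq_trans (IH (ltnW hj)) _.
by have := card_blk_shift (ltnW hj); rewrite (modn_small hj).
Qed.

Lemma card_blk0 : #|[set rho | blk rho == 0]| * B <= 2 ^ w.
Proof.
apply: leq_trans (_ : \sum_(j < B) #|[set rho | blk rho == j]| <= _); last by rewrite sum_card_blk.
rewrite mulnC -[B in B * _]card_ord -sum_nat_const.
by apply: leq_sum => j _; apply: card_blk0_le.
Qed.

Lemma card_blk_last : #|[set rho | blk rho == B.-1]| <= #|[set rho | blk rho == 0]|.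
Proof.
have B0 : 0 < B by rewrite expn_gt0.
have := @card_blk_shift B.-1; rewrite prednK // modnn; exact.
Qed.

End Collision.

Lemma subn_lt_same_block a b T : 0 < T -> a %/ T = b %/ T -> a - b < T.
Proof.
move=> T0 h; rewrite (divn_eq a T) (divn_eq b T) h subnDl.
exact: leq_ltn_trans (leq_subr _ _) (ltn_pmod _ T0).
Qed.

Lemma last_block L T c : 0 < L -> 0 < c <= T -> (L * T - c) %/ T = L.-1.
Proof.
case: L => // L _ /andP [c0 cT]; rewrite mulSn addnC -addnBA // divnMDl ?divn_small ?addn0 //; lia.
Qed.

(* On a collision rho (x - y) lies in the first or the last block. *)
Lemma mshash_collision_lt w W l u x y : W <= w -> l + u <= W -> y < x -> x < 2 ^ u ->
  #|[set rho : 'I_(2 ^ w) | mshash W l rho x == mshash W l rho y]| * 2 ^ l <= 2 * 2 ^ w.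
Proof.
move=> hW hl hyx hx.
have d0 : 0 < x - y by lia.
have du : x - y < 2 ^ u by lia.
have c0 := card_blk0 hW hl d0 du; have c1 := card_blk_last hW hl d0 du.
set S0 := [set rho | blk _ _ _ rho == 0] in c0 c1.
set S1 := [set rho | blk _ _ _ rho == _.-1] in c1.
suff sub : [set rho : 'I_(2 ^ w) | mshash W l rho x == mshash W l rho y] \subset S0 :|: S1.
  apply: (@leq_trans (#|S0 :|: S1| * 2 ^ l)); first by rewrite leq_mul2r subset_leq_card ?orbT.
  apply: (@leq_trans ((#|S0| + #|S1|) * 2 ^ l)); first by rewrite leq_mul2r cardsU leq_subr orbT.
  by rewrite mulnDl mul2n -addnn leq_add // (leq_trans _ c0) // leq_mul2r c1 orbT.
apply/subsetP => rho; rewrite !inE /mshash /blk => /eqP.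
set T := 2 ^ (W - l); have T0 : 0 < T by rewrite expn_gt0.
have W0 : 0 < 2 ^ W by rewrite expn_gt0.
have TB : 2 ^ l * T = 2 ^ W by rewrite -expnD subnKC //; lia.
rewrite !modnMml; set a := (rho * x) %% _; set b := (rho * y) %% _ => hab.
have al : a < 2 ^ W by rewrite ltn_pmod.
have bl : b < 2 ^ W by rewrite ltn_pmod.
have E : rho * (x - y) + b = a %[mod 2 ^ W].
  by rewrite modnDmr -mulnDr subnK ?modn_mod // ltnW.
case: (leqP b a) => hba.
  apply/orP; left; have -> : (rho * (x - y)) %% 2 ^ W = a - b.
    rewrite -[RHS](modn_small (leq_ltn_trans (leq_subr b a) al)).
    by apply/eqP; rewrite -(eqn_modDr b) subnK // E.
  by rewrite divn_small // subn_lt_same_block.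
apply/orP; right; have -> : (rho * (x - y)) %% 2 ^ W = 2 ^ W - (b - a).
  have ba0 : 0 < b - a by rewrite subn_gt0.
  have bL : 2 ^ W - (b - a) < 2 ^ W by rewrite ltn_subrL ba0.
  rewrite -[RHS](modn_small bL).
  have eb2 : 2 ^ W - (b - a) + b = a + 2 ^ W.
    rewrite -[X in _ + X = _](subnK (ltnW hba)) addnA subnK 1?addnC //.
    exact: leq_trans (leq_subr _ _) (ltnW bl).
  by apply/eqP; rewrite -(eqn_modDr b) E eb2 modnDr.
rewrite -TB last_block ?expn_gt0 // subn_gt0 hba /=.
by apply: ltnW; rewrite subn_lt_same_block.
Qed.

Lemma mshash_collision w W l u x y : W <= w -> l + u <= W -> x != y ->
  x < 2 ^ u -> y < 2 ^ u ->
  #|[set rho : 'I_(2 ^ w) | mshash W l rho x == mshash W l rho y]| * 2 ^ l <= 2 * 2 ^ w.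
Proof.
move=> hW hl; case: (ltngtP x y) => // h _ hx hy; last exact: mshash_collision_lt hW hl h hx.
have := mshash_collision_lt hW hl h hy.
rewrite (_ : [set rho : 'I_(2 ^ w) | mshash W l rho x == mshash W l rho y] =
   [set rho : 'I_(2 ^ w) | mshash W l rho y == mshash W l rho x]) //.
by apply/setP => rho; rewrite !inE eq_sym.
Qed.

(** Union bound over the list: each element collides with probability at most 2 / 2 ^ l. *)
Lemma mshash_has_collision w W l u (s : seq nat) y : W <= w -> l + u <= W ->
  y < 2 ^ u -> all (fun x => x < 2 ^ u) s -> y \notin s -> 4 * size s <= 2 ^ l ->
  #|[set rho : 'I_(2 ^ w) | has (fun x => mshash W l rho x == mshash W l rho y) s]| * 2
    <= 2 ^ w.
Proof.
move=> hW hl hy hs hn h4.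
suff H : #|[set rho : 'I_(2 ^ w) | has (fun x => mshash W l rho x == mshash W l rho y) s]| *
   2 ^ l <= size s * (2 * 2 ^ w).
  case: (posnP (size s)) => e.
    rewrite (size0nil e); set E := [set _ | _].
    have -> : E = set0; last by rewrite cards0.
    by apply/setP => rho; rewrite !inE.
  by nia.
elim: s hs hn {h4} => [|x s IH] /=.
  move=> _ _; set E := [set _ | _].
  have -> : E = set0; last by rewrite cards0.
  by apply/setP => rho; rewrite !inE.
case/andP=> hx hs; rewrite inE negb_or => /andP [ne hn].
have IH' := IH hs hn.
have c := mshash_collision hW hl (_ : x != y) hx hy.
have {}c := c ltac:(by rewrite eq_sym).
set E1 := [set rho : 'I_(2 ^ w) | mshash W l rho x == _] in c.
set E2 := [set rho : 'I_(2 ^ w) | has _ s] in IH'.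
set E := [set _ | _]; have -> : E = E1 :|: E2 by apply/setP => rho; rewrite !inE.
rewrite cardsU; nia.
Qed.

(** * Independent rounds and the union bound over shifts *)

(** Independence of the words of the tape, by counting: these tuples form a product of sets, R
    factors of which contain at most half of the words. *)
Lemma card_tuple_all (X t R : nat) (P : pred 'I_X) : R <= t -> #|[set x | P x]| * 2 <= X ->
  #|[set rnd : t.-tuple 'I_X | [forall i : 'I_t, (i < R) ==> P (tnth rnd i)]]| * 2 ^ R
    <= X ^ t.
Proof.
move=> hR hP.
pose F (i : 'I_t) : pred 'I_X := if i < R then P else xpredT.
pose g (rnd : t.-tuple 'I_X) : {ffun 'I_t -> 'I_X} := [ffun i => tnth rnd i].
have inj : injective g.
  by move=> a b /ffunP h; apply/eq_from_tnth => i; have := h i; rewrite !ffunE.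
set S := [set rnd | _].
have le1 : #|S| <= #|(family F : pred {ffun 'I_t -> 'I_X})|.
  rewrite -(card_imset _ inj); apply: subset_leq_card; apply/subsetP => _ /imsetP [rnd hr ->].
  apply/familyP => i; rewrite ffunE /F; move: hr; rewrite inE => /forallP /(_ i).
  by case: ifP.
have pw : \prod_(i < t) (if i < R then 2 else 1) = 2 ^ R.
  rewrite -(big_mkord xpredT (fun i => if i < R then 2 else 1)) (@big_cat_nat _ _ _ R) //=.
  rewrite (@eq_big_nat _ _ _ 0 R _ (fun=> 2)); last by move=> i /andP [_ ->].
  rewrite prod_nat_const_nat subn0 big_nat_cond big1 ?muln1 //.
  by move=> i /andP [/andP [h _] _]; rewrite ltnNge h.
apply: (@leq_trans (#|(family F : pred {ffun 'I_t -> 'I_X})| * 2 ^ R)).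
  by rewrite leq_mul2r le1 orbT.
rewrite card_family foldrE big_map big_enum /= -pw -big_split /=.
rewrite -[t in X ^ t]card_ord -prod_nat_const; apply: leq_prod => i _.
rewrite /F; case: ifP => _; last by rewrite muln1 (leq_trans (max_card _)) ?card_ord.
by apply: leq_trans hP; rewrite cardsE.
Qed.

(** At most n events cover [E], each of probability at most 1 / 2 ^ R <= 1 / n ^ (c + 1). *)
Lemma uniform_prob_le (X t R n c : nat) (I : finType) (E : {set t.-tuple 'I_X})
    (S : I -> {set t.-tuple 'I_X}) :
  0 < X -> 0 < n -> #|I| <= n -> n ^ c.+1 <= 2 ^ R -> (forall i, #|S i| * 2 ^ R <= X ^ t) ->
  (forall x, x \in E -> exists i, x \in S i) ->
  (uniform_prob E <= 1 / n%:R ^+ c)%R.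
Proof.
move=> X0 n0 hI hR hS hE.
have h1 : #|E| * 2 ^ R <= n * X ^ t.
  apply: (@leq_trans ((\sum_(i : I) #|S i|) * 2 ^ R)).
    rewrite leq_mul2r; apply/orP; right.
    apply: leq_trans (_ : #|\bigcup_i S i| <= _); last first.
      elim/big_rec2: _ => [|i a b _ hb]; first by rewrite cards0.
      by rewrite cardsU (leq_trans (leq_subr _ _)) // leq_add2l.
    apply: subset_leq_card; apply/subsetP => x /hE [i hi]; apply/bigcupP; by exists i.
  rewrite big_distrl /=; apply: (@leq_trans (\sum_(i : I) X ^ t)).
    by apply: leq_sum => i _; apply: hS.
  by rewrite sum_nat_const leq_mul2r hI orbT.
have Xt : 0 < X ^ t by rewrite expn_gt0 X0.
have h2 : #|E| * n ^ c <= X ^ t.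
  rewrite -(leq_pmul2r n0) -mulnA -expnSr mulnC [X ^ t * n]mulnC.
  by apply: leq_trans h1; rewrite mulnC leq_mul2l hR orbT.
rewrite /uniform_prob card_tuple card_ord.
rewrite ler_pdivrMr ?ltr0n // mulrAC mul1r ler_pdivlMr ?exprn_gt0 ?ltr0n //.
by rewrite -natrX -natrM ler_nat.
Qed.

(** * The program *)

Declare Scope prog_scope.
Delimit Scope prog_scope with P.
Notation "e1 + e2" := (EBin BAdd e1 e2) : prog_scope.
Notation "e1 - e2" := (EBin BSub e1 e2) : prog_scope.
Notation "e1 * e2" := (EBin BMul e1 e2) : prog_scope.
Notation "e1 / e2" := (EBin BDiv e1 e2) : prog_scope.
Notation "e1 %% e2" := (EBin BMod e1 e2) : prog_scope.
Notation "e1 == e2" := (EBin BEq e1 e2) : prog_scope.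
Notation "e1 < e2" := (EBin BLt e1 e2) : prog_scope.
Notation "'#' k" := (ECst k) (at level 1, format "# k") : prog_scope.
Notation "'$' x" := (EReg x) (at level 1, x at level 0, format "$ x") : prog_scope.
Notation "x ::= e" := (PAsg x e%P) (at level 55, no associativity) : prog_scope.
Notation "p ;; q" := (PSeq p%P q%P) (at level 58, right associativity, format "p ;; '/' q") : prog_scope.
Bind Scope prog_scope with expr.
Bind Scope prog_scope with prog.

Definition pow2 (e : expr) : expr := EBin BShl (ECst 1) e.

(* floor (e / S) for a signed e: an offset makes the dividend nonnegative. *)
Definition fdiv (e : expr) : expr := ((e + $10 * $11) / $10 - $11)%P.

(* Variables: 0, 1 sizes n, m; 4 maximum degree D; 5 lgn n; 6, 7 number of hash
   bits l and 2 ^ l; 8, 9 block exponent k and N = 2 ^ k; 10, 11 scale S of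
   the fixed-point numbers and S ^ 2; 12 transform length; 13, 14 the powers
   of 2 in the hash function; 15 random word; 18 log2 S; 20 to 26 loop
   counters; 40, 41 argument and value of the square root; 45 half the length
   of a butterfly.  Arrays: 1, 2 cosines and sines; 3, 4 roots of unity;
   5 marked hash values, stamped with the number of the round so that it need
   not be cleared; 6, 7 vector being transformed; 8, 9 its next value;
   10 positions known not to be occurrences. *)
Section Programs.

Local Open Scope prog_scope.

Definition p_maxdeg : prog :=
  4 ::= #0 ;;
  PFor 21 $0 (30 ::= EDegT (EInp $21) ;; PIf ($4 < $30) (4 ::= $30) PSkip).

(** Rounded-up binary logarithm by linear search. The arguments are O(max (1, D) n), so this time is
    affordable. *)
Definition p_log : prog :=
  31 ::= #0 ;; PFor 26 $30 (PIf (pow2 $31 < $30) (31 ::= $31 + #1) PSkip).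

Definition p_naive : prog :=
  PFor 21 ($0 - $1 + #1) (PFor 22 $1
    (PIf (EMatch (EInp ($21 + $22)) (EInp ($0 + $22))) PSkip (PSt 10 $21 #1))).

(** Successive text blocks advance by N / 2 cells. Two blocks are added to the quotient: one for the
    pattern and one for the incomplete last step. The exponent 120 lgn n makes the scale the square
    of 2 ^ (60 lgn n). *)
Definition p_setup (cW : nat) : prog :=
  30 ::= $0 + #1 ;; p_log ;; 5 ::= $31 ;;
  30 ::= #4 * $4 + #1 ;; p_log ;; 6 ::= $31 ;;
  7 ::= pow2 $6 ;;
  30 ::= #2 * $1 * $7 ;; p_log ;; 8 ::= $31 ;;
  9 ::= pow2 $8 ;;
  18 ::= #120 * $5 ;; 10 ::= pow2 $18 ;; 11 ::= $10 * $10 ;;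
  12 ::= $9 * ($0 * $7 / ($9 / #2) + #2) ;;
  13 ::= pow2 (ECst cW * $5) ;; 14 ::= pow2 (ECst cW * $5 - $6).

(** Binary digits of the root from the top one down: a bit is kept unless the square overshoots. *)
Definition p_isqrt : prog :=
  41 ::= #0 ;;
  PFor 26 ($18 + #1) (30 ::= pow2 ($18 - $26) ;; 31 ::= $41 + $30 ;;
    PIf ($40 < $31 * $31) PSkip (41 ::= $31)).

Definition p_roots : prog :=
  PSt 1 #0 (#0 - $10) ;; PSt 2 #0 #0 ;;
  PFor 24 $8 (
    40 ::= ($10 + EArr 1 $24) * $10 / #2 ;; p_isqrt ;; 43 ::= $41 ;;
    40 ::= ($10 - EArr 1 $24) * $10 / #2 ;; p_isqrt ;;
    PSt 1 ($24 + #1) $43 ;; PSt 2 ($24 + #1) $41).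

Definition p_table : prog :=
  PSt 3 #0 $10 ;; PSt 4 #0 #0 ;;
  PFor 24 $8 (
    32 ::= pow2 $24 ;; 33 ::= EArr 1 $24 ;; 34 ::= EArr 2 $24 ;;
    PFor 23 $32 (
      35 ::= EArr 3 $23 ;; 36 ::= EArr 4 $23 ;;
      PSt 3 ($32 + $23) (fdiv ($33 * $35 - $34 * $36)) ;;
      PSt 4 ($32 + $23) (fdiv ($33 * $36 + $34 * $35)))).

Definition ehash (e : expr) : expr := ($15 * e) %% $13 / $14.

Definition p_mark : prog :=
  PFor 21 $0 (30 ::= EInp $21 ;;
    PFor 25 (EDegT $30) (PSt 5 ($21 * $7 + ehash (ENbr $30 $25)) ($20 + #1))).

Definition p_load : prog :=
  PFor 23 $12 (PSt 7 $23 #0 ;;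
    PIf ($23 < $9) (PSt 6 $23 #0)
      (30 ::= $23 - $9 ;; 31 ::= $30 / $9 * ($9 / #2) + $30 %% $9 ;;
       PIf (EArr 5 $31 == $20 + #1) (PSt 6 $23 #0) (PSt 6 $23 $10))).

(** Storing cell t of the pattern at - t modulo N turns the cyclic convolution into a
    correlation. *)
Definition p_pattern : prog :=
  PFor 22 $1 (PSt 6 (($9 - ($22 * $7 + ehash (EInp ($0 + $22)))) %% $9) $10).

Definition p_copy : prog :=
  PFor 23 $12 (PSt 6 $23 (EArr 8 $23) ;; PSt 7 $23 (EArr 9 $23)).

(* The base index of the butterfly containing $23 goes to 32, its position in
   the butterfly to 31, and the root of unity to (34, 35). *)
Definition p_butterfly : prog :=
  31 ::= $23 / $45 %% #2 ;; 32 ::= $23 - $31 * $45 ;;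
  33 ::= #2 * ($23 %% $9 / (#2 * $45)) ;;
  34 ::= EArr 3 $33 ;; 35 ::= EArr 4 $33.

Definition p_fwd_body : prog :=
  p_butterfly ;;
  36 ::= EArr 6 ($32 + $45) ;; 37 ::= EArr 7 ($32 + $45) ;;
  38 ::= fdiv ($34 * $36 - $35 * $37) ;;
  39 ::= fdiv ($34 * $37 + $35 * $36) ;;
  PSt 8 $23 (EArr 6 $32 + (#1 - #2 * $31) * $38) ;;
  PSt 9 $23 (EArr 7 $32 + (#1 - #2 * $31) * $39).

Definition p_fwd : prog :=
  PFor 24 $8 (45 ::= pow2 ($8 - #1 - $24) ;; PFor 23 $12 p_fwd_body ;; p_copy).

Definition p_mult : prog :=
  PFor 23 ($12 - $9) (
    30 ::= $23 %% $9 ;; 31 ::= $9 + $23 ;;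
    34 ::= EArr 6 $31 ;; 35 ::= EArr 7 $31 ;;
    36 ::= EArr 6 $30 ;; 37 ::= EArr 7 $30 ;;
    PSt 6 $31 (fdiv ($34 * $36 - $35 * $37)) ;;
    PSt 7 $31 (fdiv ($34 * $37 + $35 * $36))).

(** From u + z v and u - z v: the sum is 2 u, and the difference times the conjugate of z is 2 v, as
    z has modulus 1. The factors 2 are never divided out. *)
Definition p_inv_body : prog :=
  p_butterfly ;;
  PIf ($31 == #0)
    (PSt 8 $23 (EArr 6 $32 + EArr 6 ($32 + $45)) ;;
     PSt 9 $23 (EArr 7 $32 + EArr 7 ($32 + $45)))
    (36 ::= EArr 6 $32 - EArr 6 ($32 + $45) ;;
     37 ::= EArr 7 $32 - EArr 7 ($32 + $45) ;;
     PSt 8 $23 (fdiv ($34 * $36 + $35 * $37)) ;;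
     PSt 9 $23 (fdiv ($34 * $37 - $35 * $36))).

Definition p_inv : prog :=
  PFor 24 $8 (45 ::= pow2 $24 ;; PFor 23 $12 p_inv_body ;; p_copy).

(** The cell is close to N S times the number of incompatible pairs and is compared with N S / 2.
    Adding S ^ 3 to both sides makes them nonnegative, so that the comparison of words is
    faithful. *)
Definition p_check : prog :=
  PFor 21 ($0 - $1 + #1) (
    30 ::= $21 * $7 ;; 31 ::= $9 / #2 ;;
    32 ::= ($30 / $31 + #1) * $9 + $30 %% $31 ;;
    PIf ($9 * $10 + $10 * $11 < #2 * EArr 6 $32 + $10 * $11) (PSt 10 $21 #1) PSkip).

Definition p_corr : prog :=
  15 ::= $15 %% $13 ;; p_mark ;; p_load ;; p_pattern ;;
  p_fwd ;; p_mult ;; p_inv ;; p_check.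

Definition p_round : prog := PRand 15 ;; p_corr.

Definition p_report : prog :=
  PFor 21 ($0 - $1 + #1) (PIf (EArr 10 $21 == #0) (PRep $21) PSkip).

Definition p_main (cW cR : nat) : prog :=
  p_maxdeg ;;
  PIf ($4 < $1)
    (p_setup cW ;; p_roots ;; p_table ;; PFor 20 (ECst cR * $5) p_round)
    p_naive ;;
  p_report.

End Programs.

Lemma wf_main cW cR : wf (p_main cW cR).
Proof. by []. Qed.

(** Splits an index into block, butterfly, half and offset, the form used by [dft_step]; [q] has the
    same offset in the first half of the same butterfly. *)
Lemma butterfly_index k lev p (h := 2 ^ (k - lev.+1)) (b := p %/ h %% 2)
  (r := (p %% 2 ^ k) %/ (2 * h)) (q := p - b * h) :
  lev < k ->
  [/\ p = p %/ 2 ^ k * 2 ^ k + r * (2 * h) + b * h + p %% h,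
      q = p %/ 2 ^ k * 2 ^ k + r * (2 * h) + p %% h,
      r < 2 ^ lev, p %% h < h & b < 2].
Proof.
move=> hl.
have h0 : 0 < h by rewrite expn_gt0.
have eN : 2 ^ k = 2 ^ lev * (2 * h).
  by rewrite /h -expnS -expnD; congr (2 ^ _); lia.
have rl : r < 2 ^ lev by rewrite /r ltn_divLR ?muln_gt0 // -eN ltn_pmod ?expn_gt0.
have e : p = p %/ 2 ^ k * 2 ^ k + r * (2 * h) + b * h + p %% h.
  rewrite {1}(divn_eq p (2 ^ k)) -2!addnA; congr (_ + _).
  rewrite {1}(divn_eq (p %% 2 ^ k) (2 * h)) -/r; congr (_ + _).
  have e1 : p %% 2 ^ k %% (2 * h) = p %% (2 * h).
    by rewrite eN; apply: modn_dvdm; exact: (dvdn_mull _ (dvdnn (2 * h))).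
  have e2 : p %% (2 * h) %% h = p %% h.
    by apply: modn_dvdm; exact: (dvdn_mull 2 (dvdnn h)).
  rewrite e1 {1}(divn_eq (p %% (2 * h)) h) e2; congr (_ * _ + _).
  by rewrite -modn_divl.
split=> //; [|by rewrite ltn_pmod|by rewrite ltn_pmod].
by rewrite /q {1}e addnAC addnK.
Qed.

Section Base.

Variables (w : nat) (O : oracle) (inp : nat -> nat) (base lim : nat).

Notation eval := (eval O inp).
Notation eok := (eok w O inp base lim).
Notation spec := (spec w O inp base lim).
Notation wp := (wp w O inp base lim).
Notation inw := (inw w).

Lemma inw_nat (x : nat) : inw (Posz x) = (x < 2 ^ w).
Proof. by []. Qed.

Lemma inidx_nat (x : nat) : inidx lim (Posz x) = (x < lim).
Proof. by []. Qed.

Lemma wp_asg x e s (Q : ist -> Prop) v :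
  eok e s -> eval e s = v -> Q (setr s x v) -> wp (PAsg x e) s Q.
Proof. by move=> h <-. Qed.

Lemma wp_seq p q s Q : wp p s (fun s' => wp q s' Q) -> wp (PSeq p q) s Q.
Proof. by []. Qed.

Lemma wp_st a e1 e2 s (Q : ist -> Prop) i v :
  eok e1 s -> eok e2 s -> eval e1 s = Posz i -> i < lim -> eval e2 s = v ->
  Q (seta s a (Posz i) v) -> wp (PSt a e1 e2) s Q.
Proof. by move=> h1 h2 e hi e2' hQ /=; rewrite e e2'; split. Qed.

Lemma divz_posz (a b : nat) : (Posz a %/ Posz b)%Z = Posz (a %/ b).
Proof. exact: divz_nat. Qed.

Lemma modz_posz (a b : nat) : (Posz a %% Posz b)%Z = Posz (a %% b).
Proof. exact: modz_nat. Qed.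

Lemma fdiv_ok e s (S : nat) : env s 10 = Posz S -> env s 11 = Posz (S * S) -> 0 < S ->
  4 * (S * (S * S)) <= 2 ^ w -> eok e s -> `|eval e s|%N <= S * (S * S) ->
  eok (fdiv e) s /\ eval (fdiv e) s = (eval e s %/ Posz S)%Z.
Proof.
move=> e10 e11 S0 hS ok1; set x := eval e s => hx; split; last first.
  rewrite /= e10 e11 -/x.
  have -> : (x + Posz S * Posz (S * S) = Posz (S * S) * Posz S + x)%R.
    by rewrite addrC mulrC.
  by rewrite divzMDl; [rewrite addrAC subrr add0r | lia].
rewrite /= ok1 e10 e11 -/x.
set Z := S * (S * S) in hS hx *.
have -> : (Posz S * Posz (S * S))%R = Posz Z by rewrite -PoszM.
have SZ : S <= Z by rewrite /Z leq_pmulr // muln_gt0 S0.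
clearbody Z; rewrite /inw; lia.
Qed.

End Base.

(** * The fixed-point transform *)

Arguments upd A B f x v y /.

Section FFT.

Variables (w : nat) (O : oracle) (inp : nat -> nat) (base lim : nat).

Notation spec := (spec w O inp base lim).
Notation wp := (wp w O inp base lim).

Variables (k M sg f : nat).
Notation N := (2 ^ k).
Notation S := (sg ^ 2).
Notation L := (2 ^ k * M).
Notation z := (zt k).

Record fparams (s : ist) : Prop := FParams {
  e8 : env s 8 = Posz k; e9 : env s 9 = Posz N;
  e10 : env s 10 = Posz S; e11 : env s 11 = Posz (S * S);
  e12 : env s 12 = Posz L; e18 : env s 18 = Posz f }.

(** The last and largest error is [inv_tol], which is 250 N ^ 7 sg; the constant 512 makes twice
    that at most S. *)
Definition sg_big : Prop := 512 * N ^ 7 <= sg.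
Definition S_fits : Prop := 4 * (S * (S * S)) <= 2 ^ w.

Hypotheses (k0 : 0 < k) (M0 : 0 < M) (sgN : sg_big) (Sw : S_fits) (Llim : L <= lim) (limw : lim < 2 ^ w).

Lemma fparams_frame ws aws s s' :
  frame ws aws s s' -> all (fun x => x \notin ws) [:: 8; 9; 10; 11; 12; 18] ->
  fparams s -> fparams s'.
Proof.
move=> [fr _] /= /and5P [h1 h2 h3 h4 /and3P [h5 h6 _]] [p1 p2 p3 p4 p5 p6].
by split; rewrite fr.
Qed.

Lemma sg0 : 0 < sg.
Proof. by apply: leq_trans sgN; rewrite muln_gt0 expn_gt0 expn_gt0. Qed.

Lemma S0 : 0 < S.
Proof. by rewrite expn_gt0 sg0. Qed.

Lemma N_L : N <= L.
Proof. by rewrite leq_pmulr. Qed.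

Lemma L_w : L < 2 ^ w.
Proof. exact: leq_ltn_trans Llim limw. Qed.

Definition table_tol := 10 * N ^ 2 * sg.
Definition fwd_tol := 50 * N ^ 4 * sg.

Definition tabs (s : ist) : Prop := forall r, r < N ->
  (`|gz (arr s 3 (Posz r)) (arr s 4 (Posz r)) - S%:R * z r| <= table_tol%:R)%R.

Definition ap (e : nat) (s : ist) (a b : nat) (g : nat -> algC) : Prop :=
  forall p, p < L -> (`|gz (arr s a (Posz p)) (arr s b (Posz p)) - S%:R * g p| <= e%:R)%R.

Lemma wp_butterfly s (Q : ist -> Prop) lev p (h := 2 ^ (k - lev.+1)) :
  lev < k -> p < L -> fparams s -> env s 45 = Posz h -> env s 23 = Posz p ->
  let b := p %/ h %% 2 in
  let q := p - b * h in
  let r := 2 * ((p %% N) %/ (2 * h)) in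
  Q (setr (setr (setr (setr (setr s 31 (Posz b)) 32 (Posz q)) 33 (Posz r))
       34 (arr s 3 (Posz r))) 35 (arr s 4 (Posz r))) ->
  wp p_butterfly s Q.
Proof.
move=> hl hp [p8 p9 p10 p11 p12 _] e45 e23 b q r hQ.
have [ep eq rl ol b2] := @butterfly_index k lev p hl.
rewrite -/h -/b -/q in ep eq ol b2.
have h0 : 0 < h by rewrite expn_gt0.
have eN : N = 2 ^ lev * (2 * h).
  by rewrite /h -expnS subnSK // -expnD subnKC // ltnW.
have h2N : 2 * h <= N by rewrite eN leq_pmull // expn_gt0.
have rN : r < N.
  apply: (@leq_trans (2 * 2 ^ lev)); first by rewrite /r ltn_mul2l /= rl.
  by rewrite eN mulnCA leq_mul2l /= leq_pmulr.
have NL := N_L; have Lw := L_w.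
have Nw : N < 2 ^ w := leq_ltn_trans NL Lw.
have h2w : 2 * h < 2 ^ w := leq_ltn_trans h2N Nw.
have hw : h < 2 ^ w by apply: leq_ltn_trans h2w; rewrite leq_pmull.
have pw : p < 2 ^ w := ltn_trans hp Lw.
have phw : p %/ h < 2 ^ w by apply: leq_ltn_trans pw; apply: leq_div.
have w2 : 2 < 2 ^ w.
  by apply: leq_ltn_trans Nw; rewrite -[X in X <= _]expn1 leq_exp2l.
have pNw : p %% N < 2 ^ w by apply: leq_ltn_trans pw; apply: leq_mod.
have bh : b * h <= p by rewrite [X in _ <= X]ep addnAC leq_addl.
have rlim : r < lim := leq_trans rN (leq_trans NL Llim).
apply: wp_seq; apply: (wp_asg (v := Posz b)).
- by rewrite /= e45 e23 !inw_nat hw pw /= divz_posz inw_nat phw w2.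
- by rewrite /= e45 e23 divz_posz modz_posz.
apply: wp_seq; apply: (wp_asg (v := Posz q)).
- by [].
- by rewrite /= e45 e23 -PoszM subzn.
apply: wp_seq; apply: (wp_asg (v := Posz r)).
- by rewrite /= e45 e23 p9 !inw_nat pw Nw /= modz_posz -?PoszM !inw_nat pNw h2w.
- by rewrite /= e45 e23 p9 modz_posz -?PoszM divz_posz -?PoszM.
apply: wp_seq; apply: (wp_asg (v := arr s 3 (Posz r))) => //.
Qed.

Lemma N_big j : j <= 7 -> 512 * N ^ j <= sg.
Proof.
move=> hj; apply: leq_trans sgN; rewrite leq_mul2l /=.
by apply: leq_pexp2l; rewrite ?expn_gt0.
Qed.

Lemma table_tol_S : table_tol <= S.
Proof.
rewrite /table_tol [S]expnS expn1 leq_mul2r; apply/orP; right.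
by apply: leq_trans (N_big (isT : 2 <= 7)); rewrite leq_mul2r orbT.
Qed.

(** The left side is the error that [cmul_err] adds for a tabulated root times a value of modulus at
    most 2 N ^ 2; forward and inverse passes share this bound. *)
Lemma table_tol_fwd : table_tol * (2 * N ^ 2 + 1) + 2 <= fwd_tol.
Proof.
have := N_big (isT : 0 <= 7); rewrite expn0 muln1 => sg512.
have N2 : 0 < N ^ 2 by rewrite !expn_gt0.
rewrite /table_tol /fwd_tol (_ : N ^ 4 = N ^ 2 * N ^ 2); last by rewrite -expnD.
move: sg512 N2; generalize (N ^ 2) => a; clear; nia.
Qed.

Lemma prod_fits G e : G <= 2 * N ^ 2 -> e <= 2 * S -> (S * 1 + table_tol) * (S * G + e) <= S * (S * S).
Proof.
move=> hG he.
have h1 : S * 1 + table_tol <= 2 * S by rewrite muln1 mul2n -addnn leq_add2l table_tol_S.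
have h2 : S * G + e <= S * (2 * N ^ 2 + 2).
  by rewrite mulnDr leq_add ?leq_mul2l ?hG ?orbT // mulnC.
apply: leq_trans (leq_mul h1 h2) _.
have N2 : 0 < N ^ 2 by rewrite !expn_gt0.
have hN := N_big (isT : 2 <= 7).
have sgS : sg <= S by rewrite -[X in X <= _]expn1 leq_pexp2l ?sg0.
have key : 2 * (2 * N ^ 2 + 2) <= S.
  by move: N2 hN sgS; generalize (N ^ 2) S; clear; lia.
apply: (@leq_trans (S * (S * (2 * (2 * N ^ 2 + 2))))).
  by generalize S (N ^ 2); clear; lia.
by rewrite !leq_mul2l key !orbT.
Qed.

Lemma dft_norm lev A (a : nat) p : (forall q, `|A q| <= a%:R)%R ->
  (`|dft z k lev A p| <= (2 ^ lev * a)%:R)%R.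
Proof.
move=> hA; rewrite /dft; apply: le_trans (ler_norm_sum _ _ _) _.
apply: (@le_trans _ _ (\sum_(q < 2 ^ lev) (a%:R : algC))%R).
  by apply: ler_sum => q _; rewrite normrM normrX norm_zt expr1n mulr1.
by rewrite sumr_const card_ord natrM mulr_natl.
Qed.

(** * Errors and safety of one butterfly pass *)

(** Each input contributes e and the product adds [fwd_tol]. Starting from exact data, j passes thus
    give (2 ^ j - 1) [fwd_tol]. *)
Lemma fwd_err (A : nat -> algC) lev p e (xr xi : int -> int) zr zi
  (h := 2 ^ (k - lev.+1)) (b := p %/ h %% 2) (q := p - b * h)
  (r := 2 * ((p %% N) %/ (2 * h))) :
  lev < k -> (forall q, `|A q| <= 1)%R -> e <= S ->
  (`|gz zr zi - S%:R * z r| <= table_tol%:R)%R ->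
  (`|gz (xr (Posz q)) (xi (Posz q)) - S%:R * dft z k lev A q| <= e%:R)%R ->
  (`|gz (xr (Posz (q + h))) (xi (Posz (q + h))) - S%:R * dft z k lev A (q + h)| <= e%:R)%R ->
  (`|gz (xr (Posz q) + (1 - 2 * Posz b) * ((zr * xr (Posz (q + h)) - zi * xi (Posz (q + h))) %/ Posz S)%Z)
        (xi (Posz q) + (1 - 2 * Posz b) * ((zr * xi (Posz (q + h)) + zi * xr (Posz (q + h))) %/ Posz S)%Z)
     - S%:R * dft z k lev.+1 A p| <= (2 * e + fwd_tol)%:R)%R.
Proof.
move=> hl hA heS hz hu hv.
have [ep eq rl ol b2] := @butterfly_index k lev p hl.
rewrite -/h -/b -/q in ep eq ol b2.
have G1 : (`|dft z k lev A (q + h)| <= (2 ^ lev)%:R)%R.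
  by have := @dft_norm lev A 1 (q + h) hA; rewrite muln1.
have nz : (`|z r| <= 1%:R)%R by rewrite norm_zt.
have c := cmul_err hz hv nz G1 S0 heS.
have ztE := @zt_even k; have ztO := @zt_odd k.
have st := dft_step ztE ztO A (p %/ N) hl rl b2 ol.
rewrite -/h in st; rewrite -ep -eq in st; rewrite st -/r.
set t1 := ((_ - _) %/ _)%Z in c *; set t2 := ((_ + _) %/ _)%Z in c *.
have es : ((1 - 2 * Posz b)%:~R = (-1) ^+ b :> algC)%R.
  by case: (b) b2 => [|[|//]] _ /=; rewrite ?expr0 ?expr1.
have -> : (gz (xr (Posz q) + (1 - 2 * Posz b) * t1) (xi (Posz q) + (1 - 2 * Posz b) * t2) =
   gz (xr (Posz q)) (xi (Posz q)) + (-1) ^+ b * gz t1 t2)%R.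
  by rewrite /gz !intrD !(intrM _ (1 - 2 * Posz b)) es; ring.
have -> : (gz (xr (Posz q)) (xi (Posz q)) + (-1) ^+ b * gz t1 t2 -
  S%:R * (dft z k lev A q + (-1) ^+ b * z r * dft z k lev A (q + h)) =
  (gz (xr (Posz q)) (xi (Posz q)) - S%:R * dft z k lev A q) +
  (-1) ^+ b * (gz t1 t2 - S%:R * (z r * dft z k lev A (q + h))))%R by ring.
apply: le_trans (ler_normD _ _) _.
rewrite normrM normrX normrN1 expr1n mul1r.
apply: le_trans (lerD hu c) _; rewrite -natrD ler_nat.
have lN : 2 ^ lev <= 2 * N ^ 2.
  apply: (@leq_trans N); first by rewrite leq_exp2l // ltnW.
  apply: (@leq_trans (N ^ 2)); last by rewrite leq_pmull.
  by rewrite -[X in X <= _]expn1 leq_pexp2l ?expn_gt0.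
apply: leq_trans (_ : 2 * e + (table_tol * (2 * N ^ 2 + 1) + 2) <= _); last by rewrite leq_add2l table_tol_fwd.
have : table_tol * (2 ^ lev + 1) <= table_tol * (2 * N ^ 2 + 1) by rewrite leq_mul2l leq_add2r lN orbT.
clear; move: (table_tol * (2 ^ lev + 1)) (table_tol * (2 * N ^ 2 + 1)) => x y; lia.
Qed.

Lemma dft_pair (Y : nat -> algC) lev p (h := 2 ^ (k - lev.+1)) (b := p %/ h %% 2)
  (q := p - b * h) (r := 2 * ((p %% N) %/ (2 * h))) : lev < k ->
  (dft z k lev.+1 Y q = dft z k lev Y q + z r * dft z k lev Y (q + h))%R /\
  (dft z k lev.+1 Y (q + h) = dft z k lev Y q - z r * dft z k lev Y (q + h))%R.
Proof.
move=> hl.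
have [ep eq rl ol b2] := @butterfly_index k lev p hl.
rewrite -/h -/b -/q in ep eq ol b2.
have ztE := @zt_even k; have ztO := @zt_odd k.
have st0 := dft_step ztE ztO Y (p %/ N) hl rl (isT : 0 < 2) ol.
have st1 := dft_step ztE ztO Y (p %/ N) hl rl (isT : 1 < 2) ol.
rewrite -/h mul0n addn0 -eq expr0 mul1r in st0.
rewrite -/h -eq mul1n addnAC -eq expr1 !mulN1r mulNr in st1.
by rewrite -/r in st0 st1.
Qed.

(** [sc] is the power of 2 accumulated by the unnormalised inverse. As sc 2 ^ (lev + 1) <= N and |Y|
    <= N, exact values stay at most N ^ 2, which keeps the products within S ^ 3. *)
Lemma inv_err (Y : nat -> algC) (sc : nat) lev p e (xr xi : int -> int) zr zi
  (h := 2 ^ (k - lev.+1)) (b := p %/ h %% 2) (q := p - b * h)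
  (r := 2 * ((p %% N) %/ (2 * h))) (g := fun p => (sc%:R * dft z k lev.+1 Y p)%R) :
  lev < k -> (forall q, `|Y q| <= N%:R)%R -> 2 * e <= S -> sc * 2 ^ lev.+1 <= N ->
  (`|gz zr zi - S%:R * z r| <= table_tol%:R)%R ->
  (`|gz (xr (Posz q)) (xi (Posz q)) - S%:R * g q| <= e%:R)%R ->
  (`|gz (xr (Posz (q + h))) (xi (Posz (q + h))) - S%:R * g (q + h)%N| <= e%:R)%R ->
  let dr := (xr (Posz q) - xr (Posz (q + h)))%R in
  let di := (xi (Posz q) - xi (Posz (q + h)))%R in
  (b = 0 -> (`|gz (xr (Posz q) + xr (Posz (q + h))) (xi (Posz q) + xi (Posz (q + h)))
     - S%:R * ((2 * sc)%:R * dft z k lev Y p)| <= (2 * e + fwd_tol)%:R)%R) /\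
  (b = 1 -> [/\ (`|gz ((zr * dr + zi * di) %/ Posz S)%Z ((zr * di - zi * dr) %/ Posz S)%Z
     - S%:R * ((2 * sc)%:R * dft z k lev Y p)| <= (2 * e + fwd_tol)%:R)%R,
     `|(zr * dr + zi * di)%R| <= S * (S * S) & `|(zr * di - zi * dr)%R| <= S * (S * S)]).
Proof.
move=> hl hY eS hsc hz hu hv dr di.
have [ep eq rl ol b2] := @butterfly_index k lev p hl.
rewrite -/h -/b -/q in ep eq ol b2.
have [st0 st1] := dft_pair Y p hl.
rewrite -/h -/b -/q -/r in st0 st1.
have gb t : (`|g t| <= (N * N)%:R)%R.
  rewrite /g normrM normr_nat.
  apply: le_trans (_ : (sc%:R * (2 ^ lev.+1 * N)%:R <= _))%R.
    by rewrite ler_wpM2l ?ler0n // dft_norm.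
  by rewrite -natrM ler_nat mulnA leq_mul2r hsc orbT.
split=> hb.
  have pq : p = q by rewrite /q hb mul0n subn0.
  have -> : ((2 * sc)%:R * dft z k lev Y p = g q + g (q + h)%N)%R.
    by rewrite pq /g st0 st1 natrM; ring.
  rewrite -gzD mulrDr opprD addrACA.
  apply: le_trans (ler_normD _ _) _; apply: le_trans (lerD hu hv) _.
  by rewrite -natrD ler_nat addnn -mul2n leq_addr.
have pq : p = q + h by rewrite /q hb mul1n subnK // ep hb mul1n; exact: leq_trans (leq_addl _ _) (leq_addr _ _).
(* On the unit circle the conjugate is the inverse, and a table entry is conjugated by a change of
   sign, at no cost in precision. *)
have zz : (z r * (z r)^* = 1)%R by rewrite -normCK norm_zt expr1n.
have -> : ((2 * sc)%:R * dft z k lev Y p = (z r)^* * (g q - g (q + h)%N))%R.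
  rewrite pq /g st0 st1 natrM.
  transitivity ((z r * (z r)^*) * (2 * sc%:R * dft z k lev Y (q + h)))%R; last by ring.
  by rewrite zz mul1r.
have hz' : (`|gz zr (- zi) - S%:R * (z r)^*| <= table_tol%:R)%R.
  rewrite -conj_gz -{1}[(S%:R)%R]conjC_nat -rmorphM -rmorphB norm_conjC //.
have hd : (`|gz dr di - S%:R * (g q - g (q + h)%N)| <= (2 * e)%:R)%R.
  rewrite /dr /di -gzB mulrBr opprB addrACA -[X in (_ + X)%R]opprB opprB.
  have -> : (gz (xr q) (xi q) + S%:R * g (q + h)%N + (- gz (xr (q + h)%N) (xi (q + h)%N) - S%:R * g q) =
     (gz (xr q) (xi q) - S%:R * g q) - (gz (xr (q + h)%N) (xi (q + h)%N) - S%:R * g (q + h)%N))%R by ring.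
  apply: le_trans (ler_normB _ _) _; apply: le_trans (lerD hu hv) _.
  by rewrite -natrD ler_nat addnn -mul2n.
have nz : (`|(z r)^*| <= 1%:R)%R by rewrite norm_conjC norm_zt.
have G2 : (`|g q - g (q + h)%N| <= (2 * N ^ 2)%:R)%R.
  apply: le_trans (ler_normB _ _) _; apply: le_trans (lerD (gb _) (gb _)) _.
  by rewrite -natrD ler_nat addnn -mul2n.
have c := cmul_err hz' hd nz G2 S0 eS.
have r1 := cmul_re_bound hz' hd nz G2.
have r2 := cmul_im_bound hz' hd nz G2.
have hpf : (S * 1 + table_tol) * (S * (2 * N ^ 2) + 2 * e) <= S * (S * S).
  apply: prod_fits => //; apply: leq_trans eS _; by rewrite leq_pmull.
rewrite !mulNr opprK in r1 c; rewrite mulNr in r2 c.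
split; [|exact: leq_trans r1 hpf|exact: leq_trans r2 hpf].
apply: le_trans c _; rewrite ler_nat mul1n -addnA leq_add2l table_tol_fwd //.
Qed.

Lemma butterfly_lt lev p (h := 2 ^ (k - lev.+1)) (b := p %/ h %% 2) (q := p - b * h) :
  lev < k -> p < L -> q + h < L.
Proof.
move=> hl hp.
have [ep eq rl ol b2] := @butterfly_index k lev p hl.
rewrite -/h -/b -/q in ep eq ol b2.
set r := (p %% N) %/ (2 * h) in ep eq rl.
have eN : N = 2 ^ lev * (2 * h).
  by rewrite /h -expnS subnSK // -expnD subnKC // ltnW.
have hP : p %/ N < M by rewrite ltn_divLR ?expn_gt0 // mulnC.
apply: (@leq_trans ((p %/ N).+1 * N)); last by rewrite mulnC leq_mul2l hP orbT.
have hr : r * (2 * h) + 2 * h <= N.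
  by rewrite addnC -mulSn [X in _ <= X]eN leq_mul2r rl orbT.
rewrite eq mulSn -!addnA [X in _ < X]addnC ltn_add2l.
apply: leq_trans hr.
by rewrite ltn_add2l mul2n -addnn ltn_add2r.
Qed.

Lemma wp_fwd_body s lev p A e (h := 2 ^ (k - lev.+1)) :
  lev < k -> p < L -> fparams s -> env s 45 = Posz h -> env s 23 = Posz p ->
  tabs s -> (forall q, `|A q| <= 1)%R -> e <= S -> ap e s 6 7 (dft z k lev A) ->
  wp p_fwd_body s (fun s' => exists v1 v2,
    [/\ arr s' 8 = upd (arr s 8) (Posz p) v1, arr s' 9 = upd (arr s 9) (Posz p) v2 &
    (`|gz v1 v2 - S%:R * dft z k lev.+1 A p| <= (2 * e + fwd_tol)%:R)%R]).
Proof.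
move=> hl hp par e45 e23 ht hA eS hap.
have [p8 p9 p10 p11 p12 p18] := par.
apply: wp_seq; apply: (wp_butterfly hl hp par e45 e23); rewrite -/h.
set b := p %/ h %% 2; set q := p - b * h; set r := 2 * _.
have qh := butterfly_lt hl hp; rewrite -/h -/b -/q in qh.
have qL : q < L by apply: leq_ltn_trans qh; apply: leq_addr.
have [ep eq rl ol b2] := @butterfly_index k lev p hl.
have rN : r < N.
  have eN : N = 2 ^ lev * (2 * h).
    by rewrite /h -expnS subnSK // -expnD subnKC // ltnW.
  apply: (@leq_trans (2 * 2 ^ lev)); first by rewrite /r ltn_mul2l /= rl.
  by rewrite eN mulnCA leq_mul2l /= leq_pmulr // expn_gt0.
have hz := ht r rN; have hu := hap q qL; have hv := hap _ qh.
have fe := fwd_err hl hA eS hz hu hv.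
have G1 : (`|dft z k lev A (q + h)| <= (2 ^ lev)%:R)%R.
  by have := @dft_norm lev A 1 (q + h) hA; rewrite muln1.
have nz : (`|z r| <= 1%:R)%R by rewrite norm_zt.
have r1 := cmul_re_bound hz hv nz G1.
have r2 := cmul_im_bound hz hv nz G1.
have hpf : (S * 1 + table_tol) * (S * 2 ^ lev + e) <= S * (S * S).
  apply: prod_fits; last by apply: leq_trans eS _; rewrite leq_pmull.
  apply: (@leq_trans N); first by rewrite leq_exp2l // ltnW.
  apply: (@leq_trans (N ^ 2)); last by rewrite leq_pmull.
  by rewrite -[X in X <= _]expn1 leq_pexp2l ?expn_gt0.
have {}r1 := leq_trans r1 hpf; have {}r2 := leq_trans r2 hpf.
have qhl : q + h < lim := leq_trans qh Llim.
have ql : q < lim := leq_trans qL Llim.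
have pl : p < lim := leq_trans hp Llim.
apply: wp_seq; apply: (wp_asg (v := arr s 6 (Posz (q + h)))).
- by rewrite /= e45 -PoszD inidx_nat.
- by rewrite /= e45 -PoszD.
apply: wp_seq; apply: (wp_asg (v := arr s 7 (Posz (q + h)))).
- by rewrite /= e45 -PoszD inidx_nat.
- by rewrite /= e45 -PoszD.
set s1 := setr (setr _ 36 _) 37 _.
have q10 : env s1 10 = Posz S by [].
have q11 : env s1 11 = Posz (S * S) by [].
have [k1 v1] := @fdiv_ok w O inp base lim ($34 * $36 - $35 * $37)%P s1 S q10 q11 S0 Sw isT r1.
apply: wp_seq; apply: (wp_asg k1 v1).
set s2 := setr s1 38 _.
have [k2 v2] := @fdiv_ok w O inp base lim ($34 * $37 + $35 * $36)%P s2 S q10 q11 S0 Sw isT r2.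
apply: wp_seq; apply: (wp_asg k2 v2).
set s3 := setr s2 39 _.
have i32 : inidx lim (Posz q) by [].
have i23 : env s3 23 = Posz p by [].
apply: wp_seq; apply: (wp_st (i := p)); [by []| | by [] | by [] |reflexivity|].
  by rewrite /= inidx_nat ql.
apply: (wp_st (i := p)); [by []| | by [] | by [] |reflexivity|].
  by rewrite /= inidx_nat ql.
eexists; eexists; split; [reflexivity|reflexivity|].
exact: fe.
Qed.

(** Syntactic conditions for running a body on all cells in turn: it preserves the parameters, and
    it writes arrays 8 and 9 only, so that its input in 6 and 7 stays fixed during the pass. *)
Definition passes (body : prog) : bool :=
  all (fun x => x \notin 23 :: writes body) [:: 8; 9; 10; 11; 12; 18; 24; 45] &&
  all (fun a => a \in [:: 8; 9]) (awrites body) && wf (PFor 23 $12%P body).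

Lemma spec_copy s : fparams s ->
  spec p_copy s (80 * L + 13) (fun s' => forall p, p < L ->
    arr s' 6 (Posz p) = arr s 8 (Posz p) /\ arr s' 7 (Posz p) = arr s 9 (Posz p)).
Proof.
move=> [p8 p9 p10 p11 p12 p18].
apply: (@spec_for _ _ _ _ _ _ _ _ _ L 70 _ (fun i s' => forall p, p < i ->
    arr s' 6 (Posz p) = arr s 8 (Posz p) /\ arr s' 7 (Posz p) = arr s 9 (Posz p))) => //.
- exact: L_w.
- move=> i s' hi [fr fa] hI; apply: wp_spec => //.
  have il : i < lim := leq_trans hi Llim.
  rewrite /= !inidx_nat il; split=> //; split=> // p; rewrite ltnS leq_eqVlt => /orP [/eqP ->|hp].
    by rewrite !eqxx !fa.
  rewrite !eqz_nat ltn_eqF //; exact: hI.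
- by rewrite /= mulnC; move: L => x; clear; lia.
Qed.

Lemma spec_pass body s T (V : nat -> algC) e :
  fparams s -> passes body -> scost body <= T ->
  (forall p s', p < L -> frame (23 :: writes body) [:: 8; 9] s s' -> env s' 23 = Posz p ->
    wp body s' (fun s'' => exists v1 v2,
      [/\ arr s'' 8 = upd (arr s' 8) (Posz p) v1, arr s'' 9 = upd (arr s' 9) (Posz p) v2 &
       (`|gz v1 v2 - S%:R * V p| <= e%:R)%R])) ->
  spec (PSeq (PFor 23 $12%P body) p_copy) s (L * (T + 90) + 40) (fun s' => ap e s' 6 7 V).
Proof.
move=> par /andP [/andP [hws /allP haw] _] hT hbody.
have [p8 p9 p10 p11 p12 p18] := par.
have fpar : all (fun x => x \notin 23 :: writes body) [:: 8; 9; 10; 11; 12; 18].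
  by apply/allP => x hx; apply: (allP hws); move: hx; rewrite !inE; do ?[case/orP=> [->|]; rewrite ?orbT //]; move=> ->; rewrite ?orbT.
apply: (@spec_seq _ _ _ _ _ _ _ _ (L * (T + 7) + 13) (80 * L + 13) _ _
   (fun s' => ap e s' 8 9 V)).
- apply: (@spec_for _ _ _ _ _ _ _ _ _ L T _ (fun i s' => forall p, p < i ->
    (`|gz (arr s' 8 (Posz p)) (arr s' 9 (Posz p)) - S%:R * V p| <= e%:R)%R)) => //.
  + exact: L_w.
  + move=> i s' hi fr hI; have {}fr := frame_sub (fun _ h => h) haw fr.
    have fr' : frame (23 :: writes body) [:: 8; 9] s (setr s' 23 (Posz i)).
      case: fr => f1 f2; split=> // x hx /=.
      by move: (hx); rewrite inE negb_or => /andP [/negbTE -> _]; exact: f1.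
    have hb := hbody i _ hi fr' (erefl _).
    have sp := wp_spec hT hb.
    apply: (spec_weaken sp (leqnn _)) => s'' _ [v1 [v2 [h8 h9 hv]]] p.
    rewrite ltnS leq_eqVlt h8 h9 => /orP [/eqP ->|hp]; first by rewrite /= eqxx.
    by rewrite /= eqz_nat ltn_eqF //; exact: hI.
  + by rewrite /=; lia.
- move=> s' fr h.
  have par' : fparams s' by apply: (fparams_frame fr) => //.
  apply: (spec_weaken (spec_copy par') (leqnn _)) => s'' _ hc p hp.
  by have [-> ->] := hc p hp; apply: h.
- by rewrite mulnDr (mulnDr L T 90); move: (L * T) (L) => x y; clear; lia.
Qed.

Lemma powers_le i j : i <= j -> N ^ i <= N ^ j.
Proof. by move=> h; rewrite leq_pexp2l // expn_gt0. Qed.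

Lemma Nc0_S : N * fwd_tol <= S.
Proof.
rewrite /fwd_tol (_ : N * (50 * N ^ 4 * sg) = 50 * N ^ 5 * sg); last first.
  by rewrite (_ : N ^ 5 = N * N ^ 4) ?expnS //; move: (N ^ 4) (N) => a b; clear; lia.
rewrite [X in _ <= X]expnS expn1 leq_mul2r; apply/orP; right.
by apply: leq_trans (N_big (isT : 5 <= 7)); rewrite leq_mul2r orbT.
Qed.

Lemma two_pow_pred j : 2 * (2 ^ j - 1) + 1 = 2 ^ j.+1 - 1.
Proof. by rewrite expnS; have := expn_gt0 2 j; move: (2 ^ j) => x; clear; lia. Qed.

Lemma fwd_pass_ok : passes p_fwd_body.
Proof. by []. Qed.

Lemma spec_fwd s A : fparams s -> tabs s -> (forall q, `|A q| <= 1)%R ->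
  ap 0 s 6 7 (dft z k 0 A) ->
  spec p_fwd s (k * (L * 690 + 80) + 13) (fun s' => ap (N * fwd_tol) s' 6 7 (dft z k k A)).
Proof.
move=> par ht hA h0; have [p8 p9 p10 p11 p12 p18] := par.
have kw : k < 2 ^ w.
  by apply: leq_ltn_trans L_w; apply: leq_trans N_L; apply/ltnW/ltn_expl.
apply: (@spec_for _ _ _ _ _ _ _ _ _ k (L * 690 + 70) _
  (fun j s' => ap ((2 ^ j - 1) * fwd_tol) s' 6 7 (dft z k j A))) => //.
- move=> j s' hj fr hI.
  have par' : fparams (setr s' 24 (Posz j)).
    by have [q8 q9 q10 q11 q12 q18] : fparams s' := fparams_frame fr isT par; split.
  apply: (@spec_seq _ _ _ _ _ _ _ _ 22 (L * 690 + 40) _ _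
     (fun s1 => s1 = setr (setr s' 24 (Posz j)) 45 (Posz (2 ^ (k - j.+1))))).
  + apply: wp_spec => //.
    have ek : (Posz k - 1 - Posz j)%R = Posz (k - j.+1).
      by rewrite -addrA -opprD -PoszD add1n subzn.
    have [q8 _ _ _ _ _] := par'; rewrite /= in q8.
    split; rewrite /= q8 ek.
      by rewrite inw_nat; apply: leq_ltn_trans kw; apply: leq_subr.
    by rewrite mul1r.
  + move=> s1 _ ->; set s2 := setr _ _ _.
    have par2 : fparams s2 by case: par'.
    have eS : (2 ^ j - 1) * fwd_tol <= S.
      apply: leq_trans Nc0_S; rewrite leq_mul2r; apply/orP; right.
      by apply: leq_trans (leq_subr _ _) _; rewrite leq_exp2l // ltnW.
    apply: (spec_weaken (@spec_pass p_fwd_body s2 600 (dft z k j.+1 A) ((2 ^ j.+1 - 1) * fwd_tol) par2 fwd_pass_ok _ _)).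
    * by [].
    * move=> p s3 hp fr3 e23.
      have par3 : fparams s3 by apply: (fparams_frame fr3) => //.
      have [f1 f2] := fr3; have [g1 g2] := fr.
      have e45 : env s3 45 = Posz (2 ^ (k - j.+1)) by rewrite f1.
      have ht3 : tabs s3 by move=> r hr; rewrite !f2 //= !g2 //; apply: ht.
      have hI3 : ap ((2 ^ j - 1) * fwd_tol) s3 6 7 (dft z k j A).
        by move=> p' hp'; rewrite !f2 //=; apply: hI.
      have := wp_fwd_body hj hp par3 e45 e23 ht3 hA eS hI3.
      by rewrite -two_pow_pred mulnDl mul1n mulnA.
    * by [].
    * by [].
  + by move: (L * 690) => x; clear; lia.
- move=> s' _ hI p hp; apply: le_trans (hI p hp) _.
  by rewrite ler_nat leq_mul2r leq_subr orbT.
- by rewrite /=; move: (L * 690) => x; clear; lia.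
Qed.

(** * Pointwise product by the transform of the pattern *)

(** [p_mult] leaves block 0 alone, so the inverse transform finds the pattern itself there. *)
Definition conv (A : nat -> algC) (p : nat) : algC := if p < N then A p else cconv k A p.

Definition mult_tol := 200 * N ^ 6 * sg.

Lemma mult_err_le : N * (N * fwd_tol) + N * fwd_tol * (N + 1) + 2 <= mult_tol.
Proof.
rewrite /fwd_tol /mult_tol.
have E5 : N ^ 5 = N * N ^ 4 := expnS N 4.
have E6 : N ^ 6 = N * (N * N ^ 4) by rewrite -E5 -expnS.
have -> : N * (N * (50 * N ^ 4 * sg)) = 50 * N ^ 6 * sg.
  by rewrite E6; move: (N ^ 4) (N) => a b; clear; lia.
have -> : N * (50 * N ^ 4 * sg) * (N + 1) = 50 * N ^ 6 * sg + 50 * N ^ 5 * sg.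
  by rewrite E6 E5; move: (N ^ 4) (N) => a b; clear; lia.
have h1 : 50 * N ^ 5 * sg <= 50 * N ^ 6 * sg by rewrite leq_mul2r leq_mul2l powers_le // !orbT.
have h2 : 2 <= 50 * N ^ 6 * sg.
  have : 1 <= N ^ 6 * sg by rewrite muln_gt0 expn_gt0 expn_gt0 sg0.
  by rewrite -mulnA; move: (N ^ 6 * sg) => x; clear; lia.
by rewrite -!mulnA in h1 h2 *; move: (N ^ 6 * sg) (N ^ 5 * sg) h1 h2 => x y; clear; lia.
Qed.

Lemma mult_fits e : e <= S -> (S * N + e) * (S * N + e) <= S * (S * S).
Proof.
move=> he.
have h1 : S * N + e <= S * (N + 1) by rewrite mulnDr muln1 leq_add2l.
apply: leq_trans (leq_mul h1 h1) _.
have sgS : sg <= S by rewrite -[X in X <= _]expn1 leq_pexp2l ?sg0.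
have N0 : 0 < N by rewrite expn_gt0.
have key : (N + 1) * (N + 1) <= S.
  apply: leq_trans sgS; apply: leq_trans (N_big (isT : 2 <= 7)).
  by rewrite expnS expn1; move: (N) N0 => a; clear; nia.
apply: (@leq_trans (S * (S * ((N + 1) * (N + 1))))).
  by move: (S) (N + 1); clear; lia.
by rewrite !leq_mul2l key !orbT.
Qed.

Lemma dft_conv0 A p : p < N -> dft z k k (conv A) p = dft z k k A p.
Proof.
move=> hp; have hp0 : p = 0 * N + p by rewrite mul0n add0n.
rewrite {1}hp0 [in RHS]hp0 !dft_full //; apply: eq_bigr => q _.
by rewrite /conv mul0n add0n ltn_ord.
Qed.

Lemma dft_conv1 A p : N <= p -> dft z k k (conv A) p = (dft z k k A p * dft z k k A (p %% N))%R.
Proof.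
move=> hp; rewrite (divn_eq p N).
have pN : p %% N < N by rewrite ltn_pmod // expn_gt0.
rewrite (dft_cconv (zt0 k) (@zt_even k) (@zt_odd k) (A := A)) //.
  by rewrite modnMDl modn_mod.
move=> q hq; rewrite /conv ifF //.
have : 1 <= p %/ N by rewrite divn_gt0 ?expn_gt0.
by move=> h1; apply/negbTE; rewrite -leqNgt (leq_trans _ (leq_addr _ _)) // leq_pmull.
Qed.

(** The product is made in place: the invariant separates the cells already multiplied from block 0
    and the cells to come, which keep their old contents. *)
Lemma spec_mult s A : fparams s -> (forall q, `|A q| <= 1)%R ->
  ap (N * fwd_tol) s 6 7 (dft z k k A) ->
  spec p_mult s (L * 400 + 30) (fun s' => ap mult_tol s' 6 7 (dft z k k (conv A))).
Proof.
move=> par hA hap; have [p8 p9 p10 p11 p12 p18] := par.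
have NL := N_L; have Lw := L_w.
have N0 : 0 < N by rewrite expn_gt0.
have ez : (Posz L - Posz N)%R = Posz (L - N) by rewrite subzn.
have G1 q : (`|dft z k k A q| <= N%:R)%R.
  by have := @dft_norm k A 1 q hA; rewrite muln1.
apply: (@spec_for _ _ _ _ _ _ _ _ _ (L - N) 300 _ (fun i s' =>
  forall q, q < L ->
  (N <= q < N + i ->
    (`|gz (arr s' 6 (Posz q)) (arr s' 7 (Posz q)) - S%:R * dft z k k (conv A) q| <= mult_tol%:R)%R) /\
  ((q < N) || (N + i <= q) ->
    arr s' 6 (Posz q) = arr s 6 (Posz q) /\ arr s' 7 (Posz q) = arr s 7 (Posz q)))) => //.
- by rewrite inw_nat; apply: leq_ltn_trans Lw; apply: leq_subr.
- by rewrite /= p9 p12 ez.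
- by move=> q hq; split=> //; rewrite addn0 => /andP [a b]; move: (leq_ltn_trans a b); rewrite ltnn.
- move=> i s' hi fr hI; apply: wp_spec => //.
  have [q8 q9 q10 q11 q12 q18] : fparams s' := fparams_frame fr isT par.
  have iNL : N + i < L by rewrite -ltn_subRL.
  have iL : i < L by apply: leq_ltn_trans iNL; apply: leq_addl.
  have iN : i %% N < N by rewrite ltn_pmod.
  have [_ /(_ (introT orP (or_intror (leqnn _)))) [x6 x7]] := hI _ iNL.
  have iNL2 : i %% N < L := leq_trans iN NL.
  have [_ /(_ (introT orP (or_introl iN))) [y6 y7]] := hI _ iNL2.
  have hc := hap _ iNL; have hv := hap _ iNL2.
  rewrite -x6 -x7 in hc; rewrite -y6 -y7 in hv.
  have er := cmul_err hc hv (G1 _) (G1 _) S0 Nc0_S.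
  have r1 := leq_trans (cmul_re_bound hc hv (G1 _) (G1 _)) (mult_fits Nc0_S).
  have r2 := leq_trans (cmul_im_bound hc hv (G1 _) (G1 _)) (mult_fits Nc0_S).
  apply: wp_seq; apply: (wp_asg (v := Posz (i %% N))).
  + by rewrite /= q9 !inw_nat (ltn_trans iL Lw) (leq_ltn_trans NL Lw).
  + by rewrite /= q9 modz_posz.
  apply: wp_seq; apply: (wp_asg (v := Posz (N + i))).
  + by [].
  + by rewrite /= q9 PoszD.
  have l1 : N + i < lim := leq_trans iNL Llim.
  have l2 : i %% N < lim := leq_trans iNL2 Llim.
  apply: wp_seq; apply: (wp_asg (v := arr s' 6 (Posz (N + i)))) => //.
  apply: wp_seq; apply: (wp_asg (v := arr s' 7 (Posz (N + i)))) => //.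
  apply: wp_seq; apply: (wp_asg (v := arr s' 6 (Posz (i %% N)))) => //.
  apply: wp_seq; apply: (wp_asg (v := arr s' 7 (Posz (i %% N)))) => //.
  set s1 := setr _ 37 _.
  have t10 : env s1 10 = Posz S by [].
  have t11 : env s1 11 = Posz (S * S) by [].
  have [k1 v1] := @fdiv_ok w O inp base lim ($34 * $36 - $35 * $37)%P s1 S t10 t11 S0 Sw isT r1.
  apply: wp_seq; apply: (wp_st (i := N + i) _ k1 _ _ v1) => //.
  set s2 := seta s1 _ _ _.
  have [k2 v2] := @fdiv_ok w O inp base lim ($34 * $37 + $35 * $36)%P s2 S t10 t11 S0 Sw isT r2.
  apply: (wp_st (i := N + i) _ k2 _ _ v2) => //.
  move=> q hq; split.
    rewrite addnS ltnS => /andP [nq]; rewrite leq_eqVlt => /orP [/eqP e|lt].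
      rewrite e /= !eqxx dft_conv1 ?leq_addr // modnDl.
      by apply: le_trans er _; rewrite ler_nat mult_err_le.
    rewrite /= !eqz_nat (ltn_eqF lt); have [h _] := hI q hq; apply: h; by rewrite nq.
  rewrite addnS => hqq.
  have ne : (q == N + i) = false.
    case/orP: hqq => h; first by rewrite ltn_eqF // (leq_trans h) // leq_addr.
    by rewrite gtn_eqF.
  rewrite /= !eqz_nat ne; have [_ h] := hI q hq; apply: h.
  by case/orP: hqq => h; [rewrite h|rewrite (ltnW h) orbT].
- move=> s' fr hI q hq /=; have [h1 h2] := hI q hq.
  case: (ltnP q N) => hqN; last by apply: h1; rewrite hqN subnKC.
  have [-> ->] := h2 (introT orP (or_introl hqN)).
  rewrite dft_conv0 //; apply: le_trans (hap q hq) _; rewrite ler_nat.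
  apply: leq_trans mult_err_le; rewrite -addnA addnC; apply: leq_trans (leq_addl _ _).
  by rewrite leq_pmull.
- rewrite /=; apply: (@leq_trans (L * 307 + 20)); last by rewrite (_ : 400 = 307 + 93) // mulnDr; move: (L * 307) (L * 93); clear; lia.
  by rewrite -addnA leq_add // leq_mul2r leq_subr orbT.
Qed.

(** * Inverse transform *)

Lemma wp_inv_body s lev p Y sc e (h := 2 ^ (k - lev.+1)) :
  lev < k -> p < L -> fparams s -> env s 45 = Posz h -> env s 23 = Posz p ->
  tabs s -> (forall q, `|Y q| <= N%:R)%R -> 2 * e <= S -> sc * 2 ^ lev.+1 <= N ->
  ap e s 6 7 (fun p => sc%:R * dft z k lev.+1 Y p)%R ->
  wp p_inv_body s (fun s' => exists v1 v2,
    [/\ arr s' 8 = upd (arr s 8) (Posz p) v1, arr s' 9 = upd (arr s 9) (Posz p) v2 &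
    (`|gz v1 v2 - S%:R * ((2 * sc)%:R * dft z k lev Y p)| <= (2 * e + fwd_tol)%:R)%R]).
Proof.
move=> hl hp par e45 e23 ht hY eS hsc hap.
have [p8 p9 p10 p11 p12 p18] := par.
apply: wp_seq; apply: (wp_butterfly hl hp par e45 e23); rewrite -/h.
set b := p %/ h %% 2; set q := p - b * h; set r := 2 * _.
have qh := butterfly_lt hl hp; rewrite -/h -/b -/q in qh.
have qL : q < L by apply: leq_ltn_trans qh; apply: leq_addr.
have [ep eq rl ol b2] := @butterfly_index k lev p hl.
have rN : r < N.
  have eN : N = 2 ^ lev * (2 * h).
    by rewrite /h -expnS subnSK // -expnD subnKC // ltnW.
  apply: (@leq_trans (2 * 2 ^ lev)); first by rewrite /r ltn_mul2l /= rl.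
  by rewrite eN mulnCA leq_mul2l /= leq_pmulr // expn_gt0.
have hz := ht r rN; have hu := hap q qL; have hv := hap _ qh.
have [f0 f1] := inv_err hl hY eS hsc hz hu hv.
have qhl : q + h < lim := leq_trans qh Llim.
have ql : q < lim := leq_trans qL Llim.
have pl : p < lim := leq_trans hp Llim.
have w0 : 1 < 2 ^ w.
  by apply: ltn_trans limw; apply: leq_ltn_trans qhl; rewrite addn_gt0 expn_gt0 orbT.
have bw : b < 2 ^ w := leq_trans b2 w0.
rewrite -/h -/b -/q -/r in f0 f1.
set s1 := setr _ 35 _.
split.
  split; first by rewrite /= !inw_nat bw (ltnW w0).
  by rewrite /= inw_nat; case: (_ == _); rewrite /= ?w0 ?(ltnW w0).
split=> hb; rewrite /= in hb.
  have hb0 : b = 0 by move: hb; rewrite eqz_nat; case: (altP (b =P 0)).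
  rewrite /= !inidx_nat e45 e23 -!PoszD !inidx_nat ql qhl pl; do 2!split=> //.
  eexists; eexists; split; [reflexivity|reflexivity|exact: f0 hb0].
have hb1 : b = 1.
  by move: hb b2; rewrite eqz_nat -/b; case: (b) => [|[|]].
have [f11 f12 f13] := f1 hb1.
apply: wp_seq; apply: (wp_asg (v := (arr s 6 (Posz q) - arr s 6 (Posz (q + h)))%R)).
- by rewrite /= e45 -PoszD !inidx_nat ql qhl.
- by rewrite /= e45 -PoszD.
apply: wp_seq; apply: (wp_asg (v := (arr s 7 (Posz q) - arr s 7 (Posz (q + h)))%R)).
- by rewrite /= e45 -PoszD !inidx_nat ql qhl.
- by rewrite /= e45 -PoszD.
set s2 := setr _ 37 _.
have t10 : env s2 10 = Posz S by [].
have t11 : env s2 11 = Posz (S * S) by [].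
have [k1 v1] := @fdiv_ok w O inp base lim ($34 * $36 + $35 * $37)%P s2 S t10 t11 S0 Sw isT f12.
apply: wp_seq; apply: (wp_st (i := p) _ k1 _ _ v1) => //.
set s3 := seta _ _ _ _.
have [k2 v2] := @fdiv_ok w O inp base lim ($34 * $37 - $35 * $36)%P s3 S t10 t11 S0 Sw isT f13.
apply: (wp_st (i := p) _ k2 _ _ v2) => //.
eexists; eexists; split; [reflexivity|reflexivity|exact: f11].
Qed.

Lemma inv_pass_ok : passes p_inv_body.
Proof. by []. Qed.

Definition inv_tol := 250 * N ^ 7 * sg.

Lemma inv_err_total : N * mult_tol + (N - 1) * fwd_tol <= inv_tol.
Proof.
have E7 : N ^ 7 = N * N ^ 6 := expnS N 6.
have h1 : N * mult_tol = 200 * N ^ 7 * sg.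
  by rewrite /mult_tol E7; move: (N ^ 6) (N) => a b; clear; lia.
have h2 : (N - 1) * fwd_tol <= 50 * N ^ 7 * sg.
  apply: (@leq_trans (N * fwd_tol)); first by rewrite leq_mul2r leq_subr orbT.
  rewrite /fwd_tol (_ : N * (50 * N ^ 4 * sg) = 50 * N ^ 5 * sg); last first.
    by rewrite [N ^ 5]expnS; move: (N ^ 4) (N) => a b; clear; lia.
  by rewrite leq_mul2r leq_mul2l powers_le // !orbT.
apply: (@leq_trans (200 * N ^ 7 * sg + 50 * N ^ 7 * sg)); first by rewrite h1 leq_add2l.
by rewrite /inv_tol -!mulnA; move: (N ^ 7 * sg) => x; clear; lia.
Qed.

Lemma inv_tol_S : 2 * inv_tol <= S.
Proof.
rewrite /inv_tol [X in _ <= X]expnS expn1 mulnA leq_mul2r; apply/orP; right.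
by apply: leq_trans (N_big (isT : 7 <= 7)); rewrite mulnA leq_mul2r orbT.
Qed.

(** After j passes the arrays hold 2 ^ j times level k - j of the decimation: each pass undoes one
    level and doubles the scale and the error. *)
Lemma spec_inv s Y : fparams s -> tabs s -> (forall q, `|Y q| <= N%:R)%R ->
  ap mult_tol s 6 7 (dft z k k Y) ->
  spec p_inv s (k * (L * 890 + 80) + 13)
    (fun s' => ap inv_tol s' 6 7 (fun p => N%:R * dft z k 0 Y p)%R).
Proof.
move=> par ht hY h0; have [p8 p9 p10 p11 p12 p18] := par.
have kw : k < 2 ^ w.
  by apply: leq_ltn_trans L_w; apply: leq_trans N_L; apply/ltnW/ltn_expl.
apply: (@spec_for _ _ _ _ _ _ _ _ _ k (L * 890 + 70) _
  (fun j s' => ap (2 ^ j * mult_tol + (2 ^ j - 1) * fwd_tol) s' 6 7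
                 (fun p => (2 ^ j)%:R * dft z k (k - j) Y p)%R)) => //.
- move=> p hp; rewrite expn0 mul1n subnn mul0n addn0 mul1r subn0; exact: h0.
- move=> j s' hj fr hI.
  have par' : fparams (setr s' 24 (Posz j)).
    by have [q8 q9 q10 q11 q12 q18] : fparams s' := fparams_frame fr isT par; split.
  apply: (@spec_seq _ _ _ _ _ _ _ _ 22 (L * 890 + 40) _ _
     (fun s1 => s1 = setr (setr s' 24 (Posz j)) 45 (Posz (2 ^ j)))).
  + apply: wp_spec => //.
    split; rewrite /=; last by rewrite mul1r.
    by rewrite inw_nat; apply: ltn_trans kw.
  + move=> s1 _ ->; set s2 := setr _ _ _.
    have par2 : fparams s2 by case: par'.
    set e := 2 ^ j * mult_tol + (2 ^ j - 1) * fwd_tol in hI.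
    have jN : 2 ^ j <= N by rewrite leq_exp2l // ltnW.
    have eS : 2 * e <= S.
      apply: leq_trans inv_tol_S; rewrite leq_mul2l /=; apply: leq_trans inv_err_total.
      by apply: leq_add; rewrite leq_mul2r ?leq_sub2r ?jN ?orbT.
    have hl : k - j.+1 < k by rewrite ltn_subrL.
    have el : (k - j.+1).+1 = k - j by rewrite subnSK.
    have ej : k - (k - j.+1).+1 = j by rewrite el subKn // ltnW.
    have hsc : 2 ^ j * 2 ^ (k - j.+1).+1 <= N by rewrite el -expnD subnKC // ltnW.
    have en : 2 * e + fwd_tol = 2 ^ j.+1 * mult_tol + (2 ^ j.+1 - 1) * fwd_tol.
      by rewrite -two_pow_pred expnS /e mulnDr mulnDl mul1n !mulnA !addnA.
    apply: (spec_weaken (@spec_pass p_inv_body s2 800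
       (fun p => (2 ^ j.+1)%:R * dft z k (k - j.+1) Y p)%R (2 * e + fwd_tol) par2 inv_pass_ok _ _)).
    * by [].
    * move=> p s3 hp fr3 e23.
      have par3 : fparams s3 by apply: (fparams_frame fr3).
      have [f1 f2] := fr3; have [g1 g2] := fr.
      have e45 : env s3 45 = Posz (2 ^ (k - (k - j.+1).+1)) by rewrite ej f1.
      have ht3 : tabs s3 by move=> r hr; rewrite !f2 //= !g2 //; apply: ht.
      have hI3 : ap e s3 6 7 (fun p => (2 ^ j)%:R * dft z k (k - j.+1).+1 Y p)%R.
        by move=> p' hp'; rewrite !f2 //= el; apply: hI.
      have := wp_inv_body hl hp par3 e45 e23 ht3 hY eS hsc hI3.
      by rewrite -expnS.
    * by [].
    * by move=> s4 _; rewrite en.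
  + by move: (L * 890) => x; clear; lia.
- move=> s' _ hI p hp /=; have := hI p hp; rewrite subnn => h; apply: le_trans h _.
  by rewrite ler_nat inv_err_total.
- by rewrite /=; move: (L * 890) => x; clear; lia.
Qed.

End FFT.

(** * Tables of roots of unity *)

Section Tables.

Variables (w : nat) (O : oracle) (inp : nat -> nat) (base lim : nat).

Notation eval := (eval O inp).
Notation spec := (spec w O inp base lim).

Variables (k M sg f : nat).
Notation N := (2 ^ k).
Notation S := (sg ^ 2).
Notation L := (2 ^ k * M).
Notation z := (zt k).
Notation fparams := (fparams k M sg f).

Hypotheses (k0 : 0 < k) (M0 : 0 < M) (sgN : sg_big k sg) (Sw : S_fits w sg) (Llim : L <= lim)
  (limw : lim < 2 ^ w) (f0 : 0 < f) (Sf : S = 2 ^ f).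

Lemma S_512 : 512 <= S.
Proof.
have := N_big sgN (isT : 0 <= 7); rewrite expn0 muln1 => h; apply: leq_trans h _.
by rewrite -[X in X <= _]expn1 leq_pexp2l // (sg0 sgN).
Qed.

Lemma S_pos : 0 < S.
Proof. by rewrite expn_gt0 (sg0 sgN). Qed.

Lemma S3_w : 4 * (S * S) < 2 ^ w.
Proof.
apply: leq_trans Sw.
have h1 : 1 < S by apply: leq_trans S_512.
have h2 : 0 < S * S by rewrite muln_gt0 S_pos.
by rewrite ltn_mul2l /= ltn_Pmull.
Qed.

Lemma f_w : f.+1 < 2 ^ w.
Proof.
apply: leq_ltn_trans S3_w; apply: (@leq_trans S); first by rewrite Sf ltn_expl.
by rewrite mulnA leq_pmull // muln_gt0 S_pos.
Qed.

(** Before bit f - b is decided, the root lies in an interval of length 2 ^ (f + 1 - b) starting at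
    the current value. *)
Lemma spec_isqrt s V : env s 18 = Posz f -> env s 40 = Posz V -> V <= S * S ->
  spec p_isqrt s (f.+1 * 80 + 30)
    (fun s' => exists x, env s' 41 = Posz x /\ x ^ 2 <= V < x.+1 ^ 2).
Proof.
move=> e18 e40 hV.
have fw := f_w; have S3 := S3_w.
have Vw : V < 2 ^ w.
  by apply: leq_ltn_trans hV _; apply: leq_ltn_trans S3; rewrite leq_pmull.
have w1 : 1 < 2 ^ w by apply: leq_ltn_trans fw.
have S4 : 2 ^ f.+1 * 2 ^ f.+1 = 4 * (S * S).
  by rewrite Sf expnS; move: (2 ^ f) => x; clear; lia.
apply: (@spec_seq _ _ _ _ _ _ _ _ 5 (f.+1 * 80 + 20) _ _ (fun s1 => s1 = setr s 41 0%R)).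
- exact: wp_spec.
- move=> s1 _ ->.
  apply: (@spec_for _ _ _ _ _ _ _ _ _ f.+1 70 _ (fun b s' => exists x,
     [/\ env s' 41 = Posz x, x ^ 2 <= V < (x + 2 ^ (f.+1 - b)) ^ 2 &
      x + 2 ^ (f.+1 - b) <= 2 ^ f.+1])) => //.
  + by rewrite /= e18 addrC -PoszD.
  + exists 0; split=> //; rewrite subn0 add0n /= expnS expn1 S4.
    apply: leq_ltn_trans hV _; have S5 : 0 < S * S by rewrite muln_gt0 S_pos.
    by rewrite ltn_Pmull.
  + move=> b s' hb [fr _] [x [ex /andP [hx1 hx2] hx3]]; apply: wp_spec => //.
    have q18 : env s' 18 = Posz f by rewrite fr.
    have q40 : env s' 40 = Posz V by rewrite fr.
    have eb : f.+1 - b = (f - b).+1 by rewrite subSn.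
    have ee : (Posz f - Posz b)%R = Posz (f - b) by rewrite subzn.
    have e2p : 2 ^ (f - b).+1 = 2 ^ (f - b) + 2 ^ (f - b) by rewrite expnS mul2n addnn.
    rewrite eb e2p addnA in hx2 hx3.
    have yle : x + 2 ^ (f - b) <= 2 ^ f.+1 by apply: leq_trans hx3; rewrite leq_addr.
    have yw : (x + 2 ^ (f - b)) * (x + 2 ^ (f - b)) < 2 ^ w.
      by apply: leq_ltn_trans S3; rewrite -S4 leq_mul.
    rewrite /= q18 q40 ex ee mul1r -PoszD -PoszM !inw_nat.
    split; first by rewrite (leq_ltn_trans (leq_subr _ _)) // ltnW.
    split=> //; split.
      by split; [rewrite Vw yw | case: (_ < _)%R; rewrite /= ?w1 ?(ltnW w1)].
    rewrite ltz_nat; split=> h.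
      have h' : V < (x + 2 ^ (f - b)) * (x + 2 ^ (f - b)) by move: h; case: (V < _).
      by exists x; rewrite subSS hx1 -mulnn; split.
    have h' : (x + 2 ^ (f - b)) * (x + 2 ^ (f - b)) <= V.
      by rewrite leqNgt; move: h; case: (V < _).
    by split=> //; exists (x + 2 ^ (f - b)); rewrite subSS hx2 andbT -mulnn; split.
  + move=> s' _ [x [ex hx _]]; exists x; split=> //.
    by move: hx; rewrite subnn expn0 addn1.
  + by move: (f.+1) => x; rewrite /=; clear; lia.
- by move: (f.+1) => x; clear; lia.
Qed.

(** Each level is computed from the previous cosine alone. The larger error of the sine, about sg
    times that of the cosine, is therefore never amplified further. The last clause keeps the
    radicands nonnegative. *)
Definition root_ok (s : ist) (i : nat) : Prop :=
  [/\ (`|(arr s 1 (Posz i))%:~R - S%:R * cs i| <= i%:R)%R,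
      (`|(arr s 2 (Posz i))%:~R - S%:R * sn i| <= (sg * i + 1)%:R)%R &
      (- Posz S <= arr s 1 (Posz i) <= Posz S)%R].

Lemma half_val (a : int) : (- Posz S <= a <= Posz S)%R ->
  exists V, [/\ Posz (2 * V) = ((Posz S + a) * Posz S)%R,
    (((Posz S + a) * Posz S) %/ 2)%Z = Posz V & V <= S * S].
Proof.
move=> ha.
have eS : S = 2 * 2 ^ f.-1 by rewrite -expnS prednK.
exists (`|(Posz S + a)%R| * 2 ^ f.-1).
have h0 : (0 <= Posz S + a)%R by move: ha; move: (S) => x; lia.
have e1 : Posz (2 * (`|(Posz S + a)%R| * 2 ^ f.-1)) = ((Posz S + a) * Posz S)%R.
  by rewrite mulnCA -eS PoszM gez0_abs.
split=> //.
  by rewrite -e1 PoszM mulrC mulzK.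
rewrite -(leq_pmul2l (isT : 0 < 2)).
have h2 : `|(Posz S + a)%R| <= 2 * S by move: ha; move: (S) => x; lia.
by rewrite mulnCA -eS mulnA leq_mul2r h2 orbT.
Qed.

Lemma isqrt_le V x : V <= S * S -> x ^ 2 <= V < x.+1 ^ 2 -> x <= S.
Proof.
move=> hV /andP [h _]; rewrite -(@leq_exp2r _ _ 2) //.
by apply: leq_trans h _; rewrite -mulnn.
Qed.

Lemma root_step a i x1 x2 V1 V2 :
  (`|a%:~R - S%:R * cs i| <= i%:R)%R ->
  Posz (2 * V1) = ((Posz S + a) * Posz S)%R -> x1 ^ 2 <= V1 < x1.+1 ^ 2 ->
  Posz (2 * V2) = ((Posz S - a) * Posz S)%R -> x2 ^ 2 <= V2 < x2.+1 ^ 2 ->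
  ((`|x1%:R - S%:R * cs i.+1| <= i.+1%:R)%R *
   (`|x2%:R - S%:R * sn i.+1| <= (sg * i.+1 + 1)%:R)%R)%type.
Proof.
move=> ha e1 h1 e2 h2; have sp := sg0 sgN; split; last first.
  have := isqrt_sin sp ha h2 (cs_bound i) e2; rewrite -/(sn i.+1) => h; apply: le_trans h _.
  by rewrite ler_nat leq_add2r leq_mul2l leqnSn orbT.
case: i ha => [|i] ha; last first.
  have := isqrt_cos sp ha h1 (cs_bound _) (cs_ge0 i) e1; rewrite -/(cs i.+2) => h.
  by apply: le_trans h _; rewrite addn1.
(* At level 0 the cosine is -1, outside the scope of [isqrt_cos], but it is stored exactly:
   [isqrt_sin] for - cs 0 with error 0 yields the bound 1. *)
have ha' : (`|(- a)%:~R - S%:R * (- cs 0)| <= 0%:R :> algC)%R.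
  by rewrite rmorphN [cs 0]lock /= mulrN opprK -normrN opprD opprK -lock.
have cb : (-1 <= - cs 0 <= 1)%R by rewrite /= opprK lexx andbT (le_trans (lerN10 _) ler01).
have e1' : Posz (2 * V1) = ((Posz S - (- a)) * Posz S)%R by rewrite opprK.
have := isqrt_sin sp ha' h1 cb e1'.
by rewrite opprK muln0 add0n.
Qed.

Lemma spec_roots s : fparams s ->
  spec p_roots s (k * (f.+1 * 160 + 250) + 80)
    (fun s' => forall i, i <= k -> root_ok s' i).
Proof.
move=> par; have [p8 p9 p10 p11 p12 p18] := par.
have NL : N <= L by rewrite leq_pmulr.
have kw : k < 2 ^ w.
  by apply: leq_ltn_trans limw; apply: leq_trans Llim; apply: leq_trans NL; apply/ltnW/ltn_expl.
have kl : k < lim.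
  by apply: leq_trans Llim; apply: leq_trans NL; apply: ltn_expl.
have S3 := S3_w.
have SSw : 2 * (S * S) < 2 ^ w by apply: leq_ltn_trans S3; rewrite leq_mul2r orbT.
have w2 : 2 < 2 ^ w.
  by apply: leq_ltn_trans SSw; rewrite leq_pmulr // muln_gt0 S_pos.
apply: (@spec_seq _ _ _ _ _ _ _ _ 30 (k * (f.+1 * 160 + 250) + 37) _ _
  (fun s1 => arr s1 1 = upd (arr s 1) 0%R (- Posz S)%R)).
- apply: wp_spec => //; rewrite /= inidx_nat (leq_ltn_trans (leq0n _) kl) p10; split=> //.
  by rewrite sub0r.
move=> s1 [fr1 _] h1.
apply: (@spec_seq _ _ _ _ _ _ _ _ 15 (k * (f.+1 * 160 + 250) + 20) _ _
  (fun s2 => root_ok s2 0)).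
- apply: wp_spec => //; rewrite /= inidx_nat (leq_ltn_trans (leq0n _) kl); split=> //.
  rewrite /root_ok /= h1 /=; split.
  + by rewrite mulrN1 rmorphN /= opprK addNr normr0.
  + by rewrite mulr0 subr0 normr0 ler0n.
  + by rewrite lexx /=; move: (S) => x; clear; lia.
- move=> s2 [fr2 _] h2.
  apply: (@spec_for _ _ _ _ _ _ _ _ _ k (f.+1 * 160 + 240) _
    (fun j s' => forall i, i <= j -> root_ok s' i)) => //.
  + by rewrite /= fr2 // fr1.
  + by move=> i; rewrite leqn0 => /eqP ->.
  + move=> j s' hj [fr fa] hI.
    have q10 : env s' 10 = Posz S by rewrite fr // fr2 // fr1.
    have q18 : env s' 18 = Posz f by rewrite fr // fr2 // fr1.
    have [r1 r2 r3] := hI j (leqnn j).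
    set a := arr s' 1 (Posz j) in r1 r3.
    have [V1 [eV1 dV1 lV1]] := half_val r3.
    have r3' : (- Posz S <= - a <= Posz S)%R by move: r3; move: (S) (a) => x y; clear; lia.
    have [V2 [eV2 dV2 lV2]] := half_val r3'.
    have V1w : 2 * V1 < 2 ^ w by apply: leq_ltn_trans SSw; rewrite leq_mul2l.
    have V2w : 2 * V2 < 2 ^ w by apply: leq_ltn_trans SSw; rewrite leq_mul2l.
    have jl : j < lim by apply: ltn_trans kl.
    apply: (@spec_seq _ _ _ _ _ _ _ _ 40 (f.+1 * 160 + 195) _ _
      (fun t => t = setr (setr s' 24 (Posz j)) 40 (Posz V1))).
      apply: wp_spec => //; split; rewrite /= q10 -/a.
        by rewrite inidx_nat jl -eV1 !inw_nat V1w w2.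
      by rewrite dV1.
    2: by move: (f.+1) => x; clear; lia.
    move=> t1 _ ->.
    set t1' := setr _ 40 _.
    apply: (@spec_seq _ _ _ _ _ _ _ _ _ (f.+1 * 80 + 160) _ _ _
       (spec_isqrt (s := t1') (V := V1) q18 (erefl _) lV1)).
    2: by move: (f.+1) => x; clear; lia.
    move=> t2 [ft2 fa2] [x1 [e41 hx1]].
    apply: (@spec_seq _ _ _ _ _ _ _ _ 7 (f.+1 * 80 + 150) _ _
      (fun t => t = setr t2 43 (Posz x1))).
      by apply: wp_spec => //=; rewrite e41.
    2: by move: (f.+1) => x; clear; lia.
    move=> t3 _ ->.
    apply: (@spec_seq _ _ _ _ _ _ _ _ 40 (f.+1 * 80 + 105) _ _
      (fun t => t = setr (setr t2 43 (Posz x1)) 40 (Posz V2))).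
      apply: wp_spec => //; split; rewrite /= !ft2 //= q10 !fa2 //= -/a.
        by rewrite inidx_nat jl -eV2 !inw_nat V2w w2.
      by rewrite dV2.
    2: by move: (f.+1) => x; clear; lia.
    move=> t4 _ ->.
    set t4' := setr _ 40 _.
    have q18' : env t4' 18 = Posz f by rewrite /= ft2.
    apply: (@spec_seq _ _ _ _ _ _ _ _ _ 70 _ _ _
       (spec_isqrt (s := t4') (V := V2) q18' (erefl _) lV2)).
    2: by move: (f.+1) => x; clear; lia.
    move=> t5 [ft5 fa5] [x2 [f41 hx2]].
    have [s1' s2'] := root_step r1 eV1 hx1 eV2 hx2.
    have e24 : env t5 24 = Posz j by rewrite ft5 //= ft2.
    have e43 : env t5 43 = Posz x1 by rewrite ft5.
    apply: wp_spec => //; rewrite /= e24 e43 f41 -PoszD addn1 !inidx_nat (leq_ltn_trans hj kl).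
    split=> //; split=> // i; rewrite leq_eqVlt => /orP [/eqP ->|hi].
      rewrite /root_ok /= eqxx; split=> //.
      have := isqrt_le lV1 hx1; move: (S) => y; clear; lia.
    have ne : (Posz i == Posz j.+1) = false by rewrite eqz_nat ltn_eqF.
    rewrite /root_ok /= ne !fa5 //= !fa2 //=; exact: hI.
  + by rewrite /=; move: (f.+1 * 160) (k) => x y; clear; lia.
- by move: (f.+1 * 160) (k) => x y; clear; lia.
- by move: (f.+1 * 160) (k) => x y; clear; lia.
Qed.

(** One level of the table multiplies by a root known up to 2 k sg; with values of modulus 1,
    [cmul_err] adds 4 k sg + 2. *)
Definition step_tol := (4 * k + 2) * sg.

Lemma root_om s i : i < k -> root_ok s i ->
  (`|gz (arr s 1 (Posz i)) (arr s 2 (Posz i)) - S%:R * om i| <= (2 * k * sg)%:R)%R.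
Proof.
move=> hi [h1 h2 _]; have sp := sg0 sgN.
have -> : (gz (arr s 1 (Posz i)) (arr s 2 (Posz i)) - S%:R * om i =
  ((arr s 1 (Posz i))%:~R - S%:R * cs i) + 'i * ((arr s 2 (Posz i))%:~R - S%:R * sn i))%R.
  by rewrite /gz /om; ring.
apply: le_trans (ler_normD _ _) _; rewrite normrM normCi mul1r.
apply: le_trans (lerD h1 h2) _; rewrite -natrD ler_nat.
have h3 : i <= sg * i by rewrite leq_pmull.
have h4 : sg * i + sg <= k * sg by rewrite -mulnSr mulnC leq_mul2r hi orbT.
by move: h3 h4; rewrite -mulnA mul2n -addnn; move: (sg * i) (k * sg) sp => x y; clear; lia.
Qed.

Lemma k_step_tol : k * step_tol <= table_tol k sg.
Proof.
rewrite /step_tol /table_tol mulnA leq_mul2r; apply/orP; right.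
have kN : k <= N by apply/ltnW/ltn_expl.
rewrite expnS expn1; apply: (@leq_trans (k * (10 * k))).
  by rewrite leq_mul2l; move: k0; move: k; clear; lia.
by rewrite mulnCA leq_mul2l /= leq_mul.
Qed.

Lemma table_fits e : e <= table_tol k sg -> (S * 1 + 2 * k * sg) * (S * 1 + e) <= S * (S * S).
Proof.
move=> he; have dS := table_tol_S sgN.
have h1 : 2 * k * sg <= S.
  apply: leq_trans dS; apply: leq_trans k_step_tol; rewrite /step_tol mulnA leq_mul2r; apply/orP; right.
  by move: k k0; clear => x; nia.
have h2 : e <= S := leq_trans he dS.
have a1 : S * 1 + 2 * k * sg <= 2 * S by rewrite muln1 [2 * S]mul2n -addnn leq_add2l.
have a2 : S * 1 + e <= 2 * S by rewrite muln1 mul2n -addnn leq_add2l.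
apply: leq_trans (leq_mul a1 a2) _.
have S4 : 4 <= S by apply: leq_trans S_512.
have E : 2 * S * (2 * S) = 4 * (S * S) by move: (S); clear; lia.
by rewrite E leq_mul2r S4 orbT.
Qed.

Lemma spec_table s : fparams s -> (forall i, i <= k -> root_ok s i) ->
  spec p_table s (k * (N * 310 + 80) + 80) (fun s' => tabs k sg s').
Proof.
move=> par hrt; have [p8 p9 p10 p11 p12 p18] := par.
have NL : N <= L by rewrite leq_pmulr.
have Nl : N <= lim := leq_trans NL Llim.
have Nw : N < 2 ^ w := leq_ltn_trans Nl limw.
have kN : k < N by apply: ltn_expl.
have kw : k < 2 ^ w := ltn_trans kN Nw.
have kl : k < lim := leq_trans kN Nl.
have l0 : 0 < lim := leq_ltn_trans (leq0n _) kl.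
have Sp := S_pos.
have w0 : 0 < 2 ^ w by rewrite expn_gt0.
apply: (@spec_seq _ _ _ _ _ _ _ _ 20 (k * (N * 310 + 80) + 50) _ _
  (fun s1 => arr s1 3 = upd (arr s 3) 0%R (Posz S))).
- by apply: wp_spec => //; rewrite /= inidx_nat l0 p10.
move=> s1 [fr1 fa1] h1.
apply: (@spec_seq _ _ _ _ _ _ _ _ 20 (k * (N * 310 + 80) + 20) _ _
  (fun s2 => arr s2 3 = arr s1 3 /\ arr s2 4 = upd (arr s1 4) 0%R 0%R)).
- by apply: wp_spec => //; rewrite /= inidx_nat l0.
- move=> s2 [fr2 fa2] [h2 h3].
  apply: (@spec_for _ _ _ _ _ _ _ _ _ k (N * 310 + 70) _
    (fun j s' => forall r, r < 2 ^ j ->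
       (`|gz (arr s' 3 (Posz r)) (arr s' 4 (Posz r)) - S%:R * z r| <= (j * step_tol)%:R)%R)) => //.
  + by rewrite /= fr2 // fr1.
  + case=> // _; rewrite h2 h3 h1 /= zt0 /gz mulr0 addr0 mulr1.
    by rewrite -[(S%:R)%R]/((Posz S)%:~R)%R subrr normr0 ler0n.
  + move=> j s' hj [fr fa] hI.
    have q8 : env s' 8 = Posz k by rewrite fr // fr2 // fr1.
    have q10 : env s' 10 = Posz S by rewrite fr // fr2 // fr1.
    have q11 : env s' 11 = Posz (S * S) by rewrite fr // fr2 // fr1.
    have hom := root_om hj (hrt j (ltnW hj)).
    have jN : 2 ^ j * 2 <= N by rewrite mulnC -expnS leq_exp2l.
    have jN' : 2 ^ j <= N by rewrite leq_exp2l // ltnW.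
    have jl : j < lim := ltn_trans hj kl.
    have a1 : arr s' 1 = arr s 1 by rewrite fa // fa2 // fa1.
    have a2 : arr s' 2 = arr s 2 by rewrite fa // fa2 // fa1.
    set c1 := arr s 1 (Posz j) in hom; set c2 := arr s 2 (Posz j) in hom.
    apply: (@spec_seq _ _ _ _ _ _ _ _ 12 (2 ^ j * 310 + 57) _ _ (fun t =>
       t = setr (setr s' 24 (Posz j)) 32 (Posz (2 ^ j)))).
      apply: wp_spec => //; rewrite /= mul1r inw_nat (ltn_trans hj kw) //.
    2: {
      have : 2 ^ j * 310 <= N * 310 by rewrite leq_mul2r jN' orbT.
      by move: (2 ^ j * 310) (N * 310) => x y; clear; lia. }
    move=> t1 _ ->.
    apply: (@spec_seq _ _ _ _ _ _ _ _ 19 (2 ^ j * 310 + 37) _ _ (fun t =>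
       t = setr (setr (setr s' 24 (Posz j)) 32 (Posz (2 ^ j))) 33 c1)).
      apply: wp_spec => //; rewrite /= inidx_nat jl a1 //.
    2: by move: (2 ^ j * 310) => x; clear; lia.
    move=> t2 _ ->.
    apply: (@spec_seq _ _ _ _ _ _ _ _ 19 (2 ^ j * 310 + 17) _ _ (fun t =>
       t = setr (setr (setr (setr s' 24 (Posz j)) 32 (Posz (2 ^ j))) 33 c1) 34 c2)).
      apply: wp_spec => //; rewrite /= inidx_nat jl a2 //.
    2: by move: (2 ^ j * 310) => x; clear; lia.
    move=> t3 _ ->; set s3 := setr _ 34 _.
    have ej1 : j * step_tol <= table_tol k sg by apply: leq_trans k_step_tol; rewrite leq_mul2r ltnW ?orbT.
    have ejS : j * step_tol <= S := leq_trans ej1 (table_tol_S sgN).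
    apply: (@spec_for _ _ _ _ _ _ _ _ _ (2 ^ j) 300 _ (fun i t =>
       [/\ forall r, r < 2 ^ j + i ->
       (`|gz (arr t 3 (Posz r)) (arr t 4 (Posz r)) - S%:R * z r| <= (j.+1 * step_tol)%:R)%R &
       forall r, r < 2 ^ j -> arr t 3 (Posz r) = arr s' 3 (Posz r) /\
                            arr t 4 (Posz r) = arr s' 4 (Posz r)])) => //.
    * by rewrite inw_nat; apply: leq_ltn_trans Nw.
    * split=> // r; rewrite addn0 => hr; apply: le_trans (hI r hr) _.
      by rewrite ler_nat leq_mul2r leqnSn orbT.
    * move=> i t hi [ft _] [hJ1 hJ2]; apply: wp_spec => //.
      have [b3 b4] := hJ2 i hi.
      have hv := hI i hi; rewrite -b3 -b4 in hv.
      have nc : (`|om j| <= 1%:R)%R by rewrite norm_om.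
      have nv : (`|z i| <= 1%:R)%R by rewrite norm_zt.
      have er := cmul_err hom hv nc nv Sp ejS.
      have r1 := leq_trans (cmul_re_bound hom hv nc nv) (table_fits ej1).
      have r2 := leq_trans (cmul_im_bound hom hv nc nv) (table_fits ej1).
      have jiN : 2 ^ j + i < N.
        by apply: leq_trans jN; rewrite muln2 -addnn ltn_add2l.
      have jil : 2 ^ j + i < lim := leq_trans jiN Nl.
      have il : i < lim by apply: leq_ltn_trans jil; apply: leq_addl.
      have t32 : env t 32 = Posz (2 ^ j) by rewrite ft.
      have t33 : env t 33 = c1 by rewrite ft.
      have t34 : env t 34 = c2 by rewrite ft.
      apply: wp_seq; apply: (wp_asg (v := arr t 3 (Posz i))) => //.
      apply: wp_seq; apply: (wp_asg (v := arr t 4 (Posz i))) => //.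
      set u1 := setr _ 36 _.
      have t10 : env u1 10 = Posz S by rewrite /= ft.
      have t11 : env u1 11 = Posz (S * S) by rewrite /= ft.
      rewrite -t33 -t34 in r1 r2 er.
      have [k1 v1] := @fdiv_ok w O inp base lim ($33 * $35 - $34 * $36)%P u1 S t10 t11 Sp Sw isT r1.
      have ei : eval ($32 + $23)%P u1 = Posz (2 ^ j + i) by rewrite /= t32 PoszD.
      apply: wp_seq; apply: (wp_st _ k1 ei jil v1) => //.
      set u2 := seta u1 _ _ _.
      have [k2 v2] := @fdiv_ok w O inp base lim ($33 * $36 + $34 * $35)%P u2 S t10 t11 Sp Sw isT r2.
      have ei2 : eval ($32 + $23)%P u2 = Posz (2 ^ j + i) by exact: ei.
      apply: (wp_st _ k2 ei2 jil v2) => //.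
      split=> r.
        rewrite addnS ltnS leq_eqVlt => /orP [/eqP ->|hr]; last first.
          by rewrite /= !eqz_nat (ltn_eqF hr); apply: hJ1.
        rewrite /= !eqxx (zt_add hj hi) (mulrC (z i)).
        apply: le_trans er _; rewrite ler_nat (mulSnr j) mul1n -addnA leq_add2l.
        rewrite /step_tol addn1 muln2 -addnn mulnDl; apply: leq_add.
          by rewrite -mulnDl leq_mul2r; apply/orP; right; move: (k); clear; lia.
        by rewrite -[X in X <= _]muln1 leq_mul2l /= (sg0 sgN).
      move=> hr; have hr2 : r < 2 ^ j + i by apply: leq_trans hr _; apply: leq_addr.
      by rewrite /= !eqz_nat (ltn_eqF hr2); apply: hJ2.
    * move=> t _ [hJ1 _] r hr; apply: hJ1; by rewrite addnn -mul2n -expnS.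
    * by rewrite /=; move: (2 ^ j) => x; clear; lia.
  + move=> s' _ hI r hr; apply: le_trans (hI r hr) _; by rewrite ler_nat k_step_tol.
  + by rewrite /=; move: (N * 310) (k) => x y; clear; lia.
- by move: (k * (N * 310 + 80)) => x; clear; lia.
- by move: (k * (N * 310 + 80)) => x; clear; lia.
Qed.

End Tables.

(** * One round *)

Lemma nat_boolw (b : bool) X : 1 < X -> b < X.
Proof. by case: b => // h; apply: ltnW. Qed.

Section Simple.

Variables (w : nat) (O : oracle) (inp : nat -> nat) (base lim : nat).

Notation spec := (spec w O inp base lim).

(** The exponent has either reached its goal or grown at every iteration; V iterations are enough
    because V < 2 ^ V. *)
Lemma spec_log s V : env s 30 = Posz V -> 0 < V -> 2 * V < 2 ^ w ->
  spec p_log s (V * 50 + 30)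
    (fun s' => env s' 31 = Posz (up_log 2 V)).
Proof.
move=> e30 V0 Vw2.
suff : spec p_log s (V * 50 + 30)
    (fun s' => exists e, [/\ env s' 31 = Posz e, V <= 2 ^ e & 2 ^ e < 2 * V]).
  case=> h1 h2 [e [h3 h4 h5]]; split=> //; rewrite h3; congr Posz; apply/eqP.
  rewrite eqn_leq up_log_min // andbT -ltnS -(ltn_exp2l _ _ (isT : 1 < 2)).
  by apply: leq_trans h5 _; rewrite expnS leq_mul2l up_logP.
have Vw : V < 2 ^ w by apply: leq_ltn_trans Vw2; rewrite leq_pmull.
have w1 : 1 < 2 ^ w by apply: leq_ltn_trans Vw2; rewrite muln_gt0.
apply: (@spec_seq _ _ _ _ _ _ _ _ 5 (V * 50 + 20) _ _ (fun s1 => s1 = setr s 31 0%R)).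
- exact: wp_spec.
- move=> s1 _ ->.
  apply: (@spec_for _ _ _ _ _ _ _ _ _ V 40 _ (fun b s' => exists e,
    [/\ env s' 31 = Posz e, 2 ^ e < 2 * V & (V <= 2 ^ e) || (e == b)])) => //.
  + by exists 0; split; [by []|exact: (@leq_mul 2 1 2 V (leqnn 2) V0)|by rewrite orbT].
  + move=> b s' hb [fr _] [e [e31 h1 h2]]; apply: wp_spec => //.
    have q30 : env s' 30 = Posz V by rewrite fr.
    have ew : 2 ^ e < 2 ^ w by apply: ltn_trans h1 Vw2.
    have ew' : e < 2 ^ w by apply: ltn_trans ew; apply: ltn_expl.
    rewrite /= q30 e31 mul1r !inw_nat ew' ew Vw; split; first by rewrite nat_boolw.
    rewrite ltz_nat; split=> h.
      have lt : 2 ^ e < V by move: h; case: (_ < V).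
      have eb : e = b by move: h2; rewrite leqNgt lt /= => /eqP.
      split=> //; exists e.+1; split.
      + by rewrite /= -[e.+1]addn1 PoszD.
      + by rewrite expnS ltn_mul2l.
      + by rewrite eb eqxx orbT.
    exists e; split=> //; rewrite leqNgt; move: h; by case: (_ < V).
  + move=> s' _ [e [e31 h1 h2]]; exists e; split=> //.
    by case/orP: h2 => // /eqP ->; apply/ltnW/ltn_expl.
  + by rewrite /=; clear; lia.
- by clear; lia.
Qed.

Definition maxdeg (n : nat) : nat := \max_(i < n) o_degT O (inp i).

Lemma spec_maxdeg s n Dm : env s 0 = Posz n -> n < 2 ^ w -> n <= base -> 1 < 2 ^ w ->
  (forall i, i < n -> inp i < 2 ^ w) -> (forall i, i < n -> o_degT O (inp i) <= Dm) ->
  Dm < 2 ^ w ->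
  spec p_maxdeg s (n * 60 + 30) (fun s' => env s' 4 = Posz (maxdeg n)).
Proof.
move=> e0 nw nb w1 hinp hdeg Dw.
have maxw i : i <= n -> maxdeg i < 2 ^ w.
  move=> hi; apply: leq_ltn_trans Dw; apply/bigmax_leqP => j _.
  by apply: hdeg; apply: leq_trans (ltn_ord j) hi.
apply: (@spec_seq _ _ _ _ _ _ _ _ 5 (n * 60 + 20) _ _ (fun s1 => s1 = setr s 4 0%R)).
- exact: wp_spec.
- move=> s1 _ ->.
  apply: (@spec_for _ _ _ _ _ _ _ _ _ n 50 _ (fun i s' => env s' 4 = Posz (maxdeg i))) => //.
  + by rewrite /maxdeg big_ord0.
  + move=> i s' hi [fr _] e4; apply: wp_spec => //.
    have ib : i < base := leq_trans hi nb.
    rewrite /= ltz_nat ib !inw_nat hinp //=; split=> //.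
    have d1w := leq_ltn_trans (hdeg i hi) Dw; have Dw' := maxw i (ltnW hi).
    have eS : maxdeg i.+1 = maxn (maxdeg i) (o_degT O (inp i)).
      by rewrite /maxdeg big_ord_recr.
    rewrite e4 !inw_nat d1w Dw' nat_boolw // ltz_nat eS; split=> //; split=> h.
      by split=> //; rewrite (maxn_idPr _) //; move: h; case: ltnP => // /ltnW.
    by rewrite (maxn_idPl _) //; move: h; case: ltnP.
  + by rewrite /=; clear; lia.
- by clear; lia.
Qed.

Lemma maxdeg_ge n i : i < n -> o_degT O (inp i) <= maxdeg n.
Proof. by move=> hi; exact: (leq_bigmax (Ordinal hi)). Qed.

End Simple.

Section Round.

Variables (w : nat) (O : oracle) (inp : nat -> nat) (lim n m : nat).
Notation base := (n + m).

Notation sem := (sem O inp).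
Notation eval := (eval O inp).
Notation eok := (eok w O inp base lim).
Notation spec := (spec w O inp base lim).
Notation inw := (inw w).

Variables (k sg f l W u D : nat).
Notation N := (2 ^ k).
Notation S := (sg ^ 2).
Notation B := (2 ^ l).
Notation M := (n * B %/ 2 ^ k.-1 + 2).
Notation L := (2 ^ k * M).
Notation z := (zt k).
Notation fparams := (fparams k M sg f).

Hypotheses (k0 : 0 < k) (sgN : sg_big k sg) (Sw : S_fits w sg) (Llim : L <= lim)
  (limw : lim < 2 ^ w).
Hypotheses (mn : 0 < m <= n) (mBN : m * B <= 2 ^ k.-1) (lW : l <= W) (Wuw : W + u < w)
  (hinp : forall i, i < base -> inp i < 2 ^ u) (hnbr : forall a q, o_nbr O a q < 2 ^ u)
  (hdeg : forall i, i < n -> o_degT O (inp i) <= D) (Dw : D < 2 ^ w).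

Record rparams (rep : nat) (s : ist) : Prop := RParams {
  rf : fparams s;
  r0 : env s 0 = Posz n; r1 : env s 1 = Posz m;
  r7 : env s 7 = Posz B; r13 : env s 13 = Posz (2 ^ W);
  r14 : env s 14 = Posz (2 ^ (W - l)); r20 : env s 20 = Posz rep }.

Lemma rparams_frame rep ws aws s s' :
  frame ws aws s s' -> all (fun x => x \notin ws) [:: 8; 9; 10; 11; 12; 18; 0; 1; 7; 13; 14; 20] ->
  rparams rep s -> rparams rep s'.
Proof.
move=> fr hall [p q0 q1 q7 q13 q14 q20].
have h : forall x, x \in [:: 8; 9; 10; 11; 12; 18; 0; 1; 7; 13; 14; 20] -> env s' x = env s x.
  by move=> x hx; apply: (proj1 fr); apply: (allP hall).
split; rewrite ?h //.
by case: p => *; split; rewrite h.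
Qed.

Variable rho : nat.

(** * Incompatible pairs as a blockwise cyclic convolution *)

Definition hsh (x : nat) : nat := mshash W l rho x.

Definition marked (i h : nat) : bool :=
  has (fun q => hsh (o_nbr O (inp i) q) == h) (iota 0 (o_degT O (inp i))).

Definition mism (i : nat) : bool :=
  has (fun j => ~~ marked (i + j) (hsh (inp (n + j)))) (iota 0 m).

(* Cell i 2 ^ l + h of the expanded text is 1 when no neighbour of T_i has
   hash value h.  The transform works on blocks of length N: block 0 contains
   the reversed pattern, the others the text, with consecutive blocks
   overlapping in N / 2 cells, so that cyclic convolution inside a block gives
   the true correlation at the shifts in its upper half. *)
Definition text (x : nat) : bool := ~~ ((x < n * B) && marked (x %/ B) (x %% B)).

Definition tidx (p : nat) : nat := (p - N) %/ N * 2 ^ k.-1 + (p - N) %% N.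

Definition ppos (j : nat) : nat := (N - (j * B + hsh (inp (n + j)))) %% N.

Definition inA (p : nat) : bool :=
  if p < N then has (fun j => p == ppos j) (iota 0 m) else text (tidx p).

Lemma hsh_lt x : hsh x < B.
Proof. exact: mshash_lt. Qed.

Lemma N_half : N = 2 * 2 ^ k.-1.
Proof. by rewrite -expnS prednK. Qed.

Lemma tpos_lt j : j < m -> j * B + hsh (inp (n + j)) < 2 ^ k.-1.
Proof.
move=> hj; apply: leq_trans mBN; apply: (@leq_trans (j.+1 * B)); last by rewrite leq_mul2r hj orbT.
by rewrite mulSnr ltn_add2l hsh_lt.
Qed.

Definition Af (p : nat) : algC := ((inA p)%:R)%R.

Definition cnt (p : nat) : nat :=
  \sum_(v < N) (inA (p %/ N * N + (p %% N + N - v) %% N) && inA v).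

Lemma Af_le q : (`|Af q| <= 1)%R.
Proof. by rewrite /Af; case: inA; rewrite ?normr1 ?normr0 ?ler01. Qed.

Lemma conv_cnt p : N <= p -> conv k Af p = ((cnt p)%:R)%R.
Proof.
move=> hp; rewrite /conv ltnNge hp /= /cconv /cnt natr_sum; apply: eq_bigr => v _.
by rewrite /Af -natrM mulnb.
Qed.

Lemma conv_le q : (`|conv k Af q| <= N%:R)%R.
Proof.
have N0 : 0 < N by rewrite expn_gt0.
case: (ltnP q N) => h.
  rewrite /conv h; apply: le_trans (Af_le q) _; by rewrite ler1n.
rewrite conv_cnt // normr_nat ler_nat /cnt -[X in _ <= X]card_ord -sum1_card.
by apply: leq_sum => v _; case: (_ && _).
Qed.

(** The shift i 2 ^ l is read in the text block that starts at the last multiple of N / 2 not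
    exceeding it, so its offset there is below N / 2. *)
Definition cpos (i : nat) : nat :=
  ((i * B) %/ 2 ^ k.-1).+1 * N + (i * B) %% 2 ^ k.-1.

Lemma cpos_ge i : N <= cpos i.
Proof. by rewrite /cpos mulSn -addnA leq_addr. Qed.

Lemma cpos_lt i : i < n -> cpos i < L.
Proof.
move=> hi; rewrite /cpos.
have h0 : 0 < 2 ^ k.-1 by rewrite expn_gt0.
have h1 : (i * B) %% 2 ^ k.-1 < N.
  by apply: leq_trans (ltn_pmod _ h0) _; rewrite N_half leq_pmull.
have h2 : (i * B) %/ 2 ^ k.-1 <= n * B %/ 2 ^ k.-1.
  by apply: leq_div2r; rewrite leq_mul2r ltnW ?orbT.
apply: (@leq_trans (((i * B) %/ 2 ^ k.-1).+2 * N)).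
  by rewrite [X in _ < X]mulSn addnC ltn_add2r.
by rewrite mulnC leq_mul2l addn2 !ltnS h2 orbT.
Qed.

(** The offset of the shift and [t] are both below N / 2: their sum does not wrap around the
    block. *)
Lemma inA_shift i t : i + 0 < n -> t < 2 ^ k.-1 ->
  inA (cpos i %/ N * N + (cpos i %% N + t) %% N) = text (i * B + t).
Proof.
move=> hi ht.
have h0 : 0 < 2 ^ k.-1 by rewrite expn_gt0.
have N0 : 0 < N by rewrite expn_gt0.
have h1 : (i * B) %% 2 ^ k.-1 < N.
  by apply: leq_trans (ltn_pmod _ h0) _; rewrite N_half leq_pmull.
have e1 : cpos i %/ N = ((i * B) %/ 2 ^ k.-1).+1.
  by rewrite /cpos divnMDl // (divn_small h1) addn0.
have e2 : cpos i %% N = (i * B) %% 2 ^ k.-1.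
  by rewrite /cpos modnMDl modn_small.
have h3 : (i * B) %% 2 ^ k.-1 + t < N.
  by rewrite N_half mul2n -addnn; have := ltn_pmod (i * B) h0; move: ht; move: (2 ^ k.-1) ((i * B) %% _) => a b; clear; lia.
rewrite e1 e2 (modn_small h3) /inA ifF; last first.
  by apply/negbTE; rewrite -leqNgt mulSn -addnA leq_addr.
congr text; rewrite /tidx mulSn -addnA addKn.
rewrite divnMDl // (divn_small h3) addn0 modnMDl (modn_small h3) addnA.
by rewrite -divn_eq.
Qed.

Lemma text_at i j : i + j < n -> text ((i + j) * B + hsh (inp (n + j))) =
  ~~ marked (i + j) (hsh (inp (n + j))).
Proof.
move=> hij; rewrite /text; have hb := hsh_lt (inp (n + j)).
rewrite divnMDl ?expn_gt0 // (divn_small hb) addn0 modnMDl (modn_small hb).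
rewrite (_ : _ < _ = true) //.
apply: (@leq_trans ((i + j).+1 * B)); last by rewrite leq_mul2r hij orbT.
by rewrite mulSnr ltn_add2l.
Qed.

(** A nonzero term of the sum is a pattern cell [ppos j] facing a 1 of the text, and this j exhibits
    the incompatible pair; conversely such a j gives the term. *)
Lemma cnt_mism i : i < n - m + 1 -> (0 < cnt (cpos i)) = mism i.
Proof.
move=> hi; case/andP: mn => m0 mn'.
have iN : i < n by move: hi m0 mn'; clear; lia.
have N0 : 0 < N by rewrite expn_gt0.
have hN : 2 ^ k.-1 <= N by rewrite N_half leq_pmull.
have ijn j : j < m -> i + j < n by move: hi mn'; clear; lia.
have i0 : i + 0 < n by rewrite addn0.
have pp j : j < m -> (ppos j < N) * (forall o, (o + N - ppos j) %% N = (o + (j * B + hsh (inp (n + j)))) %% N).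
  move=> hj; rewrite /ppos; set t := _ + _.
  have tN : t < N by apply: leq_trans (tpos_lt hj) hN.
  split=> [|o]; first by rewrite ltn_pmod.
  case: (posnP t) => [->|t0].
    by rewrite subn0 modnn subn0 modnDr addn0.
  rewrite (modn_small (_ : N - t < N)); last by rewrite ltn_subrL t0.
  by congr (_ %% _); rewrite -addnBA ?leq_subr // subKn // ltnW.
apply/idP/idP.
  rewrite lt0n sum_nat_eq0 negb_forall => /existsP [v]; rewrite /= eqb0 negbK => /andP [hv].
  rewrite {1}/inA ltn_ord => /hasP [j]; rewrite mem_iota add0n => /= hj /eqP ev.
  rewrite ev (pp j hj).2 in hv; rewrite inA_shift ?tpos_lt // addnA -mulnDl in hv.
  apply/hasP; exists j; first by rewrite mem_iota.
  by rewrite -text_at // ijn.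
case/hasP => j; rewrite mem_iota add0n => /= hj hm.
have [pj1 pj2] := pp j hj.
rewrite lt0n sum_nat_eq0 negb_forall; apply/existsP; exists (Ordinal pj1) => /=.
rewrite eqb0 negbK pj2 inA_shift ?tpos_lt // addnA -mulnDl text_at ?ijn // hm /=.
by rewrite /inA pj1; apply/hasP; exists j; rewrite ?mem_iota.
Qed.

(** * Execution of a round *)

Lemma W_w : 2 ^ W < 2 ^ w.
Proof. by rewrite ltn_exp2l // (leq_ltn_trans _ Wuw) // leq_addr. Qed.

(** [ibin_ok] asks that the product be a genuine word before its remainder is taken; W + u < w
    guarantees this. *)
Lemma ehash_ok rep e s x : rparams rep s -> env s 15 = Posz (rho %% 2 ^ W) ->
  eok e s -> eval e s = Posz x -> x < 2 ^ u ->
  eok (ehash e) s /\ eval (ehash e) s = Posz (hsh x).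
Proof.
move=> [_ _ _ _ q13 q14 _] q15 k1 ex hx.
have rW : rho %% 2 ^ W < 2 ^ W by rewrite ltn_pmod // expn_gt0.
have h1 : rho %% 2 ^ W * x < 2 ^ w.
  apply: (@leq_trans (2 ^ (W + u))); last by rewrite leq_exp2l // ltnW.
  by rewrite expnD ltn_mul.
have h2 : 2 ^ (W - l) < 2 ^ w by apply: leq_ltn_trans W_w; rewrite leq_exp2l // leq_subr.
have h3 : (rho %% 2 ^ W * x) %% 2 ^ W < 2 ^ w.
  by apply: ltn_trans W_w; rewrite ltn_pmod // expn_gt0.
rewrite /= k1 ex q15 q13 q14 -PoszM !modz_posz !divz_posz !inw_nat h1 W_w h2 h3.
by [].
Qed.

Lemma nB_lim : n * B <= lim.
Proof.
apply: leq_trans Llim; rewrite N_half -mulnA.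
have h0 : 0 < 2 ^ k.-1 by rewrite expn_gt0.
apply: (@leq_trans (2 ^ k.-1 * (n * B %/ 2 ^ k.-1 + 2))); last by rewrite leq_pmull.
by apply: ltnW; rewrite (mulnC (2 ^ k.-1)); apply: leq_trans (ltn_ceil _ h0) _; rewrite leq_mul2r addn2 leqnSn orbT.
Qed.

Lemma B_pos : 0 < B. Proof. by rewrite expn_gt0. Qed.

Lemma n_lim : n <= lim.
Proof. by apply: leq_trans nB_lim; rewrite leq_pmulr // B_pos. Qed.

Lemma nw : n < 2 ^ w. Proof. exact: leq_ltn_trans n_lim limw. Qed.

Lemma in_w i : i < base -> inp i < 2 ^ w.
Proof.
move=> hi; apply: leq_trans (hinp hi) _; rewrite leq_exp2l //.
by apply/ltnW; apply: leq_ltn_trans Wuw; apply: leq_addl.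
Qed.

(** Older stamps are thus distinct from the stamp [rep.+1] of the current round. *)
Definition mk_ok (rep : nat) (s : ist) : Prop := forall x : nat, (0 <= arr s 5 (Posz x) <= Posz rep)%R.

Lemma block_eq (i h x : nat) : h < B -> (Posz x == Posz (i * B + h)) = (x %/ B == i) && (x %% B == h).
Proof.
move=> hh; rewrite eqz_nat; apply/eqP/andP => [->|[/eqP <- /eqP <-]]; last exact: divn_eq.
by rewrite divnMDl ?B_pos // (divn_small hh) addn0 modnMDl (modn_small hh) !eqxx.
Qed.

Lemma spec_mark rep s : rparams rep s -> env s 15 = Posz (rho %% 2 ^ W) -> mk_ok rep s ->
  spec p_mark s (n * (D * 90 + 50) + 20) (fun s' => mk_ok rep.+1 s' /\
    forall x : nat, (arr s' 5 (Posz x) == Posz rep.+1) = (x < n * B) && marked (x %/ B) (x %% B)).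
Proof.
move=> par e15 hmk; have [_ q0 _ _ _ _ _] := par.
case/andP: mn => m0 mn'.
apply: (@spec_for _ _ _ _ _ _ _ _ _ n (D * 90 + 40) _ (fun i s' => mk_ok rep.+1 s' /\
   forall x : nat, (arr s' 5 (Posz x) == Posz rep.+1) = (x < i * B) && marked (x %/ B) (x %% B))) => //.
- exact: nw.
- split=> x; have /andP [h1 h2] := hmk x.
    by rewrite h1 (le_trans h2) ?lez_nat.
  by rewrite mul0n /=; move: h2; case: eqP => // ->; rewrite lez_nat ltnn.
- move=> i s' hi fr [hI1 hI2].
  have par' : rparams rep (setr s' 21 (Posz i)).
    by apply: (@rparams_frame _ [:: 21; 30; 25] [:: 5] s _ _ isT par); case: fr => f1 f2; split=> // x hx /=;
       move: (hx); rewrite inE negb_or => /andP [/negbTE -> h]; apply: f1; apply: contra hx.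
  have ib : i < base by apply: leq_trans hi _; apply: leq_addr.
  have ibz : (Posz i < Posz n + Posz m)%R by rewrite -PoszD.
  apply: (@spec_seq _ _ _ _ _ _ _ _ 9 (D * 90 + 20) _ _ (fun t =>
       t = setr (setr s' 21 (Posz i)) 30 (Posz (inp i)))).
  + by apply: wp_spec => //; rewrite /= ltz_nat ib.
  2: by move: (D * 90) => x; clear; lia.
  move=> t1 _ ->; set t := setr _ 30 _.
  have dD := hdeg hi.
  set dg := o_degT O (inp i) in dD.
  (* Rows below [i] are complete, and row [i] has received its first [q] neighbours. *)
  apply: (@spec_for _ _ _ _ _ _ _ _ _ dg 80 _ (fun q s'' => mk_ok rep.+1 s'' /\
     forall x : nat, (arr s'' 5 (Posz x) == Posz rep.+1) = ((x < i * B) && marked (x %/ B) (x %% B)) ||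
       ((x %/ B == i) && has (fun q' => hsh (o_nbr O (inp i) q') == x %% B) (iota 0 q)))) => //.
  + by rewrite /= inw_nat in_w.
  + by rewrite inw_nat; apply: leq_ltn_trans Dw.
  + by split=> // x; rewrite andbF orbF /=; exact: hI2.
  + move=> q s'' hq fr' [hJ1 hJ2]; apply: wp_spec => //.
    have [f1 _] := fr'.
    set t2 := setr s'' 25 (Posz q).
    have par2 : rparams rep t2.
      have par1 : rparams rep t by case: par' => [[? ? ? ? ? ?] ? ? ? ? ? ?]; do ?split.
      by apply: (@rparams_frame _ [:: 25] [:: 5] t _ _ isT par1); case: fr' => g1 g2; split=> // x hx /=;
       move: (hx); rewrite inE => /negbTE ->; apply: g1.
    have t15 : env t2 15 = Posz (rho %% 2 ^ W).
      by rewrite /= f1 //= (proj1 fr).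
    have t30 : env t2 30 = Posz (inp i) by rewrite /= f1.
    have t21 : env t2 21 = Posz i by rewrite /= f1.
    have [_ _ _ t7 _ _ t20] := par2.
    have qw : q < 2 ^ w by apply: leq_trans (ltnW Dw); apply: leq_trans dD.
    have ok1 : eok (ENbr $30 $25)%P t2.
      by rewrite /= f1 //= !inw_nat in_w // qw.
    have ev1 : eval (ENbr $30 $25)%P t2 = Posz (o_nbr O (inp i) q) by rewrite /= f1.
    have [k1 v1] := ehash_ok par2 t15 ok1 ev1 (hnbr _ _).
    have hb := hsh_lt (o_nbr O (inp i) q).
    have idx : eval ($21 * $7 + ehash (ENbr $30 $25))%P t2 = Posz (i * B + hsh (o_nbr O (inp i) q)).
      have -> : eval ($21 * $7 + ehash (ENbr $30 $25))%P t2 =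
        (env t2 21 * env t2 7 + eval (ehash (ENbr $30 $25)%P) t2)%R by [].
      by rewrite v1 t21 t7 -PoszM -PoszD.
    have ilim : i * B + hsh (o_nbr O (inp i) q) < lim.
      apply: leq_trans nB_lim; apply: (@leq_trans (i.+1 * B)); last by rewrite leq_mul2r hi orbT.
      by rewrite mulSnr ltn_add2l.
    apply: (wp_st (v := Posz rep.+1) _ _ idx ilim).
    * exact: (introT and3P (And3 isT k1 isT)).
    * by [].
    * by rewrite -[eval _ _]/(env t2 20 + 1)%R t20 -PoszD addn1.
    split=> x; rewrite [arr _ 5 _]/=; first by case: eqP => // _; rewrite lexx.
    have hq1 : has (fun q' => hsh (o_nbr O (inp i) q') == x %% B) (iota 0 q.+1) =
      has (fun q' => hsh (o_nbr O (inp i) q') == x %% B) (iota 0 q) || (x %% B == hsh (o_nbr O (inp i) q)).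
      by rewrite -[q.+1]addn1 iotaD has_cat /= orbF add0n [in X in _ || X]eq_sym.
    rewrite hq1 block_eq //.
    rewrite andb_orr [in RHS]orbA.
    by case: (_ && (x %% B == _)); rewrite ?eqxx ?orbT ?orbF ?hJ2.
  + move=> s'' _ [hJ1 hJ2]; split=> x; [exact: hJ1|rewrite hJ2].
    rewrite -[X in X && _](ltn_divLR _ _ B_pos) -[in RHS](ltn_divLR _ _ B_pos) ltnS [in RHS]leq_eqVlt.
    case: (altP (x %/ B =P i)) => [->|_] /=; last by rewrite orbF.
    by rewrite ltnn.
  + rewrite /=; apply: (@leq_trans (D * 87 + 20)); last by rewrite leq_add2r leq_mul2l orbT.
    by rewrite -addnA leq_add // leq_mul2r dD orbT.
- rewrite /=; clear; move: (D * 90) => x; lia.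
Qed.

Lemma L_w' : L < 2 ^ w.
Proof. exact: leq_ltn_trans Llim limw. Qed.

Lemma N_lt_w : N < 2 ^ w.
Proof. by apply: leq_ltn_trans L_w'; rewrite leq_pmulr // addn2. Qed.

Lemma half_lt : 2 ^ k.-1 < N.
Proof. by rewrite ltn_exp2l // ltn_predL. Qed.

Lemma w_gt2 : 2 < 2 ^ w.
Proof.
apply: leq_ltn_trans N_lt_w.
by apply: leq_trans half_lt; rewrite ltnS expn_gt0.
Qed.

Lemma tidx_le p : tidx p <= p.
Proof.
rewrite /tidx; apply: leq_trans (leq_subr N p).
rewrite [X in _ <= X](divn_eq (p - N) N) leq_add2r leq_mul2l; apply/orP; right; exact/ltnW/half_lt.
Qed.

Lemma half_div : N %/ 2 = 2 ^ k.-1.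
Proof. by rewrite N_half mulKn. Qed.

Lemma spec_load rep s : rparams rep s -> rep.+1 < 2 ^ w -> mk_ok rep.+1 s ->
  (forall x : nat, (arr s 5 (Posz x) == Posz rep.+1) = (x < n * B) && marked (x %/ B) (x %% B)) ->
  spec p_load s (L * 200 + 20) (fun s' => forall p, p < L ->
    arr s' 6 (Posz p) = Posz (S * ((N <= p) && text (tidx p))) /\ arr s' 7 (Posz p) = 0%R).
Proof.
move=> par rw hmk hm; have [[p8 p9 p10 p11 p12 p18] q0 q1 q7 q13 q14 q20] := par.
have w2 := w_gt2; have w1 : 1 < 2 ^ w := ltnW w2.
apply: (@spec_for _ _ _ _ _ _ _ _ _ L 190 _ (fun i s' => forall p, p < i ->
    arr s' 6 (Posz p) = Posz (S * ((N <= p) && text (tidx p))) /\ arr s' 7 (Posz p) = 0%R)) => //.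
- exact: L_w'.
- move=> i s' hi [fr fa] hI; apply: wp_spec => //.
  have il : i < lim := leq_trans hi Llim.
  have iw : i < 2 ^ w := ltn_trans il limw.
  have a5 : arr s' 5 = arr s 5 by apply: fa.
  have old v6 v7 : v6 = Posz (S * ((N <= i) && text (tidx i))) -> v7 = 0%R -> forall p, p < i.+1 ->
    (if Posz p == Posz i then v6 else arr s' 6 (Posz p)) = Posz (S * ((N <= p) && text (tidx p))) /\
    (if Posz p == Posz i then v7 else arr s' 7 (Posz p)) = 0%R.
    move=> -> -> p; rewrite ltnS leq_eqVlt eqz_nat => /orP [/eqP ->|hp]; first by rewrite eqxx.
    by rewrite (ltn_eqF hp); apply: hI.
  rewrite /= !fr //= p9 q20 p10 !inidx_nat il !inw_nat iw N_lt_w nat_boolw // ltz_nat.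
  split=> //; split=> //; split=> hc.
    have iN : i < N by move: hc; case: (i < N).
    by split=> //; apply: old => //; rewrite leqNgt iN muln0.
  have iN : N <= i by rewrite leqNgt; move: hc; case: (i < N).
  have ez : (Posz i - Posz N)%R = Posz (i - N) by rewrite subzn.
  have dw : i - N < 2 ^ w by apply: leq_ltn_trans iw; apply: leq_subr.
  have ti : (Posz ((i - N) %/ N) * Posz (2 ^ k.-1) + Posz ((i - N) %% N))%R = Posz (tidx i).
    by rewrite -PoszM -PoszD.
  have til : tidx i < lim by apply: leq_ltn_trans il; apply: tidx_le.
  rewrite ez !divz_posz !modz_posz !inw_nat dw w2 half_div ti !inidx_nat til a5 -PoszD addn1.
  split; first by [].
  have ain : inw (arr s 5 (Posz (tidx i))).
    have /andP [h1 h2] := hmk (tidx i).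
    by rewrite /inw h1 /=; apply: le_lt_trans h2 _; rewrite ltz_nat.
  rewrite ain rw nat_boolw // hm; split; first by [].
  split; first by split.
  have textE : text (tidx i) = ~~ ((tidx i < n * B) && marked (tidx i %/ B) (tidx i %% B)) by [].
  move: textE; case: (_ && marked _ _) => textE; split=> // _; (split=> //; apply: old => //).
    by rewrite textE andbF muln0.
  by rewrite textE iN muln1.
- by rewrite /=; move: L => x; clear; lia.
Qed.

(** The cells are exactly 0 or S, whence the error 0, and level 0 of the decimation is the vector
    itself. *)
Lemma spec_pattern rep s : rparams rep s -> env s 15 = Posz (rho %% 2 ^ W) ->
  (forall p, p < L ->
    arr s 6 (Posz p) = Posz (S * ((N <= p) && text (tidx p))) /\ arr s 7 (Posz p) = 0%R) ->
  spec p_pattern s (m * 150 + 20) (fun s' => ap k M sg 0 s' 6 7 (dft z k 0 Af)).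
Proof.
move=> par e15 hld; have [[p8 p9 p10 p11 p12 p18] q0 q1 q7 q13 q14 q20] := par.
case/andP: mn => m0 mn'.
have N0 : 0 < N by rewrite expn_gt0.
have NL : N <= L by rewrite leq_pmulr // addn2.
apply: (@spec_for _ _ _ _ _ _ _ _ _ m 140 _ (fun j s' => forall p, p < L ->
    arr s' 6 (Posz p) = Posz (S * (if p < N then has (fun j => p == ppos j) (iota 0 j) else text (tidx p))))) => //.
- by rewrite inw_nat; apply: leq_ltn_trans nw.
- by move=> p hp; have [-> _] := hld p hp; rewrite ltnNge; case: (N <= p).
- move=> j s' hj [fr fa] hI; apply: wp_spec => //.
  set t2 := setr s' 22 (Posz j).
  have par2 : rparams rep t2.
    by apply: (@rparams_frame _ [:: 22] [:: 6] s _ _ isT par); split=> // x hx /=;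
       move: (hx); rewrite inE => /negbTE ->; apply: fr.
  have t15 : env t2 15 = Posz (rho %% 2 ^ W) by rewrite /= fr.
  have jb : n + j < base by rewrite ltn_add2l.
  have ok1 : eok (EInp ($0 + $22))%P t2 by rewrite /= fr //= q0 -PoszD ltz_nat jb.
  have ev1 : eval (EInp ($0 + $22))%P t2 = Posz (inp (n + j)) by rewrite /= fr //= q0 -PoszD.
  have [k1 v1] := ehash_ok par2 t15 ok1 ev1 (hinp jb).
  have tp := tpos_lt hj; set tt := j * B + _ in tp.
  have tN : tt <= N by apply: leq_trans (ltnW tp) (ltnW half_lt).
  have [[_ t9 t10 _ _ _] _ _ t7 _ _ _] := par2.
  have e0 : eval ($9 - ($22 * $7 + ehash (EInp ($0 + $22))))%P t2 = Posz (N - tt).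
    have -> : eval ($9 - ($22 * $7 + ehash (EInp ($0 + $22))))%P t2 =
      (env t2 9 - (env t2 22 * env t2 7 + eval (ehash (EInp ($0 + $22)%P)) t2))%R by [].
    by rewrite v1 t9 t7 -PoszM -PoszD subzn.
  have idx : eval (($9 - ($22 * $7 + ehash (EInp ($0 + $22)))) %% $9)%P t2 = Posz (ppos j).
    have -> : eval (($9 - ($22 * $7 + ehash (EInp ($0 + $22)))) %% $9)%P t2 =
      (eval ($9 - ($22 * $7 + ehash (EInp ($0 + $22))))%P t2 %% env t2 9)%Z by [].
    by rewrite e0 t9 modz_posz.
  have ppN : ppos j < N by rewrite ltn_pmod.
  have ilim : ppos j < lim := leq_trans ppN (leq_trans NL Llim).
  have Ntw : N - tt < 2 ^ w by apply: leq_ltn_trans (leq_subr _ _) N_lt_w.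
  apply: (wp_st (v := Posz S) _ _ idx ilim).
  + have h : ibin_ok w BMod (eval ($9 - ($22 * $7 + ehash (EInp ($0 + $22))))%P t2) (env t2 9).
      by rewrite e0 t9 /= !inw_nat Ntw N_lt_w.
    exact: (introT and3P (And3 (introT and3P (And3 isT (introT and3P (And3 isT k1 isT)) isT)) isT h)).
  + by [].
  + by rewrite -t10.
  move=> p hp; rewrite [arr _ 6 _]/= eqz_nat.
  have hq1 : has (fun j => p == ppos j) (iota 0 j.+1) = has (fun j => p == ppos j) (iota 0 j) || (p == ppos j).
    by rewrite -[j.+1]addn1 iotaD has_cat /= orbF add0n.
  rewrite hq1; case: (altP (p =P ppos j)) => [->|ne].
    by rewrite ppN orbT muln1.
  by rewrite orbF; apply: hI.
- move=> s' [fr fa] hI p hp /=.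
  have [_ h7] := hld p hp.
  rewrite hI // fa // h7 /gz mulr0 addr0 /dft.
  rewrite expn0 big_ord1 mul0n addn0 expr0 mulr1 subn0 -divn_eq /Af /inA.
  by rewrite -pmulrn natrM subrr normr0.
- by rewrite /=; clear; lia.
Qed.

Lemma cnt_le p : cnt p <= N.
Proof.
rewrite /cnt -[X in _ <= X]card_ord -sum1_card.
by apply: leq_sum => v _; case: (_ && _).
Qed.

Lemma dft0 A p : dft z k 0 A p = A p.
Proof.
by rewrite /dft expn0 big_ord1 mul0n addn0 expr0 mulr1 subn0 -divn_eq.
Qed.

Lemma corr_int s i : i < n ->
  ap k M sg (inv_tol k sg) s 6 7 (fun p => N%:R * dft z k 0 (conv k Af) p)%R ->
  `|(arr s 6 (Posz (cpos i)) - Posz (S * N * cnt (cpos i)))%R| <= inv_tol k sg.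
Proof.
move=> hi hap; have h := hap _ (cpos_lt hi).
rewrite dft0 conv_cnt ?cpos_ge // in h.
apply: (absz_le_gz (y := arr s 7 (Posz (cpos i)))).
apply: le_trans h; rewrite le_eqVlt; apply/orP; left; apply/eqP; congr (`|_|)%R.
by rewrite /gz intrD rmorphN /= -pmulrn !natrM; ring.
Qed.

(** The linear arithmetic of the final test, freed from powers: 2 v is at most 2 e <= X / 2 when the
    count is 0, and at least 2 X - 2 e >= 3 X / 2 otherwise. *)
Lemma threshold (v : int) (X Y Z e c xc S2 : nat) :
  `|(v - Posz xc)%R| <= e -> 2 * e <= S2 -> 0 < S2 -> 2 * S2 <= X ->
  (c = 0 -> xc = 0) -> (0 < c -> X <= xc) -> xc <= Z -> S2 <= Z -> X <= Z -> 4 * Z <= Y ->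
  [/\ (0 <= 2 * v + Posz Z)%R, (2 * v + Posz Z < Posz Y)%R, X + Z < Y &
    (Posz X + Posz Z < 2 * v + Posz Z)%R = (0 < c)].
Proof.
move=> h1 h2 S0 h3 h4 h5 h6 h7 h8 h9; split; try lia.
Qed.

Lemma spec_check rep s : rparams rep s ->
  ap k M sg (inv_tol k sg) s 6 7 (fun p => N%:R * dft z k 0 (conv k Af) p)%R ->
  (forall i : nat, (0 <= arr s 10 (Posz i) <= 1)%R) ->
  spec p_check s (n * 170 + 40) (fun s' =>
    (forall i : nat, (0 <= arr s' 10 (Posz i) <= 1)%R) /\
    forall i, i < n - m + 1 ->
      (arr s' 10 (Posz i) != 0%R) = (arr s 10 (Posz i) != 0%R) || mism i).
Proof.
move=> par hap hbad; have [[p8 p9 p10 p11 p12 p18] q0 q1 q7 q13 q14 q20] := par.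
case/andP: mn => m0 mn'.
have nmn : n - m + 1 <= n by move: m0 mn'; clear; lia.
have ez : (Posz n - Posz m + 1)%R = Posz (n - m + 1) by rewrite subzn // -PoszD.
have w2 := w_gt2; have w1 : 1 < 2 ^ w := ltnW w2.
apply: (@spec_for _ _ _ _ _ _ _ _ _ (n - m + 1) 150 _ (fun i s' =>
    (forall i : nat, (0 <= arr s' 10 (Posz i) <= 1)%R) /\
    forall i' : nat, (i' < n - m + 1) -> (arr s' 10 (Posz i') != 0%R) =
       (arr s 10 (Posz i') != 0%R) || ((i' < i) && mism i'))) => //.
- by rewrite inw_nat; apply: leq_ltn_trans nw.
- by rewrite /= q0 q1 ez.
- by split=> // i' hi'; rewrite orbF.
- move=> i s' hi [fr fa] [hI1 hI2]; apply: wp_spec => //.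
  have hin : i < n := leq_trans hi nmn.
  have [p9' p10' p11'] : [/\ env s' 9 = Posz N, env s' 10 = Posz S & env s' 11 = Posz (S * S)].
    by rewrite !fr.
  have q7' : env s' 7 = Posz B by rewrite fr.
  have a6 : arr s' 6 = arr s 6 by apply: fa.
  have iBw : i * B < 2 ^ w.
    by apply: leq_ltn_trans limw; apply: leq_trans nB_lim; rewrite leq_mul2r ltnW ?orbT.
  have il : i < lim := leq_trans hin n_lim.
  have hw : 2 ^ k.-1 < 2 ^ w := ltn_trans half_lt N_lt_w.
  have cl : cpos i < lim := leq_trans (cpos_lt hin) Llim.
  have ci := corr_int hin hap.
  have S0 := S_pos sgN.
  have sgS : sg <= S by rewrite -[X in X <= _]expn1 leq_pexp2l // (sg0 sgN).
  have N2S : N * N <= S * S.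
    apply: leq_mul; apply: leq_trans sgS; apply: leq_trans (N_big sgN (isT : 1 <= 7));
      by rewrite expn1 leq_pmull.
  have NS : N <= S * S.
    by apply: leq_trans N2S; rewrite leq_pmull // expn_gt0.
  have t4 : S * N * cnt (cpos i) <= S * (S * S).
    rewrite -mulnA leq_mul2l; apply/orP; right; apply: leq_trans N2S.
    by rewrite leq_mul2l cnt_le orbT.
  have h2S : 2 * S <= S * N.
    by rewrite mulnC leq_mul2l N_half leq_pmulr ?orbT // expn_gt0.
  have t1 : cnt (cpos i) = 0 -> S * N * cnt (cpos i) = 0 by move->; rewrite muln0.
  have t2 : 0 < cnt (cpos i) -> S * N <= S * N * cnt (cpos i) by move=> h; rewrite leq_pmulr.
  have t3 : S <= S * (S * S) by rewrite leq_pmulr // muln_gt0 S0.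
  have t5 : S * N <= S * (S * S) by rewrite leq_mul2l NS orbT.
  have [v1 v2 v3 v4] := threshold ci (inv_tol_S sgN) S0 h2S t1 t2 t4 t3 t5 Sw.
  apply: wp_seq; apply: (wp_asg (v := Posz (i * B))) => //.
  + by rewrite /= q7'.
  apply: wp_seq; apply: (wp_asg (v := Posz (2 ^ k.-1))).
  + by rewrite /= p9' !inw_nat N_lt_w w2.
  + by rewrite /= p9' divz_posz half_div.
  apply: wp_seq; apply: (wp_asg (v := Posz (cpos i))).
  + by rewrite /= !inw_nat iBw hw.
  + rewrite /= p9' divz_posz modz_posz -PoszD -PoszM -PoszD addn1.
    by [].
  rewrite /= p9' p10' p11' a6 !inidx_nat cl il -!PoszM (mulnC N S).
  have i1 : inw (Posz (S * N) + Posz (S * (S * S)))%R by rewrite -PoszD inw_nat.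
  have i2 : inw (2 * arr s 6 (Posz (cpos i)) + Posz (S * (S * S)))%R by rewrite /inw v1 v2.
  rewrite i1 i2 v4 cnt_mism // inw_nat nat_boolw //.
  split=> //; split=> hm.
    have mi : mism i by move: hm; case: mism.
    split=> //; split=> [j|j hj] /=; rewrite eqz_nat; case: (altP (j =P i)) => [e|ne] //=.
      by rewrite e ltnS leqnn mi orbT.
    by rewrite hI2 // ltnS [(j <= i)%N]leq_eqVlt (negbTE ne).
  have mi : mism i = false by move: hm; case: mism.
  split=> // j hj; rewrite hI2 // ltnS [(j <= i)%N]leq_eqVlt; case: (altP (j =P i)) => [->|ne] //=.
  by rewrite mi ?andbF.
- move=> s' _ [hI1 hI2]; split=> // i hi; by rewrite /= hI2 // hi.
- rewrite /=; apply: (@leq_trans (n * 157 + 40)); last by rewrite leq_add2r leq_mul2l orbT.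
  by rewrite -addnA leq_add // leq_mul2r nmn orbT.
Qed.

Lemma M_pos : 0 < M.
Proof. by rewrite addn2. Qed.

Definition round_cost : nat :=
  n * (D * 90 + 50) + L * 600 + m * 150 + k * (L * 1580 + 160) + n * 170 + 300.

Definition bad_ok (s : ist) : Prop := forall i : nat, (0 <= arr s 10 (Posz i) <= 1)%R.

Lemma round_tape s : itape (sem p_round s) = behead (itape s).
Proof.
exact: (@sem_tape O inp p_corr _ isT).
Qed.

Lemma spec_round rep s : rparams rep s -> tabs k sg s -> mk_ok rep s -> bad_ok s ->
  rep.+1 < 2 ^ w -> head 0 (itape s) = rho -> rho < 2 ^ w ->
  spec p_round s round_cost (fun s' => [/\ mk_ok rep.+1 s', bad_ok s',
    itape s' = behead (itape s) &
    forall i, i < n - m + 1 ->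
      (arr s' 10 (Posz i) != 0%R) = (arr s 10 (Posz i) != 0%R) || mism i]).
Proof.
move=> par ht hmk hbad rw hrho rhow.
have Mp := M_pos.
pose T3 := k * (L * 890 + 80) + 13 + (n * 170 + 40) + 1.
pose T2 := L * 400 + 30 + T3 + 1.
pose T1 := k * (L * 690 + 80) + 13 + T2 + 1.
pose T0 := m * 150 + 20 + T1 + 1.
pose Tl := L * 200 + 20 + T0 + 1.
pose Tm := n * (D * 90 + 50) + 20 + Tl + 1.
suff H : spec p_round s (1 + (20 + Tm + 1) + 1) (fun s' => [/\ mk_ok rep.+1 s', bad_ok s' &
    forall i, i < n - m + 1 ->
      (arr s' 10 (Posz i) != 0%R) = (arr s 10 (Posz i) != 0%R) || mism i]).
  case: H => h1 h2 [h3 h4 h5]; split=> //.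
    apply: leq_trans h2 _; rewrite /round_cost /Tm /Tl /T0 /T1 /T2 /T3.
    rewrite !(mulnDr k) !(mulnA k L).
    move: (n * (D * 90 + 50)) (k * L) (L) => x y v; clear; lia.
  by split=> //; exact: round_tape.
have w1 : 1 < 2 ^ w := ltnW w_gt2.
apply: (@spec_seq _ _ _ _ _ _ _ _ 1 (20 + Tm + 1) _ _
  (fun t => arr t = arr s /\ env t = upd (env s) 15 (Posz rho))) => //.
  by split=> //=; rewrite hrho.
move=> s1 _ [a1 v1].
have par1 : rparams rep s1.
  by apply: (@rparams_frame _ [:: 15] [::] s _ _ isT par); split=> x hx; [rewrite v1 /upd; move: hx; rewrite inE => /negbTE ->|rewrite a1].
apply: (@spec_seq _ _ _ _ _ _ _ _ 20 Tm _ _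
  (fun t => arr t = arr s /\ rparams rep t /\ env t 15 = Posz (rho %% 2 ^ W))) => //.
  have q15 : env s1 15 = Posz rho by rewrite v1.
  apply: wp_spec => //; rewrite /= q15 (r13 par1) modz_posz !inw_nat rhow W_w.
  split=> //; split=> //=; split=> //.
  apply: (@rparams_frame _ [:: 15] [::] s1 _ _ isT par1); split=> // x /=.
  by rewrite inE => /negbTE ->.
move=> s2 _ [a2 [par2 v15]].
have hmk2 : mk_ok rep s2 by move=> x; rewrite a2.
apply: (spec_seq (T2 := Tl) (spec_mark par2 v15 hmk2)) => // s3 fr3 [hmk3 hm3].
have par3 : rparams rep s3 := rparams_frame fr3 isT par2.
have v15' : env s3 15 = Posz (rho %% 2 ^ W) by rewrite (proj1 fr3).
apply: (spec_seq (T2 := T0) (spec_load par3 rw hmk3 hm3)) => // s4 fr4 h4.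
have par4 : rparams rep s4 := rparams_frame fr4 isT par3.
have v15'' : env s4 15 = Posz (rho %% 2 ^ W) by rewrite (proj1 fr4).
apply: (spec_seq (T2 := T1) (spec_pattern par4 v15'' h4)) => // s5 fr5 h5.
have par5 : rparams rep s5 := rparams_frame fr5 isT par4.
have ht5 : tabs k sg s5.
  by move=> r hr; rewrite !(proj2 fr5) // !(proj2 fr4) // !(proj2 fr3) // a2; apply: ht.
apply: (spec_seq (T2 := T2) (spec_fwd O inp base k0 Mp sgN Sw Llim limw (rf par5) ht5 Af_le h5)) => // s6 fr6 h6.
have par6 : rparams rep s6 := rparams_frame fr6 isT par5.
apply: (spec_seq (T2 := T3) (spec_mult O inp base Mp sgN Sw Llim limw (rf par6) Af_le h6)) => // s7 fr7 h7.
have par7 : rparams rep s7 := rparams_frame fr7 isT par6.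
have ht7 : tabs k sg s7.
  by move=> r hr; rewrite !(proj2 fr7) // !(proj2 fr6) //; apply: ht5.
apply: (spec_seq (T2 := (n * 170 + 40)) (spec_inv O inp base k0 Mp sgN Sw Llim limw (rf par7) ht7 conv_le h7)) => // s8 fr8 h8.
have par8 : rparams rep s8 := rparams_frame fr8 isT par7.
have a10 : arr s8 10 = arr s 10.
  by rewrite (proj2 fr8) // (proj2 fr7) // (proj2 fr6) // (proj2 fr5) // (proj2 fr4) // (proj2 fr3) // a2.
have a5 : arr s8 5 = arr s3 5.
  by rewrite (proj2 fr8) // (proj2 fr7) // (proj2 fr6) // (proj2 fr5) // (proj2 fr4).
have hbad8 : forall i : nat, (0 <= arr s8 10 (Posz i) <= 1)%R by move=> i; rewrite a10.
apply: (spec_weaken (spec_check par8 h8 hbad8)) => // s9 fr9 [h9 h10].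
split=> //.
  by move=> x; rewrite (proj2 fr9) // a5.
by move=> i hi; rewrite h10 // a10.
Qed.

End Round.

(** * Parameters *)

Definition lgn (n : nat) : nat := up_log 2 n.+1.
Definition lgb (D : nat) : nat := up_log 2 (4 * D + 1).
(** Half a block must hold the whole expanded pattern, of m 2 ^ l cells. *)
Definition lgk (m D : nat) : nat := up_log 2 (2 * m * 2 ^ lgb D).

Section Sizes.

Variables (n m D : nat).
Hypotheses (m0 : 0 < m) (mn : m <= n) (Dm : D < m).

Notation lam := (lgn n).
Notation l := (lgb D).
Notation k := (lgk m D).

Lemma up_log_lt2 V : 0 < V -> 2 ^ up_log 2 V < 2 * V.
Proof.
case: V => // [[|V]] _; first by rewrite up_log1.
have := @up_log_gtn 2 V.+2 isT isT; rewrite -(ltn_pmul2l (isT : 0 < 2)) -expnS prednK //.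
by rewrite up_log_gt0.
Qed.

Lemma n_lam : n < 2 ^ lam. Proof. exact: up_logP. Qed.

Lemma lam_pos : 0 < lam.
Proof. by rewrite up_log_gt0 /= ltnS (leq_trans m0 mn). Qed.

Lemma D_B : 4 * D + 1 <= 2 ^ l. Proof. exact: up_logP. Qed.

Lemma B_D : 2 ^ l < 2 * (4 * D + 1). Proof. by apply: up_log_lt2; rewrite addn1. Qed.

Lemma l_lam : l <= lam + 2.
Proof.
apply: up_log_min => //; rewrite expnD.
by have := n_lam; move: mn Dm; move: (2 ^ lam) => x; lia.
Qed.

Lemma mB_N : 2 * m * 2 ^ l <= 2 ^ k. Proof. exact: up_logP. Qed.

Lemma mB_pos : 0 < 2 * m * 2 ^ l. Proof. by rewrite !muln_gt0 m0 expn_gt0. Qed.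

Lemma N_mB : 2 ^ k < 2 * (2 * m * 2 ^ l).
Proof. exact: up_log_lt2 mB_pos. Qed.

Lemma k_pos : 0 < k.
Proof.
rewrite up_log_gt0 /= -mulnA; have : 0 < m * 2 ^ l by rewrite muln_gt0 m0 expn_gt0.
by move: (m * 2 ^ l) => x; lia.
Qed.

Lemma k_lam : k <= 2 * lam + 3.
Proof.
apply: up_log_min => //.
have h : 2 * m * 2 ^ l <= 2 * 2 ^ lam * 2 ^ (lam + 2).
  apply: leq_mul; first by rewrite leq_mul2l /= (leq_trans mn) // ltnW // n_lam.
  by rewrite leq_exp2l // l_lam.
apply: leq_trans h _; rewrite -expnS -expnD leq_exp2l //; lia.
Qed.

Lemma mB_half : m * 2 ^ l <= 2 ^ k.-1.
Proof.
have := mB_N; rewrite -{1}(prednK k_pos) expnS -mulnA leq_mul2l //.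
Qed.

Definition Lsz : nat := 2 ^ k * (n * 2 ^ l %/ 2 ^ k.-1 + 2).

Lemma Lsz_le : Lsz <= 2 * (n * 2 ^ l) + 2 * 2 ^ k.
Proof.
rewrite /Lsz mulnDr (mulnC (2 ^ k) 2) leq_add2r -{1}(prednK k_pos) expnS -mulnA leq_mul2l /=.
by rewrite mulnC leq_divM.
Qed.

Lemma Lsz_lam : Lsz <= 2 ^ (2 * lam + 5).
Proof.
apply: leq_trans Lsz_le _.
have h1 : n * 2 ^ l <= 2 ^ (2 * lam + 3).
  apply: (@leq_trans (2 ^ lam * 2 ^ (lam + 2))).
    by apply: leq_mul; [exact/ltnW/n_lam|rewrite leq_exp2l // l_lam].
  by rewrite -expnD leq_exp2l //; lia.
have h2 : 2 ^ k <= 2 ^ (2 * lam + 3) by rewrite leq_exp2l // k_lam.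
rewrite (_ : 2 * lam + 5 = (2 * lam + 3).+2); last by lia.
by rewrite !expnS; move: (2 ^ k) (2 ^ (2 * lam + 3)) (n * 2 ^ l) h1 h2 => a b c; clear; lia.
Qed.

(** By [k_lam] the exponent of 512 N ^ 7 is at most 9 + 7 (2 lgn n + 3), which is below 60 lgn n. *)
Lemma sg_big_lam : sg_big k (2 ^ (60 * lam)).
Proof.
rewrite /sg_big -expnM; apply: (@leq_trans (2 ^ 9 * 2 ^ (k * 7))); first by [].
rewrite -expnD leq_exp2l //; have := k_lam; have := lam_pos; lia.
Qed.

Variables (w : nat).
Hypothesis hw : 500 * lam <= w.

(** 4 S ^ 3 has exponent 360 lgn n + 2, within the 500 lgn n bits of a word. *)
Lemma S_fits_lam : S_fits w (2 ^ (60 * lam)).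
Proof.
rewrite /S_fits -!expnM -!expnD (_ : 4 = 2 ^ 2) // -expnD leq_exp2l //.
by have := lam_pos; move: hw; lia.
Qed.

End Sizes.

Definition has_below (P : pred nat) (j : nat) : bool := has P (iota 0 j).

Lemma has_belowS P j : has_below P j.+1 = has_below P j || P j.
Proof. by rewrite /has_below -[j.+1]addn1 iotaD has_cat /= orbF add0n. Qed.

Section Main.

Variables (w : nat) (O : oracle) (inp : nat -> nat) (n m lim : nat).
Notation base := (n + m).

Notation sem := (sem O inp).
Notation spec := (spec w O inp base lim).
Notation inw := (inw w).
Notation lam := (lgn n).

Variables (cW : nat).
Hypotheses (m0 : 0 < m) (mn : m <= n) (cW3 : 3 <= cW) (hw : (2 * cW + 500) * lam <= w).

Notation "'M' D" := (n * 2 ^ lgb D %/ 2 ^ (lgk m D).-1 + 2) (at level 10, D at level 8).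

Lemma hw500 : 500 * lam <= w.
Proof. by apply: leq_trans hw; rewrite leq_mul2r leq_addl orbT. Qed.

Section Setup.

Variable D : nat.
Hypothesis Dm : D < m.

Notation l := (lgb D).
Notation k := (lgk m D).

Lemma setup_bounds :
  [/\ 2 * n.+1 < 2 ^ w, 2 * (4 * D + 1) < 2 ^ w, 2 * (2 * m * 2 ^ l) < 2 ^ w
     & 2 ^ k < 2 ^ w] /\
  [/\ n * 2 ^ l < 2 ^ w, cW * lam < 2 ^ w, 2 < 2 ^ w & l <= cW * lam] /\
  [/\ lam < 2 ^ w, l < 2 ^ w, k < 2 ^ w & 120 * lam < 2 ^ w].
Proof.
have lp := lam_pos m0 mn; have nl := n_lam n.
have h500 := hw500.
have w500 : 500 <= w by apply: leq_trans h500; rewrite leq_pmulr.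
have ww : w < 2 ^ w by apply: ltn_expl.
have P j : j < w -> 2 ^ j < 2 ^ w by move=> h; rewrite ltn_exp2l.
have ll := l_lam m0 mn Dm; have kl := k_lam m0 mn Dm.
have lw : lam <= w by apply: leq_trans h500; rewrite leq_pmull.
have lw5 : 5 * lam + 10 < w by move: lp h500; clear; lia.
have q1 : 2 * n.+1 <= 2 ^ (lam + 1) by rewrite addn1 expnS leq_mul2l nl.
have q3 : 2 ^ k < 2 ^ w by apply: P; move: kl lw5; clear; lia.
have q4 : 2 * m * 2 ^ l <= 2 ^ (2 * lam + 3).
  apply: (@leq_trans (2 * 2 ^ lam * 2 ^ (lam + 2))).
    by apply: leq_mul; [rewrite leq_mul2l /= (leq_trans mn) // ltnW|rewrite leq_exp2l].
  by rewrite -expnS -expnD leq_exp2l //; clear; lia.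
have q4' : 2 * (2 * m * 2 ^ l) < 2 ^ w.
  apply: (@leq_ltn_trans (2 ^ (2 * lam + 4))).
    have E : 2 * lam + 4 = (2 * lam + 3).+1 by rewrite addnS.
    by rewrite E [X in _ <= X]expnS leq_mul2l q4.
  by apply: P; move: lw5; clear; lia.
split; [split=> //|split; split=> //].
- by apply: leq_ltn_trans q1 _; apply: P; move: lw5; clear; lia.
- apply: (@leq_ltn_trans (8 * 2 ^ lam)).
    by move: nl mn Dm; move: (2 ^ lam) => x; clear; lia.
  by rewrite (_ : 8 = 2 ^ 3) // -expnD; apply: P; move: lw5; clear; lia.
- apply: (@leq_ltn_trans (2 ^ lam * 2 ^ (lam + 2))).
    by apply: leq_mul; [exact: ltnW|rewrite leq_exp2l].
  by rewrite -expnD; apply: P; move: lw5; clear; lia.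
- apply: leq_ltn_trans ww; apply: leq_trans hw; rewrite leq_mul2r; apply/orP; right; move: cW; clear; lia.
- by apply: leq_ltn_trans ww; apply: leq_trans w500.
- by apply: leq_trans ll _; move: lp cW3; move: lam cW; clear; nia.
- by apply: leq_ltn_trans ww.
- by apply: leq_ltn_trans ww; move: ll lw5; clear; lia.
- by apply: leq_ltn_trans ww; move: kl lw5; clear; lia.
- by apply: leq_ltn_trans ww; move: h500; clear; lia.
Qed.

Lemma spec_setup s : env s 0 = Posz n -> env s 1 = Posz m -> env s 4 = Posz D ->
  spec (p_setup cW) s (n * 50 + D * 200 + m * 2 ^ l * 100 + 800) (fun t =>
    [/\ fparams k (M D) (2 ^ (60 * lam)) (120 * lam) t, env t 5 = Posz lam,
        env t 7 = Posz (2 ^ l), env t 13 = Posz (2 ^ (cW * lam)) &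
        env t 14 = Posz (2 ^ (cW * lam - l))]).
Proof.
move=> e0 e1 e4.
have [[b1 b2 b3 b4] [[b5 b6 b7 b8] [b9 b10 b11 b12]]] := setup_bounds.
have lp := lam_pos m0 mn.
have b3' : 2 * m * 2 ^ l < 2 ^ w by apply: leq_ltn_trans b3; rewrite leq_pmull.
have wexp j : 2 ^ j < 2 ^ w -> j < w by rewrite ltn_exp2l.
have Bw : 2 ^ l < 2 ^ w.
  by apply: leq_ltn_trans b5; rewrite leq_pmull // (leq_trans m0 mn).
pose A := n * 50 + D * 200; pose E := m * 2 ^ l * 100.
have eA : (n.+1 * 50 + 30) + ((4 * D + 1) * 50 + 30) + ((2 * m * 2 ^ l) * 50 + 30) = A + E + 190.
  have e : 2 * m * 2 ^ l * 50 = m * 2 ^ l * 100.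
    by rewrite -(mulnA 2); move: (m * 2 ^ l) => x; clear; lia.
  by rewrite e /A /E; move: (m * 2 ^ l * 100) => x; clear; lia.
pose T1 := n.+1 * 50 + 30; pose T2 := (4 * D + 1) * 50 + 30; pose T3 := 2 * m * 2 ^ l * 50 + 30.
rewrite -/T1 -/T2 -/T3 in eA.
suff H : spec (p_setup cW) s (20 + (T1 + (20 + (20 + (T2 + (20 + (20 + (20 + (T3 + (20 + 400 + 1)
   + 1) + 1) + 1) + 1) + 1) + 1) + 1) + 1) + 1)
  (fun t => [/\ fparams k (M D) (2 ^ (60 * lam)) (120 * lam) t, env t 5 = Posz lam,
        env t 7 = Posz (2 ^ l), env t 13 = Posz (2 ^ (cW * lam)) &
        env t 14 = Posz (2 ^ (cW * lam - l))]).
  case: H => h1 h2 h3; split=> //; apply: leq_trans h2 _; rewrite -/A -/E.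
  by move: eA; move: T1 T2 T3 A E => a1 a2 a3 a4 a5; clear; lia.
apply: (spec_seq (R := fun t => env t 30 = Posz n.+1) _ _ (leqnn _)).
  by apply: wp_spec => //; rewrite /= e0 -PoszD addn1.
move=> s1 [f1 _] h1.
apply: (spec_seq (spec_log _ _ _ _ h1 (ltn0Sn n) b1) _ (leqnn _)) => s2 [f2 _] h2.
apply: (spec_seq (R := fun t => env t 5 = Posz lam) _ _ (leqnn _)).
  by apply: wp_spec => //; rewrite /= h2.
move=> s3 [f3 _] h3.
apply: (spec_seq (R := fun t => env t 30 = Posz (4 * D + 1)) _ _ (leqnn _)).
  by apply: wp_spec => //; rewrite /= f3 // f2 // f1 // e4 -PoszM -PoszD.
move=> s4 [f4 _] h4.
have V2 : 0 < 4 * D + 1 by rewrite addn1.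
apply: (spec_seq (spec_log _ _ _ _ h4 V2 b2) _ (leqnn _)) => s5 [f5 _] h5.
apply: (spec_seq (R := fun t => env t 6 = Posz l) _ _ (leqnn _)).
  by apply: wp_spec => //; rewrite /= h5.
move=> s6 [f6 _] h6.
apply: (spec_seq (R := fun t => env t 7 = Posz (2 ^ l)) _ _ (leqnn _)).
  by apply: wp_spec => //; rewrite /= h6 inw_nat b10 mul1r.
move=> s7 [f7 _] h7.
apply: (spec_seq (R := fun t => env t 30 = Posz (2 * m * 2 ^ l)) _ _ (leqnn _)).
  by apply: wp_spec => //; rewrite /= h7 f7 // f6 // f5 // f4 // f3 // f2 // f1 // e1 -!PoszM.
move=> s8 [f8 _] h8.
have V3 := mB_pos D m0.
apply: (spec_seq (spec_log _ _ _ _ h8 V3 b3) _ (leqnn _)) => s9 [f9 _] h9.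
apply: (spec_seq (R := fun t => env t 8 = Posz k) _ _ (leqnn _)).
  by apply: wp_spec => //; rewrite /= h9.
move=> s10 [f10 _] h10.
have g0 : env s10 0 = Posz n by rewrite f10 // f9 // f8 // f7 // f6 // f5 // f4 // f3 // f2 // f1.
have g5 : env s10 5 = Posz lam by rewrite f10 // f9 // f8 // f7 // f6 // f5 // f4.
have g6 : env s10 6 = Posz l by rewrite f10 // f9 // f8 // f7.
have g7 : env s10 7 = Posz (2 ^ l) by rewrite f10 // f9 // f8.
have w2 : 2 < 2 ^ w := b7.
have ehalf : (2 ^ k) %/ 2 = 2 ^ (k.-1).
  by rewrite -{1}(prednK (k_pos m0 mn Dm)) expnS mulKn.
have hfw : 2 ^ k.-1 < 2 ^ w by apply: leq_ltn_trans b4; rewrite leq_exp2l // leq_pred.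
have sfw : 2 ^ (120 * lam) < 2 ^ w.
  rewrite ltn_exp2l //; apply: leq_trans hw500; rewrite ltn_mul2r lp //.
have clw : 2 ^ (cW * lam) < 2 ^ w.
  rewrite ltn_exp2l //; apply: leq_trans hw; rewrite ltn_mul2r lp /=; move: cW; clear; lia.
have mulE : (2 ^ (60 * lam)) ^ 2 = 2 ^ (120 * lam) by rewrite -expnM mulnAC.
apply: (spec_seq (R := fun t => env t 9 = Posz (2 ^ k)) (T1 := 20) (T2 := 370) _ _ _) => //.
  by apply: wp_spec => //; rewrite /= h10 inw_nat b11 mul1r.
move=> t1 [u1 _] v1.
apply: (spec_seq (R := fun t => env t 18 = Posz (120 * lam)) (T1 := 20) (T2 := 340) _ _ _) => //.
  by apply: wp_spec => //; rewrite /= u1 // g5 -PoszM.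
move=> t2 [u2 _] v2.
apply: (spec_seq (R := fun t => env t 10 = Posz (2 ^ (120 * lam))) (T1 := 20) (T2 := 310) _ _ _) => //.
  by apply: wp_spec => //; rewrite /= v2 inw_nat b12 mul1r.
move=> t3 [u3 _] v3.
apply: (spec_seq (R := fun t => env t 11 = Posz (2 ^ (120 * lam) * 2 ^ (120 * lam))) (T1 := 20) (T2 := 280) _ _ _) => //.
  by apply: wp_spec => //; rewrite /= v3 -PoszM.
move=> t4 [u4 _] v4.
apply: (spec_seq (R := fun t => env t 12 = Posz (2 ^ k * M D)) (T1 := 60) (T2 := 200) _ _ _) => //.
  apply: wp_spec => //; rewrite /= u4 // u3 // u2 // v1 u4 // u3 // u2 // u1 // g0 u4 // u3 // u2 // u1 // g7.
  rewrite -!PoszM divz_posz ehalf !divz_posz !inw_nat b4 b5 w2 hfw.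
  by split=> //; rewrite -PoszD -PoszM.
move=> t5 [u5 _] v5.
have z5 : env t5 5 = Posz lam by rewrite u5 // u4 // u3 // u2 // u1.
have z6 : env t5 6 = Posz l by rewrite u5 // u4 // u3 // u2 // u1.
apply: (spec_seq (R := fun t => env t 13 = Posz (2 ^ (cW * lam))) (T1 := 50) (T2 := 100) _ _ _) => //.
  by apply: wp_spec => //; rewrite /= z5 -PoszM inw_nat b6 mul1r.
move=> t6 [u6 _] v6.
have sz : (Posz cW * Posz lam - Posz l)%R = Posz (cW * lam - l) by rewrite -PoszM subzn.
have clw' : cW * lam - l < 2 ^ w by apply: leq_ltn_trans b6; apply: leq_subr.
apply: wp_spec => //; rewrite /= u6 // u6 // z5 z6 sz inw_nat clw'.
split=> //; split=> //=; try (rewrite u6 //; fail).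
- split=> /=; rewrite ?mulE u6 // ?u5 // ?u4 // ?u3 // ?u2 // ?u1 //.
- by rewrite u6 // u5 // u4 // u3 // u2 // u1.
- by rewrite mul1r.
Qed.

End Setup.

Lemma spec_naive s : env s 0 = Posz n -> env s 1 = Posz m -> n <= lim -> base < 2 ^ w ->
  1 < 2 ^ w ->
  (forall i, i < base -> inp i < 2 ^ w) -> bad_ok s ->
  spec p_naive s (n * (m * 60 + 40) + 40) (fun s' => bad_ok s' /\
    forall i, i < n - m + 1 -> (arr s' 10 (Posz i) != 0%R) =
      (arr s 10 (Posz i) != 0%R) || has_below (fun j => ~~ o_match O (inp (i + j)) (inp (n + j))) m).
Proof.
move=> e0 e1 nlim bw w1 hinp hbad.
have nmn : n - m + 1 <= n by move: m0 mn; clear; lia.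
have ez : (Posz n - Posz m + 1)%R = Posz (n - m + 1) by rewrite subzn // -PoszD.
have nw : n < 2 ^ w by apply: leq_ltn_trans bw; apply: leq_addr.
pose mis i j := ~~ o_match O (inp (i + j)) (inp (n + j)).
apply: (@spec_for _ _ _ _ _ _ _ _ _ (n - m + 1) (m * 60 + 20) _ (fun i s' => bad_ok s' /\
    forall i' : nat, (i' < n - m + 1) -> (arr s' 10 (Posz i') != 0%R) =
       (arr s 10 (Posz i') != 0%R) || ((i' < i) && has_below (mis i') m))) => //.
- by rewrite inw_nat; apply: leq_ltn_trans nw.
- by rewrite /= e0 e1 ez.
- by split=> // i' hi'; rewrite orbF.
- move=> i s' hi [fr fa] [hI1 hI2].
  have hin : i < n := leq_trans hi nmn.
  apply: (@spec_for _ _ _ _ _ _ _ _ _ m 50 _ (fun j t => bad_ok t /\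
    forall i' : nat, (i' < n - m + 1) -> (arr t 10 (Posz i') != 0%R) =
       (arr s' 10 (Posz i') != 0%R) || ((i' == i) && has_below (mis i') j))) => //.
  + by rewrite inw_nat; apply: leq_ltn_trans nw.
  + by rewrite /= fr.
  + by split=> // i' hi'; rewrite andbF orbF.
  + move=> j t hj [ft ta] [hJ1 hJ2]; apply: wp_spec => //.
    have t0 : env t 0 = Posz n by rewrite ft //= fr.
    have t21 : env t 21 = Posz i by rewrite ft.
    have jb : n + j < base by rewrite ltn_add2l.
    have ib : i + j < base by rewrite (leq_trans _ (_ : n + j <= _)) ?ltn_add2r // ltnW.
    rewrite /= t0 t21 -!PoszD !ltz_nat jb ib /= !inw_nat !hinp // nat_boolw // inidx_nat (leq_trans hin nlim).
    split=> //; split=> hc.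
      have mi : mis i j = false by rewrite /mis; move: hc; case: (o_match _ _ _).
      split=> // i' hi'; rewrite hJ2 // has_belowS; case: (altP (i' =P i)) => [->|ne] //=.
      by rewrite mi orbF.
    have mi : mis i j by rewrite /mis; move: hc; case: (o_match _ _ _).
    split=> //; split=> [i'|i' hi'] /=; rewrite eqz_nat; case: (altP (i' =P i)) => [e|ne] //=.
      by rewrite e has_belowS mi !orbT.
    by rewrite hJ2 // (negbTE ne) !orbF.
  + move=> t _ [hJ1 hJ2]; split=> // i' hi'; rewrite /= hJ2 // hI2 // ltnS [(i' <= i)%N]leq_eqVlt.
    by case: (altP (i' =P i)) => [->|ne] //=; rewrite ?ltnn ?orbF.
  + by rewrite /=; move: m; clear; lia.
- move=> s' _ [hI1 hI2]; split=> // i hi; by rewrite /= hI2 // hi.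
- rewrite /=; apply: (@leq_trans (n * (m * 60 + 27) + 40)); last by rewrite leq_add2r leq_mul2l leq_add2l orbT.
  by rewrite -addnA leq_add // -addnA leq_mul2r nmn orbT.
Qed.

Variables (U cR : nat).
Hypotheses (Ubase : cW * lam + U < w) (hlim : 2 ^ (2 * lam + 5) <= lim) (limw : lim < 2 ^ w)
  (basew : base < 2 ^ w) (hinp : forall i, i < base -> inp i < 2 ^ U)
  (hnbr : forall a q, o_nbr O a q < 2 ^ U) (Rw : cR * lam < 2 ^ w).

Lemma spec_sem p s T Q : spec p s T Q -> spec p s T (fun s' => Q s' /\ s' = sem p s).
Proof. by case. Qed.

Lemma w_gt1 : 1 < 2 ^ w.
Proof.
apply: leq_ltn_trans basew; apply: leq_trans m0 _; exact: leq_addl.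
Qed.

Definition fft_cost (D : nat) : nat :=
  n * 50 + D * 200 + m * 2 ^ lgb D * 100 + 800 +
  (lgk m D * ((120 * lam).+1 * 160 + 250) + 80) +
  (lgk m D * (2 ^ lgk m D * 310 + 80) + 80) +
  (cR * lam * (round_cost n m (lgk m D) (lgb D) D + 7) + 17) + 3.

Definition bad_hash (D : nat) (t : seq nat) (i : nat) : bool :=
  has_below (fun r => mism O inp n m (lgb D) (cW * lam) (nth 0 t r) i) (cR * lam).

Definition p_fft : prog :=
  (p_setup cW ;; p_roots ;; p_table ;; PFor 20 (ECst cR * $5) p_round)%P.

Lemma spec_fft D s : D < m -> (forall i, i < n -> o_degT O (inp i) <= D) ->
  env s 0 = Posz n -> env s 1 = Posz m -> env s 4 = Posz D ->
  (forall x, arr s 5 x = 0%R) -> (forall x, arr s 10 x = 0%R) ->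
  (forall r, nth 0 (itape s) r < 2 ^ w) ->
  spec p_fft s (fft_cost D) (fun s' => bad_ok s' /\
    forall i, i < n - m + 1 -> (arr s' 10 (Posz i) != 0%R) = bad_hash D (itape s) i).
Proof.
move=> Dm hdeg e0 e1 e4 z5 z10 htape.
have lp := lam_pos m0 mn; have kp := k_pos m0 mn Dm.
have sgN := sg_big_lam m0 mn Dm.
have Sw := S_fits_lam m0 mn Dm hw500.
have Llim : 2 ^ lgk m D * M D <= lim := leq_trans (Lsz_lam m0 mn Dm) hlim.
have Mp : 0 < M D by rewrite addn2.
have f0 : 0 < 120 * lam by rewrite muln_gt0 lp.
have Sf : (2 ^ (60 * lam)) ^ 2 = 2 ^ (120 * lam) by rewrite -expnM mulnAC.
have [_ [[_ _ w2 lW] _]] := setup_bounds Dm.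
have m0n : 0 < m <= n by rewrite m0.
have mBh := mB_half m0 mn Dm.
have Dw : D < 2 ^ w.
  apply: ltn_trans basew; apply: leq_trans Dm _; exact: leq_addl.
pose cr := cR * lam.
pose RC := round_cost n m (lgk m D) (lgb D) D.
pose c4 := cr * (RC + 7) + 17.
pose c3 := lgk m D * (2 ^ lgk m D * 310 + 80) + 80.
pose c2 := lgk m D * ((120 * lam).+1 * 160 + 250) + 80.
pose c1 := n * 50 + D * 200 + m * 2 ^ lgb D * 100 + 800.
apply: (spec_seq (T2 := c2 + (c3 + c4 + 1) + 1) (spec_sem (spec_setup Dm e0 e1 e4))); last first.
  by rewrite /fft_cost -/c1 -/c2 -/c3 -/RC -/cr -/c4; move: c1 c2 c3 c4 => a1 a2 a3 a4; clear; lia.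
move=> s1 fr1 [[par1 q5 q7 q13 q14] es1].
apply: (spec_seq (T2 := c3 + c4 + 1) (spec_sem (spec_roots O inp base kp Mp sgN Sw Llim limw f0 Sf par1))); last first.
  exact: leqnn.
move=> s2 fr2 [rt es2].
have par2 := fparams_frame fr2 isT par1.
apply: (spec_seq (T2 := c4) (spec_sem (spec_table O inp base kp Mp sgN Sw Llim limw par2 rt))); last first.
  exact: leqnn.
move=> s3 fr3 [tb es3].
have par3 := fparams_frame fr3 isT par2.
have tp3 : itape s3 = itape s.
  by rewrite es3 (@sem_tape O inp p_table) // es2 (@sem_tape O inp p_roots) // es1 (@sem_tape O inp (p_setup cW)).
have env3 x : x \notin writes p_table ++ writes p_roots -> env s3 x = env s1 x.
  by rewrite mem_cat negb_or => /andP [h1 h2]; rewrite (proj1 fr3) // (proj1 fr2).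
have arr3 a : a \notin [:: 1; 2; 3; 4] -> arr s3 a = arr s a.
  move=> ha.
  have h : a \notin awrites p_table ++ awrites p_roots.
    by apply: contra ha; rewrite !inE /= => h; repeat (case/orP: h => [->|h]; rewrite ?orbT //); rewrite h ?orbT.
  by move: h; rewrite mem_cat negb_or => /andP [h1 h2]; rewrite (proj2 fr3) // (proj2 fr2) // (proj2 fr1).
(* One word is consumed per round: the remaining tape tells which word drives round [r]. Rejections
   accumulate in array 10. *)
apply: (@spec_for _ _ _ _ _ _ _ _ _ cr RC _ (fun r t => [/\ mk_ok r t, bad_ok t,
   itape t = drop r (itape s) & forall i, i < n - m + 1 -> (arr t 10 (Posz i) != 0%R) =
    has_below (fun r => mism O inp n m (lgb D) (cW * lam) (nth 0 (itape s) r) i) r])) => //.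
- by rewrite /= env3 // q5 -PoszM.
- split.
  + by move=> x; rewrite arr3 // z5.
  + by move=> x; rewrite arr3 // z10.
  + by rewrite drop0.
  + by move=> i hi; rewrite arr3 // z10.
- move=> r t hr fr [hI1 hI2 hI3 hI4].
  have par : rparams n m (lgk m D) (2 ^ (60 * lam)) (120 * lam) (lgb D) (cW * lam) r (setr t 20 (Posz r)).
    split=> //=; rewrite ?(proj1 fr) //; try by rewrite env3 // ?(proj1 fr1).
    have [h1 h2 h3 h4 h5 h6] : fparams (lgk m D) (M D) (2 ^ (60 * lam)) (120 * lam) t := fparams_frame fr isT par3.
    by split.
  have tbt : tabs (lgk m D) (2 ^ (60 * lam)) (setr t 20 (Posz r)).
    by move=> p hp; rewrite /= !(proj2 fr) //; apply: tb.
  have rw : r.+1 < 2 ^ w by apply: leq_ltn_trans Rw.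
  have hd : head 0 (itape t) = nth 0 (itape s) r by rewrite hI3 -nth0 nth_drop addn0.
  apply: (spec_weaken (spec_round kp sgN Sw Llim limw m0n mBh lW Ubase hinp hnbr hdeg Dw par tbt hI1 hI2 rw hd (htape r)) (leqnn _)).
  move=> t' _ [j1 j2 j3 j4]; split=> //.
    by rewrite j3 /= hI3 -drop1 drop_drop add1n.
  by move=> i hi; rewrite j4 // hI4 // has_belowS.
- by move=> t _ [_ hI2 _ hI4]; split.
- by rewrite /c4 -addnA leq_add2l.
Qed.

Lemma spec_report s : env s 0 = Posz n -> env s 1 = Posz m -> n <= lim -> bad_ok s ->
  iout s = [::] ->
  spec p_report s (n * 50 + 40) (fun s' => forall x,
    (x \in iout s') = (x < n - m + 1) && (arr s 10 (Posz x) == 0%R)).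
Proof.
move=> e0 e1 nlim hbad hout.
have nmn : n - m + 1 <= n by move: m0 mn; clear; lia.
have ez : (Posz n - Posz m + 1)%R = Posz (n - m + 1) by rewrite subzn // -PoszD.
have nw : n < 2 ^ w by apply: leq_ltn_trans basew; apply: leq_addr.
have w1 := w_gt1; have w0 : 0 < 2 ^ w := ltnW w1.
apply: (@spec_for _ _ _ _ _ _ _ _ _ (n - m + 1) 35 _ (fun i t => forall x,
    (x \in iout t) = (x < i) && (arr s 10 (Posz x) == 0%R))) => //.
- by rewrite inw_nat; apply: leq_ltn_trans nw.
- by rewrite /= e0 e1 ez.
- by move=> x; rewrite hout.
- move=> i t hi [fr fa] hI; apply: wp_spec => //.
  have hin : i < n := leq_trans hi nmn.
  have il : i < lim := leq_trans hin nlim.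
  have iw : i < 2 ^ w := ltn_trans hin nw.
  have a10 : arr t 10 = arr s 10 by apply: fa.
  have b10 : inw (arr s 10 (Posz i)).
    by have /andP [h1 h2] := hbad i; rewrite /inw h1 /=; apply: le_lt_trans h2 _; rewrite ltz_nat.
  rewrite /= inidx_nat il a10 b10 !inw_nat w0 iw nat_boolw //; split=> //; split=> hc.
    have b0 : arr s 10 (Posz i) == 0%R by move: hc; case: (arr s 10 _ == _).
    split=> // x; rewrite inE hI ltnS [(x <= i)%N]leq_eqVlt.
    by case: (altP (x =P i)) => [->|ne] //=; rewrite b0.
  have b0 : (arr s 10 (Posz i) == 0%R) = false by move: hc; case: (arr s 10 _ == _).
  move=> x; rewrite hI ltnS [(x <= i)%N]leq_eqVlt.
  by case: (altP (x =P i)) => [->|ne] //=; rewrite b0 ?andbF.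
- rewrite /=; apply: (@leq_trans (n * 42 + 40)); last by rewrite leq_add2r leq_mul2l orbT.
  by rewrite -addnA leq_add // leq_mul2r nmn orbT.
Qed.

Definition exact_mism (i : nat) : bool :=
  has_below (fun j => ~~ o_match O (inp (i + j)) (inp (n + j))) m.

(** [Dx] is an a priori bound on degrees, used for the time; the program branches on the largest
    degree of the characters that occur in the text. The disjunction reflects its two branches. *)
Lemma spec_main s Dx T : env s 0 = Posz n -> env s 1 = Posz m ->
  (forall a x, arr s a x = 0%R) -> (forall r, nth 0 (itape s) r < 2 ^ w) -> iout s = [::] ->
  (forall i, i < n -> o_degT O (inp i) <= Dx) -> Dx < 2 ^ w ->
  (forall D, D < m -> D <= Dx -> fft_cost D <= T) ->
  (m <= Dx -> n * (m * 60 + 40) + 40 <= T) ->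
  spec (p_main cW cR) s (n * 110 + T + 100) (fun s' => exists bad,
    (forall x, (x \in iout s') = (x < n - m + 1) && ~~ bad x) /\
    ((forall i, i < n - m + 1 -> bad i = exact_mism i) \/
     maxdeg O inp n < m /\
       forall i, i < n - m + 1 -> bad i = bad_hash (maxdeg O inp n) (itape s) i)).
Proof.
move=> e0 e1 ha htape hout hdeg Dxw hT1 hT2.
have w1 := w_gt1.
set D := maxdeg O inp n.
have hDx : D <= Dx by apply/bigmax_leqP => i _; apply: hdeg.
have Dw := leq_ltn_trans hDx Dxw.
have nw : n < 2 ^ w by apply: leq_ltn_trans basew; apply: leq_addr.
have nlim : n <= lim.
  apply: leq_trans hlim; apply: (@leq_trans (2 ^ lam)); first exact/ltnW/n_lam.
  by rewrite leq_exp2l //; lia.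
have mw : m < 2 ^ w by apply: leq_ltn_trans nw.
have inpw i : i < base -> inp i < 2 ^ w.
  move=> hi; apply: leq_trans (hinp hi) _; rewrite leq_exp2l //.
  by apply/ltnW; apply: leq_ltn_trans Ubase; apply: leq_addl.
have inpw' i : i < n -> inp i < 2 ^ w.
  by move=> hi; apply: inpw; apply: leq_trans hi _; apply: leq_addr.
apply: (spec_seq (T2 := (T + 11) + (n * 50 + 40) + 1) (spec_sem (spec_maxdeg lim e0 nw (leq_addr _ _) w1 inpw' hdeg Dxw))); last first.
  by clear; lia.
move=> s1 [f1 a1] [e4 es1].
have t1 : itape s1 = itape s by rewrite es1 (@sem_tape O inp p_maxdeg).
have o1 : iout s1 = [::] by rewrite es1 (@sem_out O inp p_maxdeg).
have g0 : env s1 0 = Posz n by rewrite f1.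
have g1 : env s1 1 = Posz m by rewrite f1.
have hD i (hi : i < n) := maxdeg_ge O inp hi.
apply: (spec_seq (T1 := T + 11) (T2 := n * 50 + 40) (R := fun t => (bad_ok t /\ (
   (forall i, i < n - m + 1 -> (arr t 10 (Posz i) != 0%R) = exact_mism i) \/
   D < m /\
       forall i, i < n - m + 1 -> (arr t 10 (Posz i) != 0%R) = bad_hash D (itape s) i)) /\ iout t = [::])).
- set pif := PIf _ _ _.
  suff H : spec pif s1 (T + 11) (fun t => bad_ok t /\ (
   (forall i, i < n - m + 1 -> (arr t 10 (Posz i) != 0%R) = exact_mism i) \/
   D < m /\
       forall i, i < n - m + 1 -> (arr t 10 (Posz i) != 0%R) = bad_hash D (itape s) i)).
    case: (spec_sem H) => h1 h2 [h3 h4]; split=> //; split=> //.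
    by rewrite (@sem_out O inp pif).
  apply: (spec_if (T := T)).
  + by rewrite /= e4 g1 !inw_nat Dw mw.
  + by rewrite /= inw_nat nat_boolw.
  + rewrite /= e4 g1 ltz_nat => hc.
    have Dm : D < m by move: hc; case: (D < m).
    have z5 x : arr s1 5 x = 0%R by rewrite a1.
    have z10 x : arr s1 10 x = 0%R by rewrite a1.
    have tw r : nth 0 (itape s1) r < 2 ^ w by rewrite t1.
    apply: (spec_weaken (spec_fft Dm hD g0 g1 e4 z5 z10 tw)); first exact: hT1.
    move=> t _ [h1 h2]; split=> //; right; split=> // i hi; by rewrite -t1 h2.
  + rewrite /= e4 g1 ltz_nat => hc.
    have Dm : m <= D by rewrite leqNgt; move: hc; case: (D < m).
    have bad1 : bad_ok s1 by move=> i; rewrite a1 // ha.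
    apply: (spec_weaken (spec_naive g0 g1 nlim basew w1 inpw bad1)).
    * exact: hT2 (leq_trans Dm hDx).
    * move=> t _ [h1 h2]; split=> //; left=> i hi; by rewrite h2 // a1 // ha.
  + by rewrite /=; clear; lia.
- move=> s2 [f2 _] [[hb hr] o2].
  have k0 : env s2 0 = Posz n by rewrite f2.
  have k1 : env s2 1 = Posz m by rewrite f2.
  apply: (spec_weaken (spec_report k0 k1 nlim hb o2) (leqnn _)) => s3 _ h3.
  exists (fun x => arr s2 10 (Posz x) != 0%R); split=> // x; by rewrite h3 negbK.
- by clear; lia.
Qed.

End Main.

(** * Running time *)

(** These rules keep the shape [a <= c * y], so that unification can build the constant factor. *)
Lemma bound_add a b c d y : a <= c * y -> b <= d * y -> a + b <= (c + d) * y.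
Proof. by move=> h1 h2; rewrite mulnDl leq_add. Qed.

Lemma bound_mul a b c d y x : a <= c * y -> b <= d * x -> a * b <= (c * d) * (y * x).
Proof. by move=> h1 h2; rewrite mulnACA leq_mul. Qed.

Lemma bound_scale a c d y : a <= c * y -> a * d <= (c * d) * y.
Proof. by move=> h; rewrite mulnAC leq_mul2r h orbT. Qed.

Lemma bound_const c y : 0 < y -> c <= c * y.
Proof. by move=> h; rewrite leq_pmulr. Qed.

Lemma bound_le a c x y : a <= c * x -> x <= y -> a <= c * y.
Proof. by move=> h1 h2; apply: leq_trans h1 _; rewrite leq_mul2l h2 orbT. Qed.

Lemma lg_pos x : 0 < lg x.
Proof. by rewrite leq_max. Qed.

Lemma lt_2lg x : x < 2 ^ (lg x).+1.
Proof.
apply: leq_trans (trunc_log_ltn x (isT : 1 < 2)) _; rewrite leq_exp2l // ltnS.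
by rewrite leq_max leqnn orbT.
Qed.

Lemma lgn_lg n : lgn n <= 2 * lg n.
Proof.
apply: (@leq_trans (lg n).+1); first by apply: up_log_min => //; apply: lt_2lg.
by rewrite mul2n -addnn -addn1 leq_add2l lg_pos.
Qed.

Lemma fft_cost_bound cR : exists C, forall n m D, 0 < m -> m <= n -> D < m ->
  fft_cost n m cR D <= C * (maxn 1 D * n * lg m * lg n).
Proof.
(* The constant stays open before n, m and D are introduced; the bounding rules at the end
   instantiate it. *)
eexists=> n m D m0 mn Dm.
have n0 : 0 < n := leq_trans m0 mn.
have [X eX] : exists X, X = maxn 1 D * n by eexists.
rewrite -eX.
have X0 : 0 < X by rewrite eX muln_gt0 n0 leq_max.
have nX : n <= 1 * X by rewrite eX mul1n leq_pmull // leq_max.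
have mX : m <= 1 * X := leq_trans mn nX.
have DX : D <= 1 * X by rewrite eX mul1n; apply: (@leq_trans (maxn 1 D)); [rewrite leq_max leqnn orbT|rewrite leq_pmulr].
have D1 : D <= maxn 1 D by rewrite leq_max leqnn orbT.
have B9 : 2 ^ lgb D <= 9 * maxn 1 D.
  have := B_D D; move: D1; have : 1 <= maxn 1 D by rewrite leq_max.
  by generalize (maxn 1 D) (2 ^ lgb D); clear; lia.
have nB : n * 2 ^ lgb D <= 9 * X.
  by rewrite eX mulnA mulnC leq_mul2r B9 orbT.
have mB : m * 2 ^ lgb D <= 9 * X by apply: leq_trans nB; rewrite leq_mul2r mn orbT.
have N36 : 2 ^ lgk m D <= 36 * X.
  have := N_mB D m0; rewrite -(mulnA 2 m).
  by move: mB; generalize (m * 2 ^ lgb D) (2 ^ lgk m D); clear; lia.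
have L90 : 2 ^ lgk m D * (n * 2 ^ lgb D %/ 2 ^ (lgk m D).-1 + 2) <= 90 * X.
  apply: leq_trans (Lsz_le m0 mn Dm) _.
  by move: nB N36; generalize (n * 2 ^ lgb D) (2 ^ lgk m D); clear; lia.
(* Here D < m is essential: it gives 2 ^ l <= 8 m, so 2 ^ k < 4 m 2 ^ l <= 32 m ^ 2. *)
have k9 : lgk m D <= 9 * lg m.
  apply: (@leq_trans (7 + 2 * lg m)); last by have := lg_pos m; generalize (lg m); clear; lia.
  rewrite -ltnS -(ltn_exp2l _ _ (isT : 1 < 2)).
  have hB : 2 ^ lgb D <= 8 * m by have := B_D D; move: Dm; generalize (2 ^ lgb D); clear; lia.
  apply: leq_trans (N_mB D m0) _.
  apply: (@leq_trans (2 ^ 5 * (m * m))).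
    rewrite -(mulnA 2 m); apply: (@leq_trans (4 * (m * (8 * m)))).
      by rewrite mulnA leq_mul2l leq_mul2l hB !orbT.
    by clear; lia.
  have -> : (7 + 2 * lg m).+1 = 5 + ((lg m).+1 + (lg m).+1) + 1 by generalize (lg m); clear; lia.
  apply: (@leq_trans (2 ^ (5 + ((lg m).+1 + (lg m).+1)))); last by rewrite leq_exp2l // leq_addr.
  rewrite expnD leq_mul2l (expnD 2 (lg m).+1) leq_mul ?orbT //; exact/ltnW/lt_2lg.
have l2 := lgn_lg n.
have lm0 := lg_pos m; have ln0 := lg_pos n.
have XY : X <= X * lg m * lg n by rewrite -mulnA leq_pmulr // muln_gt0 lm0.
have XM : X <= X * lg m by rewrite leq_pmulr.
have XMY : X * lg m <= X * lg m * lg n by rewrite leq_pmulr.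
have MNY : lg m * lg n <= X * lg m * lg n by rewrite -mulnA leq_pmull.
have MXY : lg m * X <= X * lg m * lg n by rewrite mulnC.
have mln : 0 < lg m * lg n by rewrite muln_gt0 lm0.
have kX j c d : j <= c * X -> lgk m D * j <= (9 * c) * (X * lg m).
  by move=> h; rewrite (mulnC X); apply: bound_mul.
have t1 : n * 50 + D * 200 + m * 2 ^ lgb D * 100 + 800 <= (1 * 50 + 1 * 200 + 9 * 100 + 800) * X.
  by do !apply: bound_add; do ?apply: bound_scale => //; apply: bound_const.
have t2 : lgk m D * ((120 * lgn n).+1 * 160 + 250) + 80 <=
   (9 * ((120 * 2 + 1) * 160 + 250) + 80) * (lg m * lg n).
  apply: bound_add; last exact: bound_const.
  apply: bound_mul => //; apply: bound_add; last exact: bound_const.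
  apply: bound_scale; rewrite -addn1; apply: bound_add; last exact: bound_const.
  by rewrite -mulnA leq_mul2l.
have t3 : lgk m D * (2 ^ lgk m D * 310 + 80) + 80 <= (9 * (36 * 310 + 80) + 80) * (X * lg m).
  apply: bound_add; last by apply: bound_const; rewrite muln_gt0 X0.
  apply: kX; apply: bound_add; last exact: bound_const.
  exact: bound_scale.
have rc : round_cost n m (lgk m D) (lgb D) D + 7 <=
  (140 + 90 * 600 + 1 * 150 + 9 * (90 * 1580 + 160) + 1 * 170 + 300 + 7) * (X * lg m).
  rewrite /round_cost; apply: bound_add; last by apply: bound_const; rewrite muln_gt0 X0.
  apply: bound_add; last by apply: bound_const; rewrite muln_gt0 X0.
  apply: bound_add; last by apply: bound_le XM; apply: bound_scale.
  apply: bound_add; last first.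
    by apply: kX; apply: bound_add; [exact: bound_scale|exact: bound_const].
  apply: bound_add; last by apply: bound_le XM; apply: bound_scale.
  apply: bound_add; last by apply: bound_le XM; apply: bound_scale.
  apply: bound_le XM; rewrite eX mulnA mulnC leq_mul2r; apply/orP; right.
  have h1 : 1 <= maxn 1 D by rewrite leq_max.
  by apply: (@bound_add _ _ 90 50); [rewrite mulnC leq_mul2l D1 orbT|exact: bound_const].
rewrite /fft_cost.
apply: bound_add; last by apply: bound_const; apply: leq_trans XY.
apply: bound_add; last first.
  apply: bound_add; last by apply: bound_const; apply: leq_trans XY.
  rewrite (mulnC (X * lg m)); apply: bound_mul rc.
  have hR : cR * lgn n <= (cR * 2) * lg n by rewrite -mulnA leq_mul2l l2 orbT.
  exact: hR.
apply: bound_add; last by apply: bound_le t3 XMY.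
apply: bound_add; last by apply: bound_le t2 MNY.
by apply: bound_le t1 XY.
Qed.

(** * From hash values to occurrences *)

Section Matching.

Variables (n m sT sP : nat).
Variables (T : n.-tuple 'I_sT) (P : m.-tuple 'I_sP) (M : 'I_sT -> 'I_sP -> bool).
Variable nbr : 'I_sT -> seq 'I_sP.
Hypotheses (m0 : 0 < m) (mn : m <= n) (hnb : neighbour_order M nbr).

Local Notation O := (gpm_oracle M nbr).
Local Notation inp := (nth 0 (map val T ++ map val P)).

Lemma inp_text i (k : 'I_n) : val k = i -> inp i = val (tnth T k).
Proof. by move<-; rewrite nth_cat size_map size_tuple ltn_ord -tnth_nth tnth_map. Qed.

Lemma inp_pat j0 (j : 'I_m) : val j = j0 -> inp (n + j0) = val (tnth P j).
Proof.
by move<-; rewrite nth_cat size_map size_tuple ltnNge leq_addr /= addKn -tnth_nth tnth_map.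
Qed.

Lemma size_nbr a : size (nbr a) = degT M a.
Proof.
have [u e] := hnb a; rewrite /degT -(card_uniqP u); apply: eq_card => b.
by rewrite inE e.
Qed.

Lemma o_degT_max a : o_degT O a <= max_degree M.
Proof.
rewrite /=; case: insub => [b|] //; rewrite leq_max; apply/orP; left.
exact: (leq_bigmax (F := degT M)).
Qed.

Lemma o_nbr_lt V a q : sP <= V -> 0 < V -> o_nbr O a q < V.
Proof.
move=> h V0; rewrite /=; case: insub => [b|] //.
case: (ltnP q (size (nbr b))) => hq; last by rewrite nth_default ?size_map.
have : nth 0 (map val (nbr b)) q \in map val (nbr b) by rewrite mem_nth // size_map.
by case/mapP => x _ ->; apply: leq_trans (ltn_ord x) h.
Qed.

Lemma degT_le a : degT M a <= sP.
Proof. by rewrite /degT (leq_trans (max_card _)) // card_ord. Qed.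

Lemma max_degree_le : max_degree M <= maxn sT sP.
Proof.
rewrite geq_max; apply/andP; split; apply/bigmax_leqP => a _; rewrite leq_max.
  by rewrite degT_le orbT.
by apply/orP; left; apply: leq_trans (max_card _) _; rewrite card_ord.
Qed.

Lemma inp_lt V i : sT <= V -> sP <= V -> 0 < V -> inp i < V.
Proof.
move=> hT hP V0; case: (ltnP i (n + m)) => hi; last first.
  by rewrite nth_default // size_cat !size_map !size_tuple.
case: (ltnP i n) => h1.
  by rewrite (@inp_text i (Ordinal h1) erefl); apply: leq_trans (ltn_ord _) hT.
have h2 : i - n < m by rewrite ltn_subLR.
by rewrite -(subnKC h1) (@inp_pat _ (Ordinal h2) erefl); apply: leq_trans (ltn_ord _) hP.
Qed.

Lemma text_pos i j : i < n - m + 1 -> j < m -> i + j < n.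
Proof. by move: mn; lia. Qed.

Lemma occurrenceP i : i < n - m + 1 ->
  reflect (forall (j : 'I_m) (k : 'I_n), val k = i + j -> M (tnth T k) (tnth P j))
    (occurrence T P M i).
Proof.
move=> hi; rewrite /occurrence hi /=; apply: (iffP forallP) => h j.
  by move=> k e; have /forallP /(_ k) := h j; rewrite -e eqxx.
by apply/forallP => k; apply/implyP => /eqP e; apply: h.
Qed.

Lemma exact_mism_occurrence i : i < n - m + 1 ->
  exact_mism O inp n m i = ~~ occurrence T P M i.
Proof.
move=> hi; apply/idP/idP.
  case/hasP => j; rewrite mem_iota add0n => /andP [_ hj] hM.
  apply/negP => /(occurrenceP hi) h; case/negP: hM.
  have hk := text_pos hi hj.
  rewrite (@inp_text (i + j) (Ordinal hk) erefl) (@inp_pat j (Ordinal hj) erefl) /= !valK.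
  exact: (h (Ordinal hj) (Ordinal hk)).
apply: contraR => hM; apply/(occurrenceP hi) => j k e.
apply: contraR hM => hM; apply/hasP; exists (val j); first by rewrite mem_iota /= ltn_ord.
by rewrite (inp_text e) (@inp_pat j j erefl) /= !valK.
Qed.

(** A matching pattern character is itself a listed neighbour, so its hash value is marked whatever
    [rho] is. This makes the error one-sided. *)
Lemma occurrence_mism l W rho i : i < n - m + 1 -> occurrence T P M i ->
  mism O inp n m l W rho i = false.
Proof.
move=> hi /(occurrenceP hi) h; apply/negbTE/hasPn => j; rewrite mem_iota add0n => /andP [_ hj].
have hk := text_pos hi hj.
have := h (Ordinal hj) (Ordinal hk) erefl.
rewrite /marked /= (@inp_text (i + j) (Ordinal hk) erefl) (@inp_pat j (Ordinal hj) erefl) !valK.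
move: (tnth T _) (tnth P _) => a b hab; rewrite negbK.
have hb : b \in nbr a by rewrite (hnb a).2.
apply/hasP; exists (index b (nbr a)); last by rewrite (nth_map b) ?nth_index ?index_mem.
by rewrite mem_iota /= -size_nbr index_mem.
Qed.

(** One mismatching pair is fixed per shift before any word is drawn. Surviving a round forces a
    collision at this pair, so survival of all rounds is bounded by a product over the words. *)
Definition mismatch_pair (i : nat) : option ('I_n * 'I_m) :=
  [pick jk : 'I_n * 'I_m | (val jk.1 == i + jk.2) && ~~ M (tnth T jk.1) (tnth P jk.2)].

Definition collides (l W i rho : nat) : bool :=
  if mismatch_pair i is Some (k, j) then
    has (fun x => mshash W l rho x == mshash W l rho (val (tnth P j)))
      (map val (nbr (tnth T k)))
  else false.

Lemma mism_collides l W rho i : i < n - m + 1 -> ~~ occurrence T P M i ->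
  ~~ mism O inp n m l W rho i -> collides l W i rho.
Proof.
move=> hi hocc hmis; rewrite /collides /mismatch_pair; case: pickP => [[k j] /= /andP [/eqP e hM]|h].
  move: hmis; rewrite -all_predC => /allP /(_ (val j)).
  rewrite mem_iota /= ltn_ord => /(_ isT); rewrite negbK => /hasP [q].
  rewrite mem_iota add0n (inp_text e) (@inp_pat j j erefl) /= !valK -size_nbr => hq he.
  by apply/hasP; exists (nth 0 (map val (nbr (tnth T k))) q); rewrite // mem_nth ?size_map.
case/negP: hocc; apply/(occurrenceP hi) => j k e.
by have := h (k, j); rewrite /= e eqxx /= => /negbFE.
Qed.

Lemma card_collides w l W U i : W <= w -> l + U <= W -> sP <= 2 ^ U ->
  4 * maxdeg O inp n + 1 <= 2 ^ l ->
  #|[set rho : 'I_(2 ^ w) | collides l W i rho]| * 2 <= 2 ^ w.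
Proof.
move=> hW hl hP hD; rewrite /collides /mismatch_pair; case: pickP => [[k j] /= /andP [_ hM]|_]; last first.
  by rewrite (_ : [set _ | false] = set0) ?cards0 //; apply/setP => x; rewrite !inE.
apply: (mshash_has_collision hW hl).
- exact: leq_trans (ltn_ord _) hP.
- by apply/allP => x /mapP [b _ ->]; apply: leq_trans (ltn_ord _) hP.
- by rewrite mem_map; [rewrite (hnb _).2|exact: val_inj].
- rewrite size_map size_nbr; apply: leq_trans hD.
  have := maxdeg_ge O inp (ltn_ord k); rewrite (@inp_text k k erefl) /= valK.
  by move: (degT _ _) (maxdeg _ _ _); clear; lia.
Qed.

End Matching.

Definition char_bits (K n : nat) : nat := 2 * K * lgn n.
(** Makes W large enough for the at most lgn n + 2 bits of a hash value and the 2 K lgn n bits of a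
    character, as [mshash_collision] asks. *)
Definition hash_words (K : nat) : nat := 2 * K + 3.
Definition gpm_cmd (c K : nat) : cmd :=
  CSeq (CDo (IBin BAdd 99 0 1)) (comp (p_main (hash_words K) c.+1)).

(** A halted configuration is stationary, so a run of exactly t steps shows the state reached
    earlier. *)
Lemma iter_halted w O c s s' u t : u <= t -> steps w O c s u s' ->
  iter t (step w O) ([:: c], s) = ([::], s').
Proof. by move=> h st; rewrite -(subnK h) iterD st; elim: (t - u) => //= j ->. Qed.

Section Machine.

Variables (c K n m sT sP w : nat).
Variables (T : n.-tuple 'I_sT) (P : m.-tuple 'I_sP) (M : 'I_sT -> 'I_sP -> bool).
Variable nbr : 'I_sT -> seq 'I_sP.
Hypotheses (m0 : 0 < m) (mn : m <= n) (hnb : neighbour_order M nbr).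
Hypotheses (hT : sT <= K * n ^ K) (hP : sP <= K * n ^ K).
Hypothesis hw : (4 * K + 506 + c.+1) * lgn n <= w.

Local Notation O := (gpm_oracle M nbr).
Local Notation inp := (nth 0 (map val T ++ map val P)).
Local Notation U := (char_bits K n).
Local Notation cW := (hash_words K).
Local Notation lam := (lgn n).
Local Notation lim := (2 ^ (w - 5)).

Lemma alphabet_bits : K * n ^ K <= 2 ^ U.
Proof.
rewrite /char_bits (_ : 2 * K * lam = K * lam + lam * K); last by clear; lia.
rewrite expnD leq_mul //; last by case: (posnP K) => [->|K0]; rewrite ?muln0 // (expnM 2) leq_exp2r // ltnW // n_lam.
apply: leq_trans (ltnW (ltn_expl K (isT : 1 < 2))) _; rewrite leq_exp2l //.
by rewrite leq_pmulr // (lam_pos m0 mn).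
Qed.

Lemma w_sides : [/\ (2 * cW + 500) * lam <= w, cW * lam + U < w & 506 <= w].
Proof.
have l0 := lam_pos m0 mn; move: hw; rewrite /hash_words /char_bits; move: l0.
by generalize (lgn n); clear => x h1 h2; split; nia.
Qed.

(** Sixteen arrays of size 2 ^ (w - 5) fill half of the address space; shifting them beyond the
    input takes at most the other half. *)
Lemma mem_side : 16 * (n + m + lim) <= 2 ^ w.
Proof.
have [h1 _ h2] := w_sides; have l0 := lam_pos m0 mn.
have e : 2 ^ w = 32 * lim by rewrite -(expnD 2 5) subnKC //; apply: leq_trans h2.
have h3 : n + m <= lim.
  apply: (@leq_trans (2 ^ lam.+1)).
    by have := n_lam n; move: mn; rewrite expnS; generalize (2 ^ lam); clear; lia.
  by rewrite leq_exp2l //; move: h1 l0; clear; nia.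
by rewrite e; move: h3; generalize lim; clear; lia.
Qed.

Definition init_ist (rnd : seq nat) : ist :=
  IS (fun x => Posz (nth 0 [:: n; m; sT; sP] x)) (fun _ _ => 0%R) rnd [::].

Lemma rel_init rnd :
  rel w inp (n + m) lim (init_ist rnd)
    (exec w O (IBin BAdd 99 0 1) (init T P rnd)).
Proof.
have [h1 h2 h3] := w_sides.
have hU : 2 ^ U < 2 ^ w by rewrite ltn_exp2l //; apply: leq_ltn_trans h2; apply: leq_addl.
have bw : n + m < 2 ^ w.
  apply: leq_trans mem_side; rewrite mulnDr; have : 0 < lim by rewrite expn_gt0.
  generalize lim; clear; lia.
have aw : maxn sT sP < 2 ^ w.
  by apply: leq_ltn_trans hU; rewrite geq_max !(leq_trans _ alphabet_bits).
split=> //=.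
- move=> x hx; rewrite ifN; last by apply: contraTneq hx => ->.
  rewrite rep_nat modn_small //; move: aw bw; rewrite gtn_max => /andP [a1 a2] b1.
  by case: x {hx} => [|[|[|[|x]]]] //=; rewrite ?nth_nil //; move: b1; clear; lia.
- by rewrite modn_small.
- move=> a i ha hi; rewrite nth_default ?rep_nat ?mod0n //.
  by rewrite size_cat !size_map !size_tuple; move: m0; clear; lia.
Qed.

Lemma gpm_cmd_run (t Dx Tm : nat) (rnd : t.-tuple 'I_(2 ^ w)) :
  (forall i, i < n -> o_degT O (inp i) <= Dx) -> Dx < 2 ^ w ->
  (forall D, D < m -> D <= Dx -> fft_cost n m c.+1 D <= Tm) ->
  (m <= Dx -> n * (m * 60 + 40) + 40 <= Tm) ->
  n * 110 + Tm + 102 <= t ->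
  halts T P M nbr (gpm_cmd c K) rnd /\
  exists bad,
    (forall x, (x \in report T P M nbr (gpm_cmd c K) rnd) = (x < n - m + 1) && ~~ bad x) /\
    ((forall i, i < n - m + 1 -> bad i = exact_mism O inp n m i) \/
     maxdeg O inp n < m /\ forall i, i < n - m + 1 ->
       bad i = bad_hash O inp n m cW c.+1 (maxdeg O inp n) (map val rnd) i).
Proof.
move=> hdeg Dxw h1 h2 ht.
have [s1 s2 s3] := w_sides.
have cW3 : 2 < cW := leq_addl _ _.
have w0 : 0 < 2 ^ w by rewrite expn_gt0.
have lw : 2 ^ (2 * lam + 5) <= lim.
  rewrite leq_exp2l //; move: s1 (lam_pos m0 mn); generalize lam; clear; nia.
have limw : lim < 2 ^ w by rewrite ltn_exp2l //; move: s3; clear; lia.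
have bw : n + m < 2 ^ w.
  apply: leq_trans mem_side; rewrite mulnDr; have : 0 < lim by rewrite expn_gt0.
  generalize lim; clear; lia.
have hinp i : i < n + m -> inp i < 2 ^ U.
  by move=> _; apply: inp_lt; rewrite ?expn_gt0 // (leq_trans _ alphabet_bits).
have hnbr a q : o_nbr O a q < 2 ^ U.
  by apply: o_nbr_lt; rewrite ?expn_gt0 // (leq_trans _ alphabet_bits).
have Rw : c.+1 * lam < 2 ^ w.
  apply: leq_ltn_trans (ltn_expl w (isT : 1 < 2)); apply: leq_trans hw.
  by rewrite leq_mul2r leq_addl orbT.
have htape r : nth 0 (map val rnd) r < 2 ^ w.
  case: (ltnP r (size (map val rnd))) => hr; last by rewrite nth_default.
  have /mapP [x _ ->] := mem_nth 0 hr; exact: ltn_ord.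
have [ok1 cost1 [bad [hb1 hb2]]] := @spec_main w O inp n m lim cW m0 mn cW3 s1 U c.+1 s2 lw limw
  bw hinp hnbr Rw (init_ist (map val rnd)) Dx Tm erefl erefl (fun _ _ => erefl) htape erefl hdeg Dxw h1 h2.
have base0 : 0 < n + m by rewrite addn_gt0 m0 orbT.
have b16 : 16 < 2 ^ w by rewrite (@ltn_exp2l 2 4) //; move: s3; clear; lia.
have [m' [st [_ _ _ _ [_ eo]] _]] := comp_correct base0 mem_side b16 (wf_main _ _) ok1 (rel_init (map val rnd)).
set cst := cost _ _ _ _ in st cost1.
have st2 := steps_seq (steps_do w O (IBin BAdd 99 0 1) (init T P (map val rnd))) st.
have hrun : run w O (gpm_cmd c K) (init T P (map val rnd)) t = ([::], m').
  have hle : 1 + cst + 1 <= t by move: ht cost1; clear; lia.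
  exact: iter_halted hle st2.
rewrite /halts /report /gpm_run hrun /=; split=> //.
by exists bad; split=> // x; rewrite eo hb1.
Qed.

End Machine.

(* The alphabet sizes are bounded by the polynomial K * n ^ K, and words have
   at least Cw * log n bits. *)
Theorem theorem3p1 (c K : nat) :
  exists (p : cmd) (Cw Ct : nat),
  forall (n m sT sP w : nat)
    (T : n.-tuple 'I_sT) (P : m.-tuple 'I_sP) (M : 'I_sT -> 'I_sP -> bool)
    (nbr : 'I_sT -> seq 'I_sP),
  0 < m <= n ->
  sT <= K * n ^ K ->
  sP <= K * n ^ K ->
  Cw * lg n <= w ->
  neighbour_order M nbr ->
  let t := Ct * (maxn 1 (max_degree M) * n * lg m * lg n) in
  (forall rnd : t.-tuple 'I_(2 ^ w),
     [/\ halts T P M nbr p rnd,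
         valid_report n m (report T P M nbr p rnd)
       & no_false_negative T P M (report T P M nbr p rnd)]) /\
  (uniform_prob [set rnd : t.-tuple 'I_(2 ^ w) |
                 ~~ correct_report T P M (report T P M nbr p rnd)]
   <= 1 / n%:R ^+ c)%R.
Proof.
have [C hC] := fft_cost_bound c.+1.
(* The factor 2 converts [lgn] into [lg]. In the time, 140 pays for the naive search, 110 and 102
   for the maximum degree, the report and fixed overhead; the last summand makes the tape at least
   (c + 1) lgn n words long. *)
exists (gpm_cmd c K), ((4 * K + 506 + c.+1) * 2), (110 + (C + 140) + 102 + c.+1 * 2).
move=> n m sT sP w T P M nbr /andP [m0 mn] hT hP hw0 hnb t.
have n0 : 0 < n := leq_trans m0 mn.
have hw : (4 * K + 506 + c.+1) * lgn n <= w.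
  by apply: leq_trans hw0; rewrite -mulnA leq_mul2l lgn_lg orbT.
set Dx := max_degree M in t *.
have lm0 := lg_pos m; have ln0 := lg_pos n.
have Y0 : 0 < maxn 1 Dx * n by rewrite muln_gt0 n0 leq_max.
have XY : maxn 1 Dx * n <= maxn 1 Dx * n * lg m * lg n.
  by rewrite -mulnA leq_pmulr // muln_gt0 lm0.
have [Y eY] : exists Y, Y = maxn 1 Dx * n * lg m * lg n by eexists.
have nY : n <= Y by rewrite eY; apply: leq_trans XY; rewrite leq_pmull // leq_max.
have lY : lg n <= Y by rewrite eY leq_pmull // muln_gt0 Y0.
have et : t = (110 + (C + 140) + 102 + c.+1 * 2) * Y by rewrite eY.
have ht : n * 110 + (C + 140) * Y + 102 <= t.
  rewrite et; move: nY n0; clear; nia.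
have hR : c.+1 * lgn n <= t.
  apply: (@leq_trans (c.+1 * 2 * Y)); last by rewrite et leq_mul2r leq_addl orbT.
  by rewrite -mulnA leq_mul2l (leq_trans (lgn_lg n)) ?leq_mul2l ?lY ?orbT.
have [w1 w2 w3] := w_sides m0 mn hw.
have hU := alphabet_bits K m0 mn.
have Uw : 2 ^ char_bits K n < 2 ^ w by rewrite ltn_exp2l //; apply: leq_ltn_trans w2; apply: leq_addl.
have Dxw : Dx < 2 ^ w.
  by apply: leq_ltn_trans (max_degree_le M) (leq_ltn_trans _ Uw); rewrite geq_max !(leq_trans _ hU).
have h1 D : D < m -> D <= Dx -> fft_cost n m c.+1 D <= (C + 140) * Y.
  move=> hD1 hD2; apply: leq_trans (hC _ _ _ m0 mn hD1) _.
  rewrite mulnDl; apply: leq_trans (leq_addr _ _); rewrite eY.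
  have hmax : maxn 1 D <= maxn 1 Dx by rewrite geq_max leq_maxl leq_max hD2 orbT.
  by rewrite leq_mul2l !leq_mul2r hmax !orbT.
have h2 : m <= Dx -> n * (m * 60 + 40) + 40 <= (C + 140) * Y.
  move=> hm; rewrite mulnDl; apply: leq_trans (leq_addl _ _).
  have : n * m <= Y.
    by rewrite eY; apply: leq_trans XY; rewrite mulnC leq_mul2r leq_max hm !orbT.
  by move: nY n0; clear; nia.
have hrun (rnd : t.-tuple 'I_(2 ^ w)) :=
  @gpm_cmd_run c K n m sT sP w T P M nbr m0 mn hT hP hw t Dx _ rnd
  (fun i _ => o_degT_max M nbr _) Dxw h1 h2 ht.
have hmiss (rnd : t.-tuple 'I_(2 ^ w)) i : i < n - m + 1 -> occurrence T P M i ->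
    i \in report T P M nbr (gpm_cmd c K) rnd.
  move=> hi hocc; have [_ [bad [-> hbad]]] := hrun rnd; rewrite hi /=.
  case: hbad => [-> //|[_ -> //]]; first by rewrite exact_mism_occurrence // hocc.
  apply/hasPn => r _; exact/negbT/occurrence_mism.
split.
  move=> rnd; have [hh [bad [hb _]]] := hrun rnd; split=> //.
    by apply/allP => x; rewrite hb => /andP [].
  by apply/forallP => i; apply/implyP => /hmiss; apply.
set E := [set _ | _].
set D := maxdeg (gpm_oracle M nbr) (nth 0 (map val T ++ map val P)) n.
set W := hash_words K * lgn n.
have [Dm|mD] := ltnP D m; last first.
  (* With D >= m the naive search has been run, and no tape leads to an error. *)
  rewrite (_ : E = set0) ?/uniform_prob ?cards0 ?mul0r ?divr_ge0 ?ler0n ?exprn_ge0 ?ler0n //.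
  apply/setP => rnd; rewrite in_set in_set0; apply: negbTE; rewrite negbK; apply/forallP => i.
  have [_ [bad [-> [hbad|[]]]]] := hrun rnd; last by rewrite ltnNge mD.
  by rewrite ltn_ord /= hbad // exact_mism_occurrence // negbK.
pose coll i rho := collides T P M nbr (lgb D) W i rho.
pose S (i : 'I_(n - m + 1)) := [set rnd : t.-tuple 'I_(2 ^ w) |
  [forall r : 'I_t, (r < c.+1 * lgn n) ==> coll i (tnth rnd r)]].
apply: (@uniform_prob_le _ _ (c.+1 * lgn n) _ _ _ E S) => //.
- by rewrite expn_gt0.
- by rewrite card_ord; move: m0 mn; clear; lia.
- by rewrite mulnC (expnM 2) leq_exp2r // ltnW // n_lam.
- move=> i; apply: (card_tuple_all (P := fun rho => coll i rho)) => //.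
  apply: (@card_collides _ _ _ _ _ _ _ _ hnb _ _ _ (char_bits K n)).
  + by apply: leq_trans (ltnW w2); apply: leq_addr.
  + have := l_lam m0 mn Dm; have := lam_pos m0 mn.
    by rewrite /W /hash_words /char_bits; generalize (lgb D) (lgn n); clear; nia.
  + exact: leq_trans hP hU.
  + exact: D_B.
(* No occurrence is missed, so a wrong answer at [i] is a non-occurrence that no round rejected: its
   fixed pair collides under each of the first (c + 1) lgn n words. *)
- move=> rnd; rewrite inE => /forallPn [i]; have [_ [bad [-> hbad]]] := hrun rnd.
  rewrite ltn_ord /= => hne; exists i; rewrite inE; apply/forallP => r; apply/implyP => hr.
  case: hbad => [hbad|[_ hbad]].
    by move: hne; rewrite hbad // exact_mism_occurrence // negbK eqxx.
  have hi := ltn_ord i; have hocc : ~~ occurrence T P M i.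
    apply: contra hne => hocc; rewrite hbad // hocc eqb_id.
    by apply/hasPn => j _; apply/negbT/occurrence_mism.
  apply: mism_collides => //; apply: contra hne => hmis.
  rewrite hbad // (negbTE hocc) eqbF_neg negbK.
  apply/hasP; exists (val r); first by rewrite mem_iota.
  have -> : nth 0 (map val rnd) r = val (tnth rnd r) by rewrite -tnth_nth tnth_map.
  exact: hmis.
Qed.
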